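(* Let $\mu\in(0,1)$, let $V_\mu\subset E_\mu$ be open, and suppose the following two hypotheses hold. (1) $(A,F_1): V_\mu\to \mathcal{M}_\mu(E_1,E_0)\times E_0$ is locally Lipschitz continuous (with $\mathcal{M}_\mu(E_1,E_0)$ carrying the norm of $\mathcal{L}(E_1,E_0)$). (2) There is a number $\beta\in(\mu,1)$ such that $F_2:V_\mu\cap E_\beta\to E_0$, and there are $m\in\mathbb{N}$ and numbers $\beta_j\in[\mu,\beta]$, $\rho_j\ge 0$ with $$\frac{\rho_j(\beta-\mu)+(\beta_j-\mu)}{1-\mu}\le 1\qquad\text{for all } j=1,\dots,m,$$ such that for each $x_0\in V_\mu$ and $R>0$ there is a constant $C_R=C_R(x_0)>0$ for which $$|F_2(x_1)-F_2(x_2)|_{E_0}\le C_R\sum_{j=1}^m\big(1+|x_1|_{E_\beta}^{\rho_j}+|x_2|_{E_\beta}^{\rho_j}\big)|x_1-x_2|_{E_{\beta_j}}$$ holds for all $x_1,x_2\in\bar B_{E_\mu}(x_0,R)\cap(V_\mu\cap E_\beta)$. Let $\bar\mu\in[\beta,1)$ and suppose $u_*\in V_\mu\cap E_1$ is an equilibrium of $$\dot u+A(u)u=F_1(u)+F_2(u)\ \text{ for } t>0,\qquad u(0)=x, \tag{P}$$ i.e. $A(u_* )u_*=F_1(u_* )+F_2(u_* )$. Then $u_*$ is stable in the topology of $E_\mu$ if and only if $u_*$ is stable in the topology of $E_{\bar\mu}$.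
   Context: $E_0,E_1$ are Banach spaces with $E_1$ continuously and densely embedded in $E_0$. For $\theta\in(0,1)$, $E_\theta:=(E_0,E_1)^0_{\theta,\infty}$ is the continuous interpolation space (the closure of $E_1$ in the real interpolation space $(E_0,E_1)_{\theta,\infty}$). $B_E(x,R)$ and $\bar B_E(x,R)$ are the open and closed balls in $E$. For a Banach space $E$, $\mu\in(0,1)$, $J=[0,T]$, $\dot J=(0,T]$: $$BC_{1-\mu}(J,E):=\{v\in C(\dot J,E): [t\mapsto t^{1-\mu}v(t)]\in BC(\dot J,E),\ \lim_{t\to0^+}|t^{1-\mu}v(t)|_E=0\},$$ $$BC^1_{1-\mu}(J,E):=\{v\in C^1(\dot J,E): v,\dot v\in BC_{1-\mu}(J,E)\}.$$ Set $\mathbb{E}_{0,\mu}(J):=BC_{1-\mu}(J,E_0)$ and $\mathbb{E}_{1,\mu}(J):=BC^1_{1-\mu}(J,E_0)\cap BC_{1-\mu}(J,E_1)$. Functions in $\mathbb{E}_{1,\mu}(J)$ extend continuously to $t=0$ with values in $E_0$. $\mathcal{M}_\mu(E_1,E_0)$ is the set of all $B\in\mathcal{L}(E_1,E_0)$ such that, for some (hence all) $T>0$ and $J=[0,T]$: for every $(f,x)\in\mathbb{E}_{0,\mu}(J)\times E_\mu$ there is a unique $u\in\mathbb{E}_{1,\mu}(J)$ with $\dot u(t)+Bu(t)=f(t)$ for $t\in\dot J$ and $u(0)=x$. A solution of (P) on $[0,T]$ is a function $u\in\mathbb{E}_{1,\mu}([0,T])$ with values in $V_\mu$ satisfying the equation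 on $(0,T]$ and $u(0)=x$. Under the hypotheses, (P) has for each $x\in V_\mu$ a unique maximal solution $u(\cdot,x)$ on some $[0,t^+(x))$; it exists globally if $t^+(x)=\infty$. For $\nu\in\{\mu,\bar\mu\}$, $u_*$ is stable in (the topology of) $E_\nu$ if for every $\varepsilon>0$ there is $\delta>0$ such that every solution of (P) with initial value $x_0\in B_{E_\nu}(u_*,\delta)$ exists globally and satisfies $|u(t,x_0)-u_*|_{E_\nu}<\varepsilon$ for all $t\ge0$. *)

(* Defs.v *)
From HB Require Import structures.
From mathcomp Require Import all_boot all_order all_algebra.
From mathcomp Require Import all_classical all_reals all_analysis.
Set Implicit Arguments.
Unset Strict Implicit.
Unset Printing Implicit Defensive.
Import Order.TTheory GRing.Theory Num.Theory.
Import numFieldNormedType.Exports.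
Local Open Scope classical_set_scope.
Local Open Scope ring_scope.

(* The inclusion of E1 in E0 is an injective linear map [j]; intermediate
   spaces are subsets of E0 with their own norm. *)
Definition dense_embedding (R : realType) (E0 E1 : completeNormedModType R)
    (j : {linear E1 -> E0}) : Prop :=
  [/\ injective j, continuous j & dense (range j)].

(* Peetre's K-functional; E0 + E1 = E0. *)
Definition Kfun (R : realType) (E0 E1 : completeNormedModType R)
    (j : {linear E1 -> E0}) (t : R) (x : E0) : R :=
  inf [set r | exists a : E0, exists b : E1,
                 x = a + j b /\ r = `|a| + t * `|b|].

Definition Kvalues (R : realType) (E0 E1 : completeNormedModType R)
    (j : {linear E1 -> E0}) (theta : R) (x : E0) : set R :=
  [set t `^ (- theta) * Kfun j t x | t in `]0, +oo[].

(* The space (E0, E1)_{theta, oo}. *)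
Definition real_interp (R : realType) (E0 E1 : completeNormedModType R)
    (j : {linear E1 -> E0}) (theta : R) : set E0 :=
  [set x | has_ubound (Kvalues j theta x)].

(* Its norm; meaningful only on [real_interp j theta] ([sup] is 0 on sets that
   are not bounded above). *)
Definition inorm (R : realType) (E0 E1 : completeNormedModType R)
    (j : {linear E1 -> E0}) (theta : R) (x : E0) : R :=
  sup (Kvalues j theta x).

(* E_theta = (E0, E1)^0_{theta, oo}: the closure of E1 in
   (E0, E1)_{theta, oo}, with the same norm. *)
Definition cont_interp (R : realType) (E0 E1 : completeNormedModType R)
    (j : {linear E1 -> E0}) (theta : R) : set E0 :=
  [set x | real_interp j theta x /\
     forall e : R, 0 < e -> exists y : E1, inorm j theta (x - j y) < e].

Definition iball (R : realType) (E0 E1 : completeNormedModType R)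
    (j : {linear E1 -> E0}) (theta : R) (x : E0) (r : R) : set E0 :=
  [set y | cont_interp j theta y /\ inorm j theta (y - x) < r].

Definition iclosed_ball (R : realType) (E0 E1 : completeNormedModType R)
    (j : {linear E1 -> E0}) (theta : R) (x : E0) (r : R) : set E0 :=
  [set y | cont_interp j theta y /\ inorm j theta (y - x) <= r].

Definition iopen (R : realType) (E0 E1 : completeNormedModType R)
    (j : {linear E1 -> E0}) (theta : R) (V : set E0) : Prop :=
  V `<=` cont_interp j theta /\
  forall x, V x -> exists2 r : R, 0 < r & iball j theta x r `<=` V.

(* BC_{1-mu}([0,T], E); only the values of v on ]0, T] matter. *)
Definition BCw (R : realType) (E : completeNormedModType R) (mu T : R)
    (v : R -> E) : Prop :=
  [/\ {within `]0, T], continuous v},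
      {within `]0, T], continuous (fun t : R => t `^ (1 - mu) *: v t)},
      [bounded t `^ (1 - mu) *: v t | t in `]0, T]] &
      `|t `^ (1 - mu) *: v t| @[t --> 0^'+] --> (0 : R)].

(* [dv] is the derivative of [v] on D, one-sided at endpoints in D. *)
Definition derivative_on (R : realType) (E : completeNormedModType R)
    (D : set R) (v dv : R -> E) : Prop :=
  forall t, D t ->
    (s - t)^-1 *: (v s - v t) @[s --> within D t^'] --> dv t.

(* v is in BC^1_{1-mu}([0,T], E), with derivative dv. *)
Definition BC1w (R : realType) (E : completeNormedModType R) (mu T : R)
    (v dv : R -> E) : Prop :=
  [/\ derivative_on `]0, T] v dv, BCw mu T v & BCw mu T dv].

(* u is in E_{1,mu}([0,T]), extended continuously in E0 to t = 0; [du] is its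
   derivative and [w] is u on ]0, T] regarded as a function with values
   in E1. *)
Definition E1mu (R : realType) (E0 E1 : completeNormedModType R)
    (j : {linear E1 -> E0}) (mu T : R) (u du : R -> E0) (w : R -> E1) : Prop :=
  [/\ forall t, 0 < t <= T -> u t = j (w t),
      BC1w mu T u du, BCw mu T w & u t @[t --> 0^'+] --> u 0].

Definition solves_linear (R : realType) (E0 E1 : completeNormedModType R)
    (j : {linear E1 -> E0}) (mu : R) (B : {linear E1 -> E0}) (T : R)
    (f : R -> E0) (x : E0) (u : R -> E0) : Prop :=
  exists (du : R -> E0) (w : R -> E1),
    [/\ E1mu j mu T u du w,
        forall t, 0 < t <= T -> du t + B (w t) = f t & u 0 = x].

Definition max_reg (R : realType) (E0 E1 : completeNormedModType R)
    (j : {linear E1 -> E0}) (mu : R) (B : {linear E1 -> E0}) : Prop :=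
  continuous B /\
  exists2 T : R, 0 < T &
    forall (f : R -> E0) (x : E0), BCw mu T f -> cont_interp j mu x ->
      exists2 u : R -> E0, solves_linear j mu B T f x u &
        forall v, solves_linear j mu B T f x v ->
          forall t, 0 <= t <= T -> v t = u t.

Definition opnorm (R : realType) (E F : completeNormedModType R)
    (B : E -> F) : R :=
  sup [set `|B y| | y in [set y : E | `|y| <= 1]].

(* A, F1 and F2 are total functions whose values matter only on V, V and
   the intersection of V and E_beta respectively. *)
Definition hyp_quasilinear (R : realType) (E0 E1 : completeNormedModType R)
    (j : {linear E1 -> E0}) (mu : R) (V : set E0)
    (A : E0 -> {linear E1 -> E0}) (F1 : E0 -> E0) : Prop :=
  (forall x, V x -> max_reg j mu (A x)) /\
  forall x0, V x0 -> exists r L : R, 0 < r /\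
    forall x1 x2, V x1 -> V x2 -> iball j mu x0 r x1 -> iball j mu x0 r x2 ->
      opnorm ((A x1 : E1 -> E0) \- (A x2 : E1 -> E0))
        <= L * inorm j mu (x1 - x2) /\
      `|F1 x1 - F1 x2| <= L * inorm j mu (x1 - x2).

Definition hyp_semilinear (R : realType) (E0 E1 : completeNormedModType R)
    (j : {linear E1 -> E0}) (mu : R) (V : set E0) (F2 : E0 -> E0)
    (beta : R) (m : nat) (betas rhos : 'I_m -> R) : Prop :=
  [/\ mu < beta < 1,
      forall k, mu <= betas k <= beta /\ 0 <= rhos k,
      forall k, (rhos k * (beta - mu) + (betas k - mu)) / (1 - mu) <= 1 &
      forall x0, V x0 -> forall r : R, 0 < r -> exists2 C : R, 0 < C &
        forall x1 x2,
          iclosed_ball j mu x0 r x1 -> V x1 -> cont_interp j beta x1 ->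
          iclosed_ball j mu x0 r x2 -> V x2 -> cont_interp j beta x2 ->
          `|F2 x1 - F2 x2| <=
            C * \sum_(k < m)
                  (1 + inorm j beta x1 `^ rhos k + inorm j beta x2 `^ rhos k)
                  * inorm j (betas k) (x1 - x2)].

(* u solves u' + A(u)u = F1(u) + F2(u), u(0) = x on [0, T]. *)
Definition solution (R : realType) (E0 E1 : completeNormedModType R)
    (j : {linear E1 -> E0}) (mu : R) (V : set E0)
    (A : E0 -> {linear E1 -> E0}) (F1 F2 : E0 -> E0) (T : R) (x : E0)
    (u : R -> E0) : Prop :=
  exists (du : R -> E0) (w : R -> E1),
    [/\ E1mu j mu T u du w,
        forall t, 0 <= t <= T -> V (u t),
        forall t, 0 < t <= T ->
          du t + A (u t) (w t) = F1 (u t) + F2 (u t) &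
        u 0 = x].

(* u is a solution on [0, tp[ that no solution on some [0, T] with tp <= T
   extends. *)
Definition maximal_solution (R : realType) (E0 E1 : completeNormedModType R)
    (j : {linear E1 -> E0}) (mu : R) (V : set E0)
    (A : E0 -> {linear E1 -> E0}) (F1 F2 : E0 -> E0) (x : E0)
    (tp : \bar R) (u : R -> E0) : Prop :=
  [/\ (0%:E < tp)%E,
      forall T : R, 0 < T -> (T%:E < tp)%E -> solution j mu V A F1 F2 T x u &
      forall (T : R) (v : R -> E0), (tp <= T%:E)%E ->
        solution j mu V A F1 F2 T x v ->
        ~ (forall t : R, 0 <= t -> (t%:E < tp)%E -> v t = u t)].

Definition equilibrium (R : realType) (E0 E1 : completeNormedModType R)
    (j : {linear E1 -> E0}) (A : E0 -> {linear E1 -> E0})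
    (F1 F2 : E0 -> E0) (us : E1) : Prop :=
  A (j us) us = F1 (j us) + F2 (j us).

Definition stable_in (R : realType) (E0 E1 : completeNormedModType R)
    (j : {linear E1 -> E0}) (mu : R) (V : set E0)
    (A : E0 -> {linear E1 -> E0}) (F1 F2 : E0 -> E0) (nu : R) (us : E1)
    : Prop :=
  forall e : R, 0 < e -> exists2 d : R, 0 < d &
    forall x0, iball j nu (j us) d x0 ->
      forall (tp : \bar R) (u : R -> E0),
        maximal_solution j mu V A F1 F2 x0 tp u ->
        tp = +oo%E /\ forall t, 0 <= t -> iball j nu (j us) e (u t).

(* Main.v *)
Require Import Defs.
From HB Require Import structures.
From mathcomp Require Import all_boot all_order all_algebra.
From mathcomp Require Import all_classical all_reals all_analysis.
From mathcomp Require Import ring lra.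
Set Implicit Arguments.
Unset Strict Implicit.
Unset Printing Implicit Defensive.
Import Order.TTheory GRing.Theory Num.Theory.
Import numFieldNormedType.Exports.
Local Open Scope classical_set_scope.
Local Open Scope ring_scope.

(** Freezing the operator at the equilibrium rewrites the equation as
[u' + B u = G(u)], where [B = A(us)] and
[G(w) = B w - A(w) w + F1(w) + F2(w)], so that [G(us) = B us].

Maximal regularity of [B] bounds, on every [[0, T]] with [T <= T0] and with a
constant that does not depend on [T], the weighted norms
[sup t^(1-mu) |u(t)|_1] and [sup t^(1-mu) |u'(t)|_0] of a solution of the
linear problem by the E_mu norm of the initial value and the weighted norm of
the right-hand side ([max_reg_uniform]).  If a function is within [M] of [us]
in E_mu and within [s^(mu-1) M] in E_1 at time [s], then it is within
[s^(mu-theta) M] in E_theta.  Inserted in the growth condition on [F2], these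
powers of [s] combine with the weight to a nonnegative exponent; when it
vanishes, smallness comes from the power of [M] that appears instead.  Hence
[G] is Lipschitz for the weighted norms, near [us] and for short times, with a
constant as small as desired ([frozen_contraction]).

It follows that two solutions that stay near [us] differ by at most a multiple
of the difference of their initial values ([solution_lipschitz]), that a
solution starting close to [us] in E_mu stays close up to some time [tau]
([confinement]), and that it is then close in all E_theta:
[|u(t) - us|_theta <= C t^(mu-theta) |u(0) - us|_mu] ([smoothing]).

For E_mubar this bound is useless as [t] tends to 0.  There one fixes [t] and
compares the solution on [[0, t]] with the constant [us + b], where
[u(0) - us = a + b] is an almost optimal decomposition for the K-functional at
[t]; the constant solves the equation up to an error of the order of
[t^(mubar-mu)], which the trace estimate at time [t] compensates exactly.  So
a solution that starts close to [us] in E_mubar stays so up to [tau]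
([persistence]).

Finally, a solution on [[0, r[] with [r <= tau] that starts close to [us] in
E_mu has a limit in E_1 at [r]: the Lipschitz bound applied to the solution and
its translates by small times shows that it is Cauchy.  It therefore extends to
[[0, r]] ([solution_closes]), and maximal solutions live beyond [tau].

Now let [us] be stable in E_mu.  A solution starting close to [us] in E_mubar
is global and remains close in E_mu; it is close in E_mubar up to [tau] by
[persistence], and at a later time [t] by [smoothing] on [[t - tau, t]].
Conversely let [us] be stable in E_mubar.  A solution starting close to [us] in
E_mu lives beyond [tau] and is close in E_mu until then; [u(tau)] is close to
[us] in E_mubar by [smoothing], so the rest of the solution is global and
remains close in E_mubar, a fortiori in E_mu.

The uniform linear bound comes from two observations.  A countably subadditive
functional that is finite on a complete space is bounded by a multiple of the
norm ([zabreiko]); this applies to the least bound of a solution with given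
data.  And uniqueness on [[0, T0]] passes to shorter intervals
([uniqueness_restrict]), because the primitive of a homogeneous solution,
unlike the solution itself, can be continued beyond [T]. *)

(** * Linear identities in modules *)

Section LinearCombinations.
Context {R : comNzRingType} {M : lmodType R}.

Inductive lexpr := LVar of nat | LZero | LAdd of lexpr & lexpr | LOpp of lexpr
  | LScale of R & lexpr.

Fixpoint leval (env : seq M) (x : lexpr) : M :=
  match x with
  | LVar i => nth 0 env i
  | LZero => 0
  | LAdd x y => leval env x + leval env y
  | LOpp x => - leval env x
  | LScale a x => a *: leval env x
  end.

Fixpoint lcoef (x : lexpr) (i : nat) : R :=
  match x with
  | LVar k => if eqn k i then 1 else 0
  | LZero => 0
  | LAdd x y => lcoef x i + lcoef y i
  | LOpp x => - lcoef x i
  | LScale a x => a * lcoef x i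
  end.

Fixpoint lsame (n : nat) (x y : lexpr) : Prop :=
  if n is n'.+1 then lcoef x n' = lcoef y n' /\ lsame n' x y else True.

Lemma leval_coef env x :
  leval env x = \sum_(i < size env) lcoef x i *: env`_i.
Proof.
elim: x => [k||x IHx y IHy|x IHx|a x IHx] /=.
- have [kn|nk] := ltnP k (size env); last first.
    rewrite nth_default// big1// => i _; have -> : eqn k i = false by apply/negbTE; rewrite -[eqn k i]/(k == i :> nat); apply: contraTneq nk => ->; rewrite -ltnNge ltn_ord.
    by rewrite scale0r.
  rewrite (bigD1 (Ordinal kn))//= -[eqn k k]/(k == k) eqxx scale1r big1 ?addr0// => i ik.
  have -> : eqn k i = false by apply/negbTE; rewrite -[eqn k i]/(k == i :> nat); apply: contraNneq ik => ki; apply/eqP/val_inj.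
  by rewrite scale0r.
- by rewrite big1// => i _; rewrite scale0r.
- by rewrite IHx IHy -big_split; apply: eq_bigr => i _; rewrite scalerDl.
- by rewrite IHx -sumrN; apply: eq_bigr => i _; rewrite scaleNr.
- by rewrite IHx scaler_sumr; apply: eq_bigr => i _; rewrite scalerA.
Qed.

(** Expressions are compared through the coefficients of their atoms, so that
    equality in the module reduces to identities in the ring of scalars. *)
Lemma leval_eq env x y : lsame (size env) x y -> leval env x = leval env y.
Proof.
move=> H; rewrite !leval_coef.
have K n i : (i < n)%N -> lsame n x y -> lcoef x i = lcoef y i.
  elim: n => // n IHn; rewrite ltnS leq_eqVlt => /orP[/eqP->|/IHn h] /= [] //.
by apply: eq_bigr => i _; rewrite (K (size env))// ltn_ord.
Qed.

End LinearCombinations.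

Ltac lm_find_syn x env :=
  match env with
  | x :: _ => constr:(O)
  | _ :: ?e => let n := lm_find_syn x e in constr:(S n)
  end.
Ltac lm_find_conv x env :=
  match env with
  | ?y :: _ => let _ := match goal with _ => unify x y end in constr:(O)
  | _ :: ?e => let n := lm_find_conv x e in constr:(S n)
  end.
(* Conversion tests between atoms are expensive, so a syntactic match is preferred. *)
Ltac lm_find x env :=
  match env with
  | _ => lm_find_syn x env
  | _ => lm_find_conv x env
  end.
Ltac lm_add x env :=
  match env with
  | _ => let n := lm_find x env in env
  | _ => constr:(x :: env)
  end.
Ltac lm_atoms t env :=
  match t with
  | ?a + ?b => let e := lm_atoms a env in lm_atoms b e
  | - ?a => lm_atoms a env
  | _ *: ?a => lm_atoms a env
  | 0 => env
  | _ => lm_add t env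
  end.
Ltac lm_quote R M t env :=
  match t with
  | ?a + ?b => let x := lm_quote R M a env in let y := lm_quote R M b env in
               constr:(@LAdd R x y)
  | - ?a => let x := lm_quote R M a env in constr:(@LOpp R x)
  | ?k *: ?a => let x := lm_quote R M a env in constr:(@LScale R k x)
  | 0 => constr:(@LZero R)
  | _ => let n := lm_find t env in constr:(@LVar R n)
  end.
Ltac lmod_eq R :=
  match goal with |- @eq ?M ?a ?b =>
    let e0 := constr:(@nil M) in
    let e1 := lm_atoms a e0 in
    let env := lm_atoms b e1 in
    let x := lm_quote R M a env in
    let y := lm_quote R M b env in
    let H := fresh in
    have H := @leval_eq R _ env x y;
    refine (H _); clear H; cbn [lsame lcoef size eqn]; repeat split; try ring
  end.

(* The cost of [lra] grows with the number of inequalities in the context; those it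
   is to use are moved to the goal beforehand. *)
Ltac forget :=
  repeat match goal with
  | H : is_true (Order.le _ _) |- _ => clear H
  | H : is_true (Order.lt _ _) |- _ => clear H
  end; intros.

(** * Real induction, the mean value inequality and Stieltjes primitives *)

Section RealInduction.
Context {R : realType}.
Implicit Types a b c d e r s t : R.

(** The supremum of the points of [[a, b]] where [P] holds can only be [b], since [P]
    passes from just below any point to just above it. *)
Lemma real_ind (P : R -> Prop) a b : a <= b -> P a ->
  (forall c, a <= c <= b -> exists2 d, 0 < d &
     forall r s, a <= r <= c -> c <= s <= b -> c - d < r -> s < c + d ->
       P r -> P s) ->
  P b.
Proof.
move=> ab Pa H.
pose S : set R := [set r | a <= r <= b /\ P r].
have Sa : S a by split => //; rewrite lexx.
have Sb : ubound S b by move=> r [/andP[]].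
have supS : has_sup S by split; [exists a | exists b].
set c := sup S.
have ac : a <= c by apply: sup_upper_bound.
have cb : c <= b by apply: ge_sup => //; exists a.
have acb : a <= c <= b by rewrite ac.
have [d d0 Hd] := H c acb.
have [r [/andP[ar rb] Pr] rc] := sup_adherent d0 supS.
have rlec : r <= c by apply: sup_upper_bound => //; split => //; rewrite ar.
have Pm : P (Num.min b (c + d / 2)).
  apply: (Hd r) => //.
  - by rewrite ar.
  - by rewrite le_min cb ge_min lexx /=; lra.
  - by rewrite gt_min; apply/orP; right; lra.
have : Num.min b (c + d / 2) <= c.
  apply: sup_upper_bound => //; split => //.
  by rewrite le_min ge_min lexx /=; lra.
rewrite ge_min => /orP[bc|]; last by lra.
by move: Pm; rewrite min_l//; lra.
Qed.

(** Increments and increments of [Phi] both add up along adjacent intervals, so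
    the local inequality propagates by real induction. *)
Lemma local_increment (E : normedModType R) (u : R -> E) (Phi : R -> R) a b :
  a <= b ->
  (forall s t, a <= s -> s <= t -> t <= b -> Phi s <= Phi t) ->
  (forall t, a <= t <= b -> exists2 d, 0 < d &
     forall s, a <= s <= b -> `|s - t| < d -> `|u s - u t| <= `|Phi s - Phi t|) ->
  `|u b - u a| <= Phi b - Phi a.
Proof.
move=> ab mono H.
apply: (@real_ind (fun r => `|u r - u a| <= Phi r - Phi a) a b) => //.
  by rewrite !subrr normr0.
move=> c acb; have [d d0 Hd] := H c acb; exists d => // r s /andP[ar rc] /andP[cs sb] cr sc Hr.
have /andP[ac cb] := acb.
have Hs : `|u s - u c| <= Phi s - Phi c.
  rewrite -[leRHS]ger0_norm ?subr_ge0 ?mono//; apply: Hd; first by apply/andP; lra.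
  by rewrite ger0_norm; lra.
have Hc : `|u c - u r| <= Phi c - Phi r.
  rewrite -[leRHS]ger0_norm ?subr_ge0 ?mono// distrC [leRHS]distrC; apply: Hd; first by apply/andP; lra.
  by rewrite ler0_norm; lra.
have -> : u s - u a = (u s - u c) + (u c - u r) + (u r - u a).
  by rewrite !addrA !subrK.
apply: (le_trans (ler_normD _ _)); apply: (le_trans (lerD (ler_normD _ _) (lexx _))); lra.
Qed.

End RealInduction.

Section Derivatives.
Context {R : realType}.
Implicit Types (a b c d e r s t : R) (D : set R).

Definition lcont (E : normedModType R) D (v : R -> E) := forall t, D t ->
  forall e, 0 < e -> exists2 d, 0 < d &
    forall s, D s -> `|s - t| < d -> `|v s - v t| <= e.

(** Derivative of [u] with respect to the integrator [Phi].  With [Phi = id] it is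
    the usual derivative; with [Phi(t) = t^mu] it absorbs the singularity at 0 of the
    functions of the weighted spaces. *)
Definition rsd (E : normedModType R) D (Phi : R -> R) (u g : R -> E) :=
  forall t, D t -> forall e, 0 < e -> exists2 d, 0 < d &
    forall s, D s -> `|s - t| < d ->
      `|u s - u t - (Phi s - Phi t) *: g t| <= e * `|Phi s - Phi t|.

Lemma rsd_mono (E : normedModType R) D D' Phi (u g : R -> E) :
  D' `<=` D -> rsd D Phi u g -> rsd D' Phi u g.
Proof.
move=> DD H t /DD Dt e e0; have [d d0 Hd] := H t Dt e e0.
by exists d => // s /DD; exact: Hd.
Qed.

Lemma lcont_mono (E : normedModType R) D D' (u : R -> E) :
  D' `<=` D -> lcont D u -> lcont D' u.
Proof.
move=> DD H t /DD Dt e e0; have [d d0 Hd] := H t Dt e e0.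
by exists d => // s /DD; exact: Hd.
Qed.

Lemma mean_value (E : normedModType R) (u du : R -> E) (Phi dPhi : R -> R^o) a b :
  a <= b ->
  (forall s t, a <= s -> s <= t -> t <= b -> Phi s <= Phi t) ->
  rsd [set t | a <= t <= b] id u du ->
  rsd [set t | a <= t <= b] id Phi dPhi ->
  (forall t, a <= t <= b -> `|du t| <= dPhi t) ->
  `|u b - u a| <= Phi b - Phi a.
Proof.
move=> ab mono Hu HP Hle; apply/ler_addgt0Pr => e e0.
pose e' := e / (2 * (b - a + 1)).
have e'0 : 0 < e' by rewrite divr_gt0//; lra.
have ee' : 2 * e' * (b - a) <= e.
  have -> : 2 * e' * (b - a) = e * ((b - a) / (b - a + 1)) by rewrite /e'; field; lra.
  rewrite -[leRHS]mulr1 ler_wpM2l ?(ltW e0)// ler_pdivrMr; lra.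
apply: (@le_trans _ _ ((Phi b + 2 * e' * b) - (Phi a + 2 * e' * a))); last by lra.
(* The slack linear in time pays for the errors in both difference quotients. *)
apply: (@local_increment _ _ u (fun r => Phi r + 2 * e' * r)) => //.
  by move=> s t ? ? ?; apply: lerD; [exact: mono | rewrite ler_wpM2l//; lra].
move=> t tab; have [d1 d10 H1] := Hu t tab e' e'0; have [d2 d20 H2] := HP t tab e' e'0.
exists (Num.min d1 d2); first by rewrite lt_min d10.
move=> s sab; rewrite lt_min => /andP[st1 st2].
have {}H1 := H1 s sab st1; have {}H2 := H2 s sab st2.
have A1 : `|u s - u t| <= `|s - t| * dPhi t + e' * `|s - t|.
  rewrite -[u s - u t](subrK ((s - t) *: du t)) addrC.
  apply: (le_trans (ler_normD _ _)); apply: lerD => //.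
  by rewrite normrZ ler_wpM2l// Hle.
have dP0 : 0 <= dPhi t by apply: le_trans (Hle t tab).
have A2 : `|s - t| * dPhi t <= `|Phi s - Phi t| + e' * `|s - t|.
  rewrite -[in leLHS](ger0_norm dP0) -normrM.
  have -> : (s - t) * dPhi t = (Phi s - Phi t) - ((Phi s - Phi t) - (s - t) * dPhi t) by ring.
  by apply: (le_trans (ler_normB _ _)); rewrite lerD2l.
have /andP[at_ tb] := tab; have /andP[as_ sb] := sab.
have k0 : 0 <= 2 * e' by rewrite mulr_ge0// ltW.
have -> : Phi s + 2 * e' * s - (Phi t + 2 * e' * t) = (Phi s - Phi t) + 2 * e' * (s - t) by ring.
suff -> : `|Phi s - Phi t + 2 * e' * (s - t)| = `|Phi s - Phi t| + 2 * e' * `|s - t|.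
  by move: A1 A2; forget; lra.
have [st|/ltW ts] := leP s t.
  have mm := mono _ _ as_ st tb.
  rewrite !ler0_norm ?subr_le0//; first by ring.
  by rewrite -[leRHS]addr0 lerD ?subr_le0// mulr_ge0_le0// subr_le0.
have mm := mono _ _ at_ ts sb.
by rewrite !ger0_norm ?subr_ge0// addr_ge0 ?subr_ge0// mulr_ge0// subr_ge0.
Qed.

Lemma rsd_lcont (E : normedModType R) D (u du : R -> E) : rsd D id u du -> lcont D u.
Proof.
move=> H t Dt e e0; have [d d0 Hd] := H t Dt 1 ltr01.
have k0 : 0 < 1 + `|du t| by have := normr_ge0 (du t); lra.
exists (Num.min d (e / (1 + `|du t|))).
  by rewrite lt_min d0 divr_gt0.
move=> s Ds; rewrite lt_min => /andP[s1 s2]; have := Hd s Ds s1 => {}Hd.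
rewrite -[u s - u t](subrK ((s - t) *: du t)).
apply: (le_trans (ler_normD _ _)); rewrite normrZ.
move: s2; rewrite ltr_pdivlMr// => s2; move: Hd => /=; lra.
Qed.

(** Turns a primitive with respect to [t^mu] into an ordinary one. *)
Lemma rsd_chain (E : normedModType R) D (Phi dPhi : R -> R^o) (W g : R -> E) :
  rsd D id Phi dPhi -> rsd D Phi W g -> rsd D id W (fun t => dPhi t *: g t).
Proof.
move=> HP HW t Dt e e0.
pose e1 := e / (2 * (1 + `|dPhi t|)); pose e2 := Num.min 1 (e / (2 * (1 + `|g t|))).
have k1 : 0 < 1 + `|dPhi t| by have := normr_ge0 (dPhi t); lra.
have k2 : 0 < 1 + `|g t| by have := normr_ge0 (g t); lra.
have e10 : 0 < e1 by rewrite divr_gt0//; lra.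
have e20 : 0 < e2 by rewrite lt_min ltr01 divr_gt0//; lra.
have [d1 d10 H1] := HP t Dt e2 e20; have [d2 d20 H2] := HW t Dt e1 e10.
exists (Num.min d1 d2); first by rewrite lt_min d10.
move=> s Ds; rewrite lt_min => /andP[s1 s2].
have {}H1 := H1 s Ds s1; have {}H2 := H2 s Ds s2.
have -> : W s - W t - (s - t) *: (dPhi t *: g t) =
  (W s - W t - (Phi s - Phi t) *: g t) + ((Phi s - Phi t) - (s - t) * dPhi t) *: g t.
  by lmod_eq R.
apply: (le_trans (ler_normD _ _)); rewrite normrZ.
have P1 : `|Phi s - Phi t| <= (1 + `|dPhi t|) * `|s - t|.
  rewrite -[Phi s - Phi t](subrK ((s - t) *: dPhi t)).
  apply: (le_trans (ler_normD _ _)); rewrite normrZ.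
  have : e2 * `|s - t| <= 1 * `|s - t| by rewrite ler_wpM2r// ge_min lexx.
  by move: H1 => /=; lra.
have Q1 : e1 * `|Phi s - Phi t| <= e / 2 * `|s - t|.
  apply: (@le_trans _ _ (e1 * ((1 + `|dPhi t|) * `|s - t|))); first by rewrite ler_wpM2l// ltW.
  by rewrite le_eqVlt; apply/orP; left; apply/eqP; rewrite /e1; field; lra.
have Q2 : `|Phi s - Phi t - (s - t) * dPhi t| * `|g t| <= e / 2 * `|s - t|.
  apply: (@le_trans _ _ (e2 * `|s - t| * (1 + `|g t|))).
    by apply: ler_pM => //; lra.
  apply: (@le_trans _ _ (e / (2 * (1 + `|g t|)) * `|s - t| * (1 + `|g t|))).
    by rewrite ler_wpM2r ?(ltW k2)// ler_wpM2r// ge_min lexx orbT.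
  by rewrite le_eqVlt; apply/orP; left; apply/eqP; field; lra.
apply: (le_trans (lerD H2 Q2)); move: Q1 => /=; lra.
Qed.

End Derivatives.

Lemma cauchy_limit (R : realType) (E : completeNormedModType R) (u : nat -> E) :
  (forall e : R, 0 < e -> exists n, forall k, (n <= k)%N -> `|u k - u n| <= e) ->
  exists l, forall e : R, 0 < e -> exists n, forall k, (n <= k)%N -> `|u k - l| <= e.
Proof.
move=> H.
have cu : cvg (u @ \oo).
  apply: cauchy_cvg; apply/cauchy_ballP => e e0; have [n Hn] := H (e / 4) (divr_gt0 e0 (ltr0n _ 4)).
  near_simpl; exists ([set k | (n <= k)%N], [set k | (n <= k)%N]); first by split; exists n.
  move=> [k l] /= [nk nl]; rewrite -ball_normE /ball_ /=.
  have -> : u k - u l = (u k - u n) - (u l - u n) by lmod_eq R.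
  apply: (le_lt_trans (ler_normB _ _)); have := Hn k nk; have := Hn l nl; lra.
exists (lim (u @ \oo)) => e e0.
have /cvgrPdist_le/(_ e e0)[n _ Hn] := cu.
by exists n => k nk; rewrite distrC; exact: Hn.
Qed.

Section Primitive.
Context {R : realType} {E : completeNormedModType R}.
Implicit Types (a b c d e r s t : R).
Variables (g : R -> E) (Phi : R -> R) (b : R).
Hypothesis b0 : 0 <= b.
Hypothesis mono : forall s t, 0 <= s -> s <= t -> t <= b -> Phi s <= Phi t.
Hypothesis gcont : lcont [set t | 0 <= t <= b] g.

(** [W] is a primitive of [g] up to a relative error [e] in each small increment. *)
Definition approx_primitive e c (W : R -> E) := W 0 = 0 /\ forall t, 0 <= t <= c ->
  exists2 d, 0 < d & forall s, 0 <= s <= c -> `|s - t| < d ->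
    `|W s - W t - (Phi s - Phi t) *: g t| <= e * `|Phi s - Phi t|.

(** Where [g] oscillates by at most [e], an approximate primitive is continued
    linearly in [Phi]. *)
Lemma approx_primitive_ex e : 0 < e -> exists W, approx_primitive e b W.
Proof.
move=> e0; apply: (@real_ind R (fun c => exists W, approx_primitive e c W) 0 b) => //.
  exists (fun=> 0); split=> // t /andP[t0 t1]; exists 1 => // s /andP[s0 s1] _.
  have -> : s = t by lra.
  by rewrite !subrr scale0r !subrr !normr0 mulr0.
move=> c c0b; have [d d0 Hd] := gcont c0b (divr_gt0 e0 (ltr0n _ 2)).
exists d => // r q /andP[r0 rc] /andP[cq qb] dr qd [W [W0 HW]].
have /andP[c0 cb] := c0b.
have osc s t : r <= s <= q -> r <= t <= q -> `|g s - g t| <= e.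
  move=> /andP[? ?] /andP[? ?].
  have A : `|g s - g c| <= e / 2.
    by apply: Hd => /=; [apply/andP; lra| rewrite ltr_norml; apply/andP; lra].
  have B : `|g t - g c| <= e / 2.
    by apply: Hd => /=; [apply/andP; lra| rewrite ltr_norml; apply/andP; lra].
  have -> : g s - g t = (g s - g c) - (g t - g c) by rewrite opprB addrA subrK.
  by apply: (le_trans (ler_normB _ _)); lra.
pose W' s := if s <= r then W s else W r + (Phi s - Phi r) *: g r.
exists W'; split; first by rewrite /W' r0.
move=> t /andP[t0 tq].
have W'r s : r <= s -> W' s = W r + (Phi s - Phi r) *: g r.
  move=> rs; rewrite /W'; case: leP => // sr.
  by have -> : s = r by [lra]; rewrite subrr scale0r addr0.
have right s : r <= s <= q -> r <= t -> `|W' s - W' t - (Phi s - Phi t) *: g t| <= e * `|Phi s - Phi t|.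
  move=> /andP[rs sq] rt; rewrite !W'r//.
  have -> : W r + (Phi s - Phi r) *: g r - (W r + (Phi t - Phi r) *: g r) - (Phi s - Phi t) *: g t
     = (Phi s - Phi t) *: (g r - g t).
    by lmod_eq R.
  rewrite normrZ mulrC ler_wpM2r// osc//; apply/andP; lra.
have [tr|rt] := ltP t r.
  have /HW[d1 d10 H1] : 0 <= t <= r by apply/andP; lra.
  exists (Num.min d1 (r - t)); first by rewrite lt_min d10 subr_gt0.
  move=> s /andP[s0 sq]; rewrite lt_min [X in _ && X]ltr_norml => /andP[s1 /andP[s2 s3]].
  have sr : s <= r by lra.
  rewrite /W' sr (ltW tr); apply: H1 => //; apply/andP; lra.
have [rt'|] := ltP r t.
  exists (t - r); first by rewrite subr_gt0.
  move=> s /andP[s0 sq]; rewrite ltr_norml => /andP[s2 s3].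
  by apply: right => //; apply/andP; lra.
move=> tr; have et : t = r by lra.
have /HW[d1 d10 H1] : 0 <= t <= r by apply/andP; lra.
exists d1 => // s /andP[s0 sq] s1.
have [sr|/ltW rs] := leP s r; last by apply: right => //; apply/andP; lra.
rewrite /W' sr tr; apply: H1 => //; apply/andP; lra.
Qed.

(** Locally the main terms of the two increments cancel; the error terms then add
    up globally. *)
Lemma approx_primitive_dist e1 e2 W1 W2 s t : 0 < e1 -> 0 < e2 -> approx_primitive e1 b W1 -> approx_primitive e2 b W2 ->
  0 <= s -> s <= t -> t <= b ->
  `|(W1 t - W2 t) - (W1 s - W2 s)| <= (e1 + e2) * (Phi t - Phi s).
Proof.
move=> e10 e20 [_ H1] [_ H2] s0 st tb; rewrite mulrBr.
apply: (@local_increment R E (fun r => W1 r - W2 r) (fun r => (e1 + e2) * Phi r)) => //.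
  by move=> q r q0 qr rt; rewrite ler_wpM2l ?mono//; lra.
move=> r /andP[r0 r1]; have rb : 0 <= r <= b by apply/andP; lra.
have [d1 d10 {}H1] := H1 r rb; have [d2 d20 {}H2] := H2 r rb.
exists (Num.min d1 d2); first by rewrite lt_min d10.
move=> q /andP[q0 q1]; rewrite lt_min => /andP[qr1 qr2].
have qb : 0 <= q <= b by apply/andP; lra.
have {}H1 := H1 q qb qr1; have {}H2 := H2 q qb qr2.
have -> : W1 q - W2 q - (W1 r - W2 r) =
  (W1 q - W1 r - (Phi q - Phi r) *: g r) - (W2 q - W2 r - (Phi q - Phi r) *: g r).
  by lmod_eq R.
apply: (le_trans (ler_normB _ _)); apply: (le_trans (lerD H1 H2)).
by rewrite -mulrDl -mulrBr normrM ger0_norm//; lra.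
Qed.

(** The Riemann-Stieltjes integral of [g] with respect to [Phi], as the uniform
    limit of approximate primitives. *)
Lemma rs_primitive : exists W : R -> E, W 0 = 0 /\ rsd [set t | 0 <= t <= b] Phi W g.
Proof.
pose ep n : R := n.+1%:R^-1.
have ep0 n : 0 < ep n by rewrite invr_gt0.
have /choice[W HW] : forall n, exists W, approx_primitive (ep n) b W by move=> n; exact: approx_primitive_ex.
have dist n k t : 0 <= t <= b -> `|W n t - W k t| <= (ep n + ep k) * (Phi t - Phi 0).
  move=> /andP[t0 tb].
  have := approx_primitive_dist (ep0 n) (ep0 k) (HW n) (HW k) (lexx 0) t0 tb.
  by rewrite (proj1 (HW n)) (proj1 (HW k)) subrr subr0.
have small e : 0 < e -> exists n, ep n <= e.
  move=> e0; exists (Num.truncn e^-1); rewrite invf_ple// ?posrE//.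
  by apply: ltW; rewrite truncnS_gt.
have epmono n k : (n <= k)%N -> ep k <= ep n.
  by move=> nk; rewrite lef_pV2 ?posrE// ler_nat.
have Pb t : 0 <= t <= b -> 0 <= Phi t - Phi 0 <= Phi b - Phi 0.
  by move=> /andP[t0 tb]; rewrite subr_ge0 mono//= lerD2r mono.
have Phi0 : 0 <= Phi b - Phi 0 by rewrite subr_ge0 mono.
have [W' HW'] : exists W' : R -> E, forall t, 0 <= t <= b -> forall e, 0 < e ->
    exists n, forall k, (n <= k)%N -> `|W k t - W' t| <= e.
  have HH t : exists l, 0 <= t <= b -> forall e, 0 < e ->
    exists n, forall k, (n <= k)%N -> `|W k t - l| <= e.
    have [tb|tb] := pselect (0 <= t <= b); last by exists 0.
    have [|l Hl] := @cauchy_limit R E (W ^~ t).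
      move=> e e0; have e'0 : 0 < e / (2 * (Phi b - Phi 0 + 1)) by rewrite divr_gt0//; lra.
      have [n Hn] := small _ e'0.
      exists n => k nk; apply: (le_trans (dist k n t tb)).
      have /andP[p0 pb] := Pb t tb.
      apply: (@le_trans _ _ ((2 * (e / (2 * (Phi b - Phi 0 + 1)))) * (Phi b - Phi 0 + 1))).
        apply: ler_pM => //; last by lra.
          by rewrite addr_ge0// ltW.
        by have := epmono _ _ nk; lra.
      by rewrite le_eqVlt; apply/orP; left; apply/eqP; field; lra.
    by exists l.
  by have /choice[W' HW'] := HH; exists W'.
have W'0 : W' 0 = 0.
  apply/eqP; rewrite -normr_le0; apply/ler_addgt0Pr => e e0; rewrite add0r.
  have [n Hn] := HW' 0 (introT andP (conj (lexx 0) b0)) e e0.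
  by have := Hn n (leqnn n); rewrite (proj1 (HW n)) sub0r normrN.
exists W'; split => // t tb e e0.
have [n Hn] := small (e / 4) (divr_gt0 e0 (ltr0n _ 4)).
have [_ /(_ t tb)[d d0 Hd]] := HW n.
exists d => // s sb std; have {}Hd := Hd s sb std.
have L1 s1 t1 : 0 <= s1 -> s1 <= t1 -> t1 <= b ->
  `|(W' t1 - W n t1) - (W' s1 - W n s1)| <= 2 * ep n * (Phi t1 - Phi s1).
  move=> s10 st tb1; apply/ler_addgt0Pr => e1 e10.
  have s1b : 0 <= s1 <= b by apply/andP; lra.
  have t1b : 0 <= t1 <= b by apply/andP; lra.
  have [n1 Hn1] := HW' s1 s1b (e1 / 2) (divr_gt0 e10 (ltr0n _ 2)).
  have [n2 Hn2] := HW' t1 t1b (e1 / 2) (divr_gt0 e10 (ltr0n _ 2)).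
  pose k := maxn n (maxn n1 n2).
  have k1 : (n1 <= k)%N by rewrite /k !leq_max leqnn !orbT.
  have k2 : (n2 <= k)%N by rewrite /k !leq_max leqnn !orbT.
  have k3 : (n <= k)%N by rewrite /k !leq_max leqnn.
  have := approx_primitive_dist (ep0 k) (ep0 n) (HW k) (HW n) s10 st tb1.
  have -> : W' t1 - W n t1 - (W' s1 - W n s1) =
    (W k t1 - W n t1 - (W k s1 - W n s1)) - (W k t1 - W' t1) + (W k s1 - W' s1) by lmod_eq R.
  move=> H; apply: (le_trans (ler_normD _ _)); apply: (le_trans (lerD (ler_normB _ _) (lexx _))).
  have : (ep k + ep n) * (Phi t1 - Phi s1) <= 2 * ep n * (Phi t1 - Phi s1).
    by rewrite ler_wpM2r ?subr_ge0 ?mono//; have := epmono _ _ k3; lra.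
  have := Hn1 k k1; have := Hn2 k k2; lra.
have L2 : `|(W' s - W n s) - (W' t - W n t)| <= 2 * ep n * `|Phi s - Phi t|.
  have /andP[? ?] := sb; have /andP[? ?] := tb.
  have [st|/ltW ts] := leP s t.
    by rewrite distrC [X in _ * X]distrC [X in _ * X]ger0_norm ?subr_ge0 ?mono// L1.
  by rewrite [X in _ * X]ger0_norm ?subr_ge0 ?mono// L1.
have -> : W' s - W' t - (Phi s - Phi t) *: g t = (W n s - W n t - (Phi s - Phi t) *: g t) +
   ((W' s - W n s) - (W' t - W n t)) by lmod_eq R.
apply: (le_trans (ler_normD _ _)); apply: (le_trans (lerD Hd L2)).
by rewrite -mulrDl ler_wpM2r//; lra.
Qed.

End Primitive.

(** * Interpolation norms *)

Section PowerFacts.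
Context {R : realType}.
Implicit Types (x y r s t : R).

Lemma powRDp x r s : 0 < x -> x `^ (r + s) = x `^ r * x `^ s.
Proof. by move=> x0; rewrite powRD// (gt_eqF x0) implybT. Qed.

Lemma powR_split x r s u : 0 < x -> r + s = u -> x `^ r * x `^ s = x `^ u.
Proof. by move=> x0 <-; rewrite powRDp. Qed.

Lemma powR_le_base x y r : 0 <= r -> 0 <= x -> x <= y -> x `^ r <= y `^ r.
Proof.
move=> r0 x0 xy; apply: ge0_ler_powR => //; rewrite nnegrE//.
exact: le_trans xy.
Qed.

Lemma powR_le_basen x y r : r <= 0 -> 0 < x -> x <= y -> y `^ r <= x `^ r.
Proof.
move=> r0 x0 xy; have y0 := lt_le_trans x0 xy.
rewrite -[r]opprK !(powRN _ (- r)) lef_pV2 ?posrE ?powR_gt0// powR_le_base ?(ltW x0)//.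
by rewrite oppr_ge0.
Qed.

Lemma powR_le1 x r : 0 <= r -> 0 < x <= 1 -> x `^ r <= 1.
Proof. by move=> r0 x01; rewrite -(powRr0 x); apply: ger_powR. Qed.

Lemma powR_ge1 x r : 0 <= r -> 1 <= x -> 1 <= x `^ r.
Proof. by move=> r0 x01; rewrite -(powRr0 x); apply: ler_powR. Qed.

(** This and [powR_high] compare the two natural bounds of a K-functional, that by
    the E_1 norm for [t <= s] and that by the E_mu norm for [t >= s], with
    [t^theta]; they agree at [t = s]. *)
Lemma powR_low t s mu theta : 0 < t <= s -> theta <= 1 ->
  t * s `^ (mu - 1) <= t `^ theta * s `^ (mu - theta).
Proof.
move=> /andP[t0 ts] t1; have s0 := lt_le_trans t0 ts.
rewrite -{1}(powRr1 (ltW t0)) -(@powR_split t theta (1 - theta))//; last by lra.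
rewrite -(@powR_split s (1 - theta) (mu - 1) (mu - theta))//; last by lra.
rewrite -mulrA ler_wpM2l ?powR_ge0// ler_wpM2r ?powR_ge0// powR_le_base//; [lra|exact: ltW].
Qed.

Lemma powR_high t s mu theta : 0 < s <= t -> mu <= theta ->
  t `^ mu <= t `^ theta * s `^ (mu - theta).
Proof.
move=> /andP[s0 st] mt; have t0 := lt_le_trans s0 st.
rewrite -(@powR_split t theta (mu - theta) mu)//; last by lra.
by rewrite ler_wpM2l ?powR_ge0// powR_le_basen//; lra.
Qed.

End PowerFacts.

Lemma bounded_lin (R : realType) (E F : completeNormedModType R) (B : {linear E -> F}) :
  continuous B -> exists2 C, 1 <= C & forall y, `|B y| <= C * `|y|.
Proof.
move=> /(_ 0)/continuous_linear_bounded/linear_boundedP[C [Creal HC]].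
exists (`|C| + 1) => [|y]; first by rewrite lerDr.
by apply: HC; rewrite (le_lt_trans (ler_norm _))// ltrDl.
Qed.

Section Interpolation.
Context {R : realType} {E0 E1 : completeNormedModType R} (j : {linear E1 -> E0}).
Implicit Types (s t e M N theta : R) (x y a : E0) (b w : E1).

Let Kset t x := [set r | exists a : E0, exists b : E1, x = a + j b /\ r = `|a| + t * `|b|].

Let Kset0 t x : Kset t x !=set0.
Proof. by exists (`|x| + t * `|0 : E1|); exists x, 0; rewrite linear0 addr0. Qed.

Let Kset_lb t x : 0 <= t -> lbound (Kset t x) 0.
Proof. by move=> t0 r [a [b [_ ->]]]; rewrite addr_ge0// mulr_ge0. Qed.

Lemma Kfun_ge0 t x : 0 <= t -> 0 <= Kfun j t x.
Proof. by move=> t0; apply: (lb_le_inf (Kset0 t x)); exact: Kset_lb. Qed.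

Lemma Kfun_le t a b : 0 <= t -> Kfun j t (a + j b) <= `|a| + t * `|b|.
Proof.
by move=> t0; apply: ge_inf; [exists 0; exact: (@Kset_lb t) | exists a, b].
Qed.

Lemma Kfun_approx t x e : 0 <= t -> 0 < e ->
  exists a b, x = a + j b /\ `|a| + t * `|b| < Kfun j t x + e.
Proof.
move=> t0 e0; have := @inf_adherent R (Kset t x) e e0.
case=> [|r [a [b [xab ->]]] H]; first by split=> //; exists 0; exact: (@Kset_lb t).
by exists a, b.
Qed.

Lemma Kfun_norm t x : 0 <= t -> Kfun j t x <= `|x|.
Proof. by move=> t0; have := Kfun_le x 0 t0; rewrite linear0 normr0 mulr0 !addr0. Qed.

Lemma Kfun_j t b : 0 <= t -> Kfun j t (j b) <= t * `|b|.
Proof. by move=> t0; have := Kfun_le 0 b t0; rewrite normr0 !add0r. Qed.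

Lemma Kfun_add t x y : 0 <= t -> Kfun j t (x + y) <= Kfun j t x + Kfun j t y.
Proof.
move=> t0; apply/ler_addgt0Pr => e e0.
have e2 : 0 < e / 2 by lra.
have [a [b [-> H1]]] := Kfun_approx x t0 e2; have [c [d [-> H2]]] := Kfun_approx y t0 e2.
have -> : a + j b + (c + j d) = (a + c) + j (b + d) by rewrite linearD addrACA.
apply: (le_trans (Kfun_le _ _ t0)).
have := ler_normD a c; have : t * `|b + d| <= t * (`|b| + `|d|) by rewrite ler_wpM2l// ler_normD.
rewrite mulrDr; move: H1 H2; lra.
Qed.

Lemma Kfun_scale t k x : 0 <= t -> Kfun j t (k *: x) <= `|k| * Kfun j t x.
Proof.
move=> t0; apply/ler_addgt0Pr => e e0.
have k1 : 0 < `|k| + 1 by rewrite ltr_pwDr.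
have e2 : 0 < e / (`|k| + 1) by rewrite divr_gt0.
have [a [b [-> H1]]] := Kfun_approx x t0 e2.
rewrite scalerDr -linearZ; apply: (le_trans (Kfun_le _ _ t0)).
rewrite !normrZ mulrCA -mulrDr.
apply: (@le_trans _ _ (`|k| * (Kfun j t (a + j b) + e / (`|k| + 1)))).
  by rewrite ler_wpM2l// ltW.
rewrite mulrDr lerD2l mulrCA -[leRHS]mulr1 ler_wpM2l ?(ltW e0)// ler_pdivrMr//; lra.
Qed.

Lemma Kfun_opp t x : 0 <= t -> Kfun j t (- x) <= Kfun j t x.
Proof. by move=> t0; rewrite -scaleN1r (le_trans (Kfun_scale _ _ t0))// normrN1 mul1r. Qed.

(** Stands for [|x|_theta <= M].  Bounds on the K-functional at each [t] are easier to
    handle than a supremum, and they carry membership in the real interpolation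
    space. *)
Definition ile theta x M := forall t, 0 < t -> Kfun j t x <= t `^ theta * M.

Lemma real_interp_ile theta x : real_interp j theta x -> ile theta x (inorm j theta x).
Proof.
move=> H t t0; have t1 : 0 < t `^ theta by rewrite powR_gt0.
rewrite mulrC -ler_pdivrMr// mulrC -powRN.
apply: sup_upper_bound; last by exists t => //=; rewrite in_itv/= andbT.
split=> //; exists (1 `^ (- theta) * Kfun j 1 x); exists 1 => //=.
by rewrite in_itv /= ltr01.
Qed.

Lemma ile_ub theta x M : ile theta x M -> ubound (Kvalues j theta x) M.
Proof.
move=> H r [t /=]; rewrite in_itv/= andbT => t0 <-.
by rewrite powRN mulrC ler_pdivrMr ?powR_gt0// mulrC; exact: H.
Qed.

Lemma ile_real_interp theta x M : ile theta x M -> real_interp j theta x.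
Proof. by move=> /ile_ub; exists M. Qed.

Lemma ile_inorm theta x M : ile theta x M -> inorm j theta x <= M.
Proof.
move=> /ile_ub; apply: ge_sup; exists (1 `^ (- theta) * Kfun j 1 x); exists 1 => //=.
by rewrite in_itv /= ltr01.
Qed.

Lemma ile_ge0 theta x M : ile theta x M -> 0 <= M.
Proof.
move=> /(_ 1 ltr01); rewrite powR1 mul1r; apply: le_trans.
exact: Kfun_ge0.
Qed.

Lemma ile_le theta x M N : ile theta x M -> M <= N -> ile theta x N.
Proof. by move=> H MN t t0; apply: (le_trans (H t t0)); rewrite ler_wpM2l// powR_ge0. Qed.

Lemma ileD theta x y M N : ile theta x M -> ile theta y N -> ile theta (x + y) (M + N).
Proof.
move=> Hx Hy t t0; apply: (le_trans (Kfun_add _ _ (ltW t0))); rewrite mulrDr.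
by apply: lerD; [exact: Hx|exact: Hy].
Qed.

Lemma ileZ theta x k M : ile theta x M -> ile theta (k *: x) (`|k| * M).
Proof.
move=> Hx t t0; apply: (le_trans (Kfun_scale _ _ (ltW t0))); rewrite mulrCA.
by rewrite ler_wpM2l//; exact: Hx.
Qed.

Lemma ileN theta x M : ile theta x M -> ile theta (- x) M.
Proof. by move=> Hx t t0; apply: (le_trans (Kfun_opp _ (ltW t0))); exact: Hx. Qed.

Lemma ileB theta x y M N : ile theta x M -> ile theta y N -> ile theta (x - y) (M + N).
Proof. by move=> Hx /ileN; exact: ileD. Qed.

Lemma ile0 theta M : 0 <= M -> ile theta 0 M.
Proof.
move=> M0 t t0; have := Kfun_norm 0 (ltW t0); rewrite normr0 => /le_trans; apply.
by rewrite mulr_ge0// powR_ge0.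
Qed.

Hypothesis jc : continuous j.

(** The norm of E_0 is equivalent to [K(1, .)], because E_1 embeds in E_0. *)
Lemma norm_le_Kfun : exists2 c, 1 <= c & (forall b, `|j b| <= c * `|b|) /\
  forall x, `|x| <= c * Kfun j 1 x.
Proof.
have [c c1 Hc] := bounded_lin jc; exists c => //; split=> // x.
have c0 : 0 < c by exact: lt_le_trans c1.
rewrite mulrC -ler_pdivrMr//; apply/ler_addgt0Pr => e e0.
have [a [b [-> H1]]] := Kfun_approx x ler01 e0.
apply: ltW; apply: le_lt_trans H1; rewrite mul1r ler_pdivrMr//.
apply: (le_trans (ler_normD _ _)); rewrite mulrDl [`|b| * _]mulrC; apply: lerD => //.
by rewrite ler_peMr.
Qed.

Lemma ile_norm : exists2 c, 1 <= c & forall theta x M, ile theta x M -> `|x| <= c * M.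
Proof.
have [c c1 [_ Hc]] := norm_le_Kfun; exists c => // theta x M /(_ 1 ltr01).
rewrite powR1 mul1r => H; apply: (le_trans (Hc x)); rewrite ler_wpM2l//.
exact: le_trans c1.
Qed.

Lemma ile_j : exists2 c, 1 <= c &
  forall theta b, 0 <= theta <= 1 -> ile theta (j b) (c * `|b|).
Proof.
have [c c1 [Hc _]] := norm_le_Kfun; exists c => // theta b /andP[h0 h1] t t0.
have [t1|/ltW t1] := leP t 1.
  apply: (le_trans (Kfun_j _ (ltW t0))).
  apply: ler_pM => //; first exact: ltW.
    by rewrite -[leLHS]powRr1 ?(ltW t0)//; apply: ger_powR => //; rewrite t0.
  by rewrite ler_peMl.
apply: (le_trans (Kfun_norm _ (ltW t0))); apply: (le_trans (Hc b)).
by rewrite ler_peMl ?powR_ge1// mulr_ge0//; exact: le_trans c1.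
Qed.

(** For [t <= 1] compare the powers of [t]; for [t >= 1] use that [K(t, x)] is at
    most the norm in E_0. *)
Lemma ile_embed : exists2 c, 1 <= c & forall theta theta' x M,
  0 <= theta -> theta <= theta' -> ile theta' x M -> ile theta x (c * M).
Proof.
have [c c1 Hc] := ile_norm; exists c => // theta theta' x M h0 hh H t t0.
have M0 := ile_ge0 H.
have [t1|/ltW t1] := leP t 1.
  apply: (le_trans (H t t0)); apply: ler_pM; rewrite ?powR_ge0//.
    by apply: ger_powR => //; rewrite t0.
  by rewrite ler_peMl.
apply: (le_trans (Kfun_norm _ (ltW t0))); apply: (le_trans (Hc _ _ _ H)).
by rewrite ler_peMl ?powR_ge1// mulr_ge0//; exact: le_trans c1.
Qed.

(** Since E_1 lies in the real interpolation space, whatever it approximates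
    does too. *)
Lemma cont_interpP theta x : 0 <= theta <= 1 -> cont_interp j theta x <->
  forall e, 0 < e -> exists y : E1, ile theta (x - j y) e.
Proof.
move=> h01; have [c c1 Hc] := ile_j; split=> [[rx H] e /H[y Hy]|H].
  exists y; have ri : real_interp j theta (x - j y).
    by apply: ile_real_interp; apply: ileB; [exact: real_interp_ile|exact: Hc].
  by apply: ile_le (real_interp_ile ri) (ltW Hy).
split.
  have [y Hy] := H 1 ltr01.
  have : ile theta (x - j y + j y) (1 + c * `|y|) by apply: ileD => //; exact: Hc.
  by rewrite subrK; exact: ile_real_interp.
move=> e e0; have [y Hy] := H (e / 2) (divr_gt0 e0 (ltr0n _ 2)); exists y.
by apply: (le_lt_trans (ile_inorm Hy)); lra.
Qed.

Section Space.
Variable theta : R.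
Hypothesis h01 : 0 <= theta <= 1.

Lemma ci_ile x : cont_interp j theta x -> ile theta x (inorm j theta x).
Proof. by case=> /real_interp_ile. Qed.

Lemma ci_j b : cont_interp j theta (j b).
Proof. by apply/cont_interpP => // e e0; exists b; rewrite subrr; apply: ile0; exact: ltW. Qed.

Lemma ci0 : cont_interp j theta 0.
Proof. by rewrite -(linear0 j); exact: ci_j. Qed.

Lemma ciD x y : cont_interp j theta x -> cont_interp j theta y -> cont_interp j theta (x + y).
Proof.
move=> /cont_interpP Hx /cont_interpP Hy; apply/cont_interpP => // e e0.
have e2 : 0 < e / 2 by lra.
have [a Ha] := Hx h01 _ e2; have [b Hb] := Hy h01 _ e2; exists (a + b).
rewrite linearD opprD addrACA; apply: ile_le (ileD Ha Hb) _; lra.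
Qed.

Lemma ciZ k x : cont_interp j theta x -> cont_interp j theta (k *: x).
Proof.
move=> /cont_interpP Hx; apply/cont_interpP => // e e0.
have k1 : 0 < `|k| + 1 by rewrite ltr_pwDr.
have e2 : 0 < e / (`|k| + 1) by rewrite divr_gt0.
have [a Ha] := Hx h01 _ e2; exists (k *: a).
rewrite linearZ -scalerBr; apply: ile_le (ileZ k Ha) _.
rewrite mulrCA -[leRHS]mulr1 ler_wpM2l ?(ltW e0)// ler_pdivrMr//; lra.
Qed.

Lemma ciB x y : cont_interp j theta x -> cont_interp j theta y -> cont_interp j theta (x - y).
Proof. by move=> Hx Hy; rewrite -scaleN1r; apply: ciD => //; exact: ciZ. Qed.

Lemma ci_closed x : (forall e, 0 < e -> exists2 y, cont_interp j theta y & ile theta (x - y) e) ->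
  cont_interp j theta x.
Proof.
move=> H; apply/cont_interpP => // e e0; have e2 : 0 < e / 2 by lra.
have [y /cont_interpP Hy Hxy] := H _ e2; have [b Hb] := Hy h01 _ e2; exists b.
have -> : x - j b = (x - y) + (y - j b) by rewrite addrA subrK.
by apply: ile_le (ileD Hxy Hb) _; lra.
Qed.

(** [K(t, .)] is continuous for the norm of E_0. *)
Lemma ile_lim x (u : nat -> E0) M :
  (forall e, 0 < e -> exists n, `|x - u n| <= e /\ ile theta (u n) M) -> ile theta x M.
Proof.
move=> H t t0; apply/ler_addgt0Pr => e e0; have [n [Hn Hi]] := H e e0.
have -> : x = u n + (x - u n) by rewrite addrC subrK.
apply: (le_trans (Kfun_add _ _ (ltW t0))); apply: lerD; first exact: Hi.
by apply: le_trans Hn; exact: Kfun_norm (ltW t0).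
Qed.

End Space.

Lemma ci_embed theta theta' x : 0 <= theta -> theta <= theta' -> theta' <= 1 ->
  cont_interp j theta' x -> cont_interp j theta x.
Proof.
move=> h0 hh h1 /cont_interpP Hx; have h01' : 0 <= theta' <= 1 by apply/andP; lra.
have [c c1 Hc] := ile_embed; have c0 : 0 < c by exact: lt_le_trans c1.
apply/cont_interpP => [|e e0]; first by apply/andP; lra.
have [a Ha] := Hx h01' (e / c) (divr_gt0 e0 c0); exists a.
by apply: ile_le (Hc _ _ _ _ h0 hh Ha) _; rewrite mulrC divfK// gt_eqF.
Qed.

Section Traces.
Variable mu : R.
Hypothesis mu01 : 0 < mu < 1.
Let mu0 : 0 < mu. Proof. by case/andP: mu01. Qed.
Let mu1 : mu < 1. Proof. by case/andP: mu01. Qed.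

(** The E_1 norm bounds [K(t, .)] for [t <= s], the E_mu norm for [t >= s]. *)
Lemma ile_weighted theta s w M : mu <= theta <= 1 -> 0 < s -> ile mu (j w) M ->
  `|w| <= s `^ (mu - 1) * M -> ile theta (j w) (s `^ (mu - theta) * M).
Proof.
have m0 := mu0; have m1 := mu1.
move=> /andP[mt t1] s0 HM Hw t t0; have M0 := ile_ge0 HM.
rewrite mulrA; have [ts|/ltW st] := leP t s.
  apply: (le_trans (Kfun_j _ (ltW t0))).
  apply: (@le_trans _ _ (t * (s `^ (mu - 1) * M))); first by rewrite ler_wpM2l// ltW.
  by rewrite mulrA ler_wpM2r// powR_low// t0.
by apply: (le_trans (HM t t0)); rewrite ler_wpM2r// powR_high// s0.
Qed.

(** For [t <= s] the E_1 norm bounds [K(t, .)]; for [t >= s] the point is written as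
    its starting value plus a displacement that is small in E_0. *)
Lemma ile_trace theta s C x0 w P N : mu <= theta <= 1 -> 0 < s -> 1 <= C ->
  `|j w - x0| <= C * (s `^ mu * P) -> `|w| <= s `^ (mu - 1) * P -> ile theta x0 N ->
  ile theta (j w) (N + C * (s `^ (mu - theta) * P)).
Proof.
have m0 := mu0; have m1 := mu1.
move=> /andP[mt t1] s0 C1 Hd Hw HN t t0; have N0 := ile_ge0 HN.
have C0 : 0 <= C by lra.
have P0 : 0 <= P.
  have := le_trans (normr_ge0 _) Hw; rewrite pmulr_rge0// powR_gt0//.
have [ts|/ltW st] := leP t s.
  apply: (le_trans (Kfun_j _ (ltW t0))).
  apply: (@le_trans _ _ (t * (s `^ (mu - 1) * P))); first by rewrite ler_wpM2l// ltW.
  rewrite mulrA; apply: (@le_trans _ _ (t `^ theta * (s `^ (mu - theta) * P))).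
    by rewrite [leRHS]mulrA ler_wpM2r// powR_low// t0.
  rewrite ler_wpM2l ?powR_ge0//.
  have : 0 <= s `^ (mu - theta) * P by rewrite mulr_ge0// powR_ge0.
  by move=> h; apply: (@le_trans _ _ (C * (s `^ (mu - theta) * P))); [rewrite ler_peMl|rewrite lerDr].
have -> : j w = x0 + (j w - x0) by rewrite addrC subrK.
apply: (le_trans (Kfun_add _ _ (ltW t0))); rewrite mulrDr; apply: lerD; first exact: HN.
apply: (le_trans (Kfun_norm _ (ltW t0))); apply: (le_trans Hd).
rewrite [leRHS]mulrCA ler_wpM2l// mulrA ler_wpM2r//.
have -> : s `^ mu = s `^ theta * s `^ (mu - theta) by rewrite (@powR_split _ s _ _ mu)//; lra.
by rewrite ler_wpM2r ?powR_ge0// powR_le_base//; [have := mu0; lra|exact: ltW].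
Qed.

(** If [P] can be taken small on short intervals, this gives continuity in E_mu at
    time 0.  When [t <= s], the term [K(t, u(0))] is bounded by passing through the value
    [u(t)] at time [t]. *)
Lemma ile_trace_diff s C (u : R -> E0) (w : R -> E1) P : 0 < s -> 1 <= C ->
  (forall r, 0 < r <= s -> [/\ u r = j (w r), `|u r - u 0| <= C * (r `^ mu * P) & `|w r| <= r `^ (mu - 1) * P]) ->
  ile mu (u s - u 0) ((2 * C + 2) * P).
Proof.
have m0 := mu0; have m1 := mu1.
move=> s0 C1 H t t0.
have [us ds ws] := H s (introT andP (conj s0 (lexx s))).
have P0 : 0 <= P by have := le_trans (normr_ge0 _) ws; rewrite pmulr_rge0// powR_gt0.
have tP : 0 <= t `^ mu * P by rewrite mulr_ge0// powR_ge0.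
have CtP : 0 <= C * (t `^ mu * P) by rewrite mulr_ge0//; lra.
have ttm r : 0 < r -> r * r `^ (mu - 1) = r `^ mu.
  by move=> r0; rewrite -{1}(powRr1 (ltW r0)) (@powR_split _ r _ _ mu)//; lra.
have goalE : t `^ mu * ((2 * C + 2) * P) = 2 * (C * (t `^ mu * P)) + 2 * (t `^ mu * P) by ring.
rewrite goalE; have [ts|/ltW st] := leP t s; last first.
  apply: (le_trans (Kfun_norm _ (ltW t0))); apply: (le_trans ds).
  have : s `^ mu * P <= t `^ mu * P by rewrite ler_wpM2r// powR_le_base// ltW.
  by move=> /(ler_wpM2l (le_trans ler01 C1)); lra.
have [ut dt wt] := H t (introT andP (conj t0 ts)).
have K1 : Kfun j t (u s) <= t `^ mu * P.
  rewrite us; apply: (le_trans (Kfun_j _ (ltW t0))).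
  apply: (@le_trans _ _ (t * (t `^ (mu - 1) * P))); last by rewrite mulrA ttm.
  rewrite ler_wpM2l ?(ltW t0)//; apply: (le_trans ws); rewrite ler_wpM2r// powR_le_basen//; lra.
have K2 : Kfun j t (u 0) <= C * (t `^ mu * P) + t `^ mu * P.
  have -> : u 0 = j (w t) - (u t - u 0) by rewrite ut opprB addrC subrK.
  apply: (le_trans (Kfun_add _ _ (ltW t0))); rewrite addrC; apply: lerD.
    by apply: (le_trans (Kfun_opp _ (ltW t0))); apply: le_trans dt; exact: Kfun_norm (ltW t0).
  apply: (le_trans (Kfun_j _ (ltW t0))); apply: (@le_trans _ _ (t * (t `^ (mu - 1) * P))).
    by rewrite ler_wpM2l// ltW.
  by rewrite mulrA ttm.
have := Kfun_add (u s) (- u 0) (ltW t0); have := Kfun_opp (u 0) (ltW t0); lra.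
Qed.

(** An almost optimal decomposition for [K(s, x)].  Its E_0 part is bounded in E_theta
    and, as [s] tends to 0, small in the weaker norm of E_mu. *)
Lemma ile_decomp theta s x N : mu <= theta <= 1 -> 0 < s -> ile theta x N -> 0 < N ->
  exists a b, [/\ x = a + j b, ile mu a (3 * s `^ (theta - mu) * N), ile theta a (3 * N) &
     `|b| <= 2 * s `^ (theta - 1) * N].
Proof.
have m0 := mu0; have m1 := mu1.
move=> /andP[mt t1] s0 HN N0.
have sN : 0 < s `^ theta * N by rewrite mulr_gt0// powR_gt0.
have [a [b [xab H]]] := Kfun_approx x (ltW s0) sN.
have {}H : `|a| + s * `|b| <= 2 * (s `^ theta * N) by have := HN s s0; lra.
have Ha : `|a| <= 2 * (s `^ theta * N).
  by have : 0 <= s * `|b| by [rewrite mulr_ge0// ltW]; lra.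
have Hb : `|b| <= 2 * s `^ (theta - 1) * N.
  have : s * `|b| <= 2 * (s `^ theta * N) by have := normr_ge0 a; lra.
  rewrite mulrC -ler_pdivlMr// => /le_trans; apply.
  rewrite -(@powR_split _ s theta (- 1) (theta - 1))// powR_inv1 ?(ltW s0)//.
  by rewrite le_eqVlt; apply/orP; left; apply/eqP; field; lra.
have low t : 0 < t <= s -> Kfun j t a <= t `^ theta * (3 * N).
  move=> /andP[t0 ts]; have -> : a = x - j b by rewrite xab addrK.
  apply: (le_trans (Kfun_add _ _ (ltW t0))).
  have : Kfun j t (- j b) <= t `^ theta * (2 * N).
    apply: (le_trans (Kfun_opp _ (ltW t0))); apply: (le_trans (Kfun_j _ (ltW t0))).
    apply: (@le_trans _ _ (t * (2 * s `^ (theta - 1) * N))); first by rewrite ler_wpM2l// ltW.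
    have := @powR_low _ t s theta theta _ t1; rewrite subrr powRr0 mulr1 t0 ts => /(_ isT) h.
    have := ler_wpM2r (ltW N0) h; lra.
  have := HN t t0; lra.
have high t : s <= t -> Kfun j t a <= 2 * (s `^ theta * N).
  by move=> st; apply: le_trans Ha; apply: Kfun_norm; lra.
exists a, b; split=> // t t0.
- have [ts|/ltW st] := leP t s.
    have h1 : 0 < t <= s by rewrite t0.
    apply: (le_trans (low t h1)).
    have -> : t `^ theta = t `^ mu * t `^ (theta - mu) by rewrite (@powR_split _ t _ _ theta)//; lra.
    rewrite -!mulrA ler_wpM2l ?powR_ge0// mulrCA ler_wpM2l// ler_wpM2r ?(ltW N0)//.
    by rewrite powR_le_base//; [have := mu0; lra|exact: ltW].
  apply: (le_trans (high t st)).
  have -> : s `^ theta = s `^ mu * s `^ (theta - mu) by rewrite (@powR_split _ s _ _ theta)//; lra.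
  have h : s `^ mu <= t `^ mu by rewrite powR_le_base// ltW.
  have q0 : 0 <= s `^ (theta - mu) * N by rewrite mulr_ge0 ?powR_ge0// ltW.
  have := ler_wpM2r q0 h; have : 0 <= t `^ mu * (s `^ (theta - mu) * N) by rewrite mulr_ge0// powR_ge0.
  lra.
- have [ts|/ltW st] := leP t s; first by apply: low; rewrite t0.
  apply: (le_trans (high t st)).
  have h : s `^ theta <= t `^ theta by rewrite powR_le_base//; [have := mu0; lra|exact: ltW].
  have := ler_wpM2r (ltW N0) h; have : 0 <= t `^ theta * N by rewrite mulr_ge0 ?powR_ge0// ltW.
  lra.
Qed.

End Traces.
End Interpolation.

(** * Weighted spaces of functions of time *)

Section Epsilon.
Context {R : realType} {E : normedModType R}.
Implicit Types (s t e d T : R).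

Lemma cvg_withinP (A : set R) t (f : R -> E) (l : E) :
  f s @[s --> within A (nbhs t)] --> l <->
  forall e, 0 < e -> exists2 d, 0 < d & forall s, A s -> `|s - t| < d -> `|f s - l| <= e.
Proof.
split=> [/cvgrPdist_le H e e0|H].
  have /nbhs_ballP[d d0 Hd] := H e e0; exists d => // s As st; rewrite distrC; apply: Hd => //.
  by rewrite /ball /= distrC.
apply/cvgrPdist_le => e e0; have [d d0 Hd] := H e e0.
apply/nbhs_ballP; exists d => // s; rewrite /ball /= distrC => st As; rewrite distrC; exact: Hd.
Qed.

Lemma cvg_within_dnbhsP (A : set R) t (f : R -> E) (l : E) :
  f s @[s --> within A t^'] --> l <->
  forall e, 0 < e -> exists2 d, 0 < d &
     forall s, A s -> s != t -> `|s - t| < d -> `|f s - l| <= e.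
Proof.
split=> [/cvgrPdist_le H e e0|H].
  have /nbhs_ballP[d d0 Hd] := H e e0; exists d => // s As st' st; rewrite distrC; apply: Hd => //.
  by rewrite /ball /= distrC.
apply/cvgrPdist_le => e e0; have [d d0 Hd] := H e e0.
apply/nbhs_ballP; exists d => // s; rewrite /ball /= distrC => st st' As; rewrite distrC; exact: Hd.
Qed.

Lemma within_lcont (A : set R) (f : R -> E) : {within A, continuous f} <-> lcont A f.
Proof.
split=> [/subspace_continuousP H t At e e0|H].
  by have /cvg_withinP/(_ e e0) := H t At.
by apply/subspace_continuousP => t At; apply/cvg_withinP; exact: H.
Qed.

Lemma derivative_onP (D : set R) (u du : R -> E) :
  (forall t, D t -> (s - t)^-1 *: (u s - u t) @[s --> within D t^'] --> du t) <->
  rsd D id u du.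
Proof.
have key s t (x y : E) : s != t -> `|(s - t)^-1 *: x - y| * `|s - t| = `|x - (s - t) *: y|.
  move=> st; rewrite mulrC -normrZ scalerBr scalerA divff ?scale1r// subr_eq0//.
split=> H t Dt.
  move=> e e0; have /cvg_within_dnbhsP/(_ e e0)[d d0 Hd] := H t Dt; exists d => // s Ds std /=.
  have [->|st] := eqVneq s t; first by rewrite !subrr scale0r subrr !normr0 mulr0.
  by rewrite -key// ler_wpM2r// Hd.
apply/cvg_within_dnbhsP => e e0; have [d d0 Hd] := H t Dt e e0; exists d => // s Ds st std.
have := Hd s Ds std; rewrite /= -key// ler_pM2r// normr_gt0 subr_eq0//.
Qed.

End Epsilon.

Section Powers.
Context {R : realType}.
Implicit Types (s t e d T : R).

Lemma powR_is_lcont p : lcont [set t : R | 0 < t] (fun t => t `^ p : R^o).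
Proof.
move=> t /= t0 e e0.
have c : {for t, continuous (fun s : R => s `^ p : R^o)}.
  by apply: differentiable_continuous; apply/derivable1_diffP; apply: derivable_powR; rewrite in_itv/= t0.
have /cvgrPdist_le/(_ e e0)/nbhs_ballP[d d0 Hd] := c.
by exists d => // s _ st; rewrite distrC; apply: Hd; rewrite /ball /= distrC.
Qed.

Lemma powR_rsd p : rsd [set t : R | 0 < t] id (fun t => t `^ p : R^o) (fun t => p * t `^ (p - 1)).
Proof.
apply/derivative_onP => t t0.
have [dv vE] := is_derive1_powR p t0.
have : (fun h : R => h^-1 *: ((h *: (1 : R) + t) `^ p - t `^ p : R^o)) @ 0^' --> (p * t `^ (p - 1) : R^o).
  by rewrite -vE; exact: dv.
move=> /(@cvgrPdist_le _ _ _ _ (dnbhs_filter _)) H.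
apply/cvg_within_dnbhsP => e e0; have /nbhs_ballP[d d0 Hd] := H e e0.
exists d => // s s0 st std; rewrite distrC.
have := Hd (s - t); rewrite /ball /= sub0r normrN subr_eq0 => /(_ std st).
by rewrite /GRing.scale /= mulr1 subrK.
Qed.

Lemma powR_small p e : 0 < p -> 0 < e -> exists2 d : R, 0 < d & forall t, 0 < t -> t < d -> t `^ p <= e.
Proof.
move=> p0 e0; exists (e `^ p^-1) => [|t t0 td]; first by rewrite powR_gt0.
have -> : e = (e `^ p^-1) `^ p by rewrite -powRrM mulVf ?powRr1 ?(ltW e0)// gt_eqF.
by apply: powR_le_base; exact: ltW.
Qed.

End Powers.

Section LcontOps.
Context {R : realType} {E F : normedModType R}.
Implicit Types (s t e d T : R) (A : set R).

Lemma lcontD A (u v : R -> E) : lcont A u -> lcont A v -> lcont A (fun t => u t + v t).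
Proof.
move=> Hu Hv t At e e0; have e2 : 0 < e / 2 by lra.
have [d1 d10 H1] := Hu t At _ e2; have [d2 d20 H2] := Hv t At _ e2.
exists (Num.min d1 d2); first by rewrite lt_min d10.
move=> s As; rewrite lt_min => /andP[s1 s2].
have -> : u s + v s - (u t + v t) = (u s - u t) + (v s - v t) by lmod_eq R.
apply: (le_trans (ler_normD _ _)); have := H1 s As s1; have := H2 s As s2; lra.
Qed.

Lemma lcontZ A k (u : R -> E) : lcont A u -> lcont A (fun t => k *: u t).
Proof.
move=> Hu t At e e0; have k1 : 0 < `|k| + 1 by rewrite ltr_pwDr.
have e2 : 0 < e / (`|k| + 1) by rewrite divr_gt0.
have [d1 d10 H1] := Hu t At _ e2; exists d1 => // s As s1.
rewrite -scalerBr normrZ; apply: (le_trans (ler_wpM2l (normr_ge0 _) (H1 s As s1))).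
rewrite mulrCA -[leRHS]mulr1 ler_wpM2l ?(ltW e0)// ler_pdivrMr//; lra.
Qed.

Lemma lcont_cst A (x : E) : lcont A (fun=> x).
Proof. by move=> t At e e0; exists 1 => // s _ _; rewrite subrr normr0 ltW. Qed.

Lemma lcont_lin A C (B : {linear E -> F}) (u : R -> E) : 1 <= C ->
  (forall y, `|B y| <= C * `|y|) -> lcont A u -> lcont A (fun t => B (u t)).
Proof.
move=> C1 HB Hu t At e e0; have C0 : 0 < C by lra.
have [d d0 Hd] := Hu t At _ (divr_gt0 e0 C0); exists d => // s As sd.
rewrite -linearB; apply: (le_trans (HB _)).
by rewrite mulrC -ler_pdivlMr//; exact: Hd.
Qed.

Lemma lcont_eq A (u v : R -> E) : (forall t, A t -> u t = v t) -> lcont A u -> lcont A v.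
Proof.
move=> uv H t At e e0; have [d d0 Hd] := H t At e e0; exists d => // s As sd.
by rewrite -!uv//; exact: Hd.
Qed.

Lemma lcont_scale A (p : R -> R^o) (u : R -> E) : lcont A p -> lcont A u -> lcont A (fun t => p t *: u t).
Proof.
move=> Hp Hu t At e e0.
have k1 : 0 < 1 + `|p t| by have := normr_ge0 (p t); lra.
have k2 : 0 < 1 + `|u t| by have := normr_ge0 (u t); lra.
have e1 : 0 < Num.min 1 (e / (2 * (1 + `|u t|))) by rewrite lt_min ltr01 divr_gt0//; lra.
have e2 : 0 < e / (2 * (1 + `|p t|)) by rewrite divr_gt0//; lra.
have [d1 d10 H1] := Hp t At _ e1; have [d2 d20 H2] := Hu t At _ e2.
exists (Num.min d1 d2); first by rewrite lt_min d10.
move=> s As; rewrite lt_min => /andP[s1 s2].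
have := H1 s As s1; have {}H2 := H2 s As s2; rewrite le_min => /andP[P1 P2].
have -> : p s *: u s - p t *: u t = p s *: (u s - u t) + (p s - p t) *: u t by lmod_eq R.
apply: (le_trans (ler_normD _ _)); rewrite !normrZ.
have Q1 : `|p s| <= 1 + `|p t|.
  by rewrite -[p s](subrK (p t)); apply: (le_trans (ler_normD _ _)); lra.
have Q2 : `|p s| * `|u s - u t| <= e / 2.
  have -> : e / 2 = (1 + `|p t|) * (e / (2 * (1 + `|p t|))) by field; lra.
  exact: ler_pM.
have Q3 : `|p s - p t| * `|u t| <= e / 2.
  have -> : e / 2 = (e / (2 * (1 + `|u t|))) * (1 + `|u t|) by field; lra.
  by apply: ler_pM => //; lra.
by lra.
Qed.

End LcontOps.

Section WeightedSpaces.
Context {R : realType}.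
Implicit Types (mu s t e d T M : R).

Definition wbound (E : normedModType R) mu T (v : R -> E) M :=
  forall t, 0 < t <= T -> t `^ (1 - mu) * `|v t| <= M.

Definition wvanish (E : normedModType R) mu T (v : R -> E) :=
  forall e, 0 < e -> exists2 d, 0 < d & forall t, 0 < t <= T -> t < d -> t `^ (1 - mu) * `|v t| <= e.

Lemma BCwP (E : completeNormedModType R) mu T (v : R -> E) : 0 < T ->
  BCw mu T v <-> [/\ lcont [set t | 0 < t <= T] v, (exists M, wbound mu T v M) & wvanish mu T v].
Proof.
move=> T0; have setE : [set` `]0, T]] = [set t : R | 0 < t <= T].
  by apply/seteqP; split=> t; rewrite /= in_itv.
have nrm t (x : E) : `|t `^ (1 - mu) *: x| = t `^ (1 - mu) * `|x|.
  by rewrite normrZ ger0_norm// powR_ge0.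
split=> [[/within_lcont H1 _ [M [Mr HM]] H3]|[H1 [M HM] H3]].
  rewrite setE in H1; split => //.
    exists (M + 1) => t tT; rewrite -nrm; apply: (HM (M + 1)); first by rewrite ltrDl.
    by rewrite /= in_itv.
  move=> e e0; have /cvg_withinP/(_ e e0)[d d0 Hd] := H3; exists d => // t /andP[t0 tT] td.
  by have := Hd t t0; rewrite subr0 gtr0_norm// => /(_ td); rewrite subr0 normr_id nrm.
have cs : lcont [set t | 0 < t <= T] (fun t => t `^ (1 - mu) *: v t).
  apply: lcont_scale => //; apply: lcont_mono (powR_is_lcont _) => t /andP[]//.
split.
- by rewrite setE; exact/within_lcont.
- by rewrite setE; exact/within_lcont.
- exists `|M|; split => [|x Mx t /=]; first by rewrite num_real.
  rewrite in_itv /= => tT; rewrite nrm; apply: (le_trans (HM t tT)).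
  by apply: ltW; apply: le_lt_trans Mx; exact: ler_norm.
- apply/cvg_withinP => e e0; have [d d0 Hd] := H3 e e0.
  exists (Num.min d T); first by rewrite lt_min d0.
  move=> t t0; rewrite subr0 gtr0_norm// lt_min => /andP[td tT].
  by rewrite subr0 normr_id nrm Hd// t0 ltW.
Qed.

(** The space BC_(1-mu)([[0, T]], E), written without filters; see [BCwP]. *)
Definition wC (E : normedModType R) mu T (v : R -> E) :=
  [/\ lcont [set t | 0 < t <= T] v, (exists M, wbound mu T v M) & wvanish mu T v].

Section WC.
Variables (E : normedModType R) (mu T : R).
Implicit Types u v : R -> E.

Lemma wboundD u v M N : wbound mu T u M -> wbound mu T v N -> wbound mu T (fun t => u t + v t) (M + N).
Proof.
move=> Hu Hv t tT; apply: (le_trans _ (lerD (Hu t tT) (Hv t tT))).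
by rewrite -mulrDr ler_wpM2l ?powR_ge0// ler_normD.
Qed.

Lemma wboundZ k u M : wbound mu T u M -> wbound mu T (fun t => k *: u t) (`|k| * M).
Proof. by move=> Hu t tT; rewrite normrZ mulrCA ler_wpM2l//; exact: Hu. Qed.

Lemma wbound_le T' u M N : T' <= T -> M <= N -> wbound mu T u M -> wbound mu T' u N.
Proof.
move=> TT MN H t /andP[t0 tT]; apply: le_trans MN; apply: H.
by rewrite t0 (le_trans tT).
Qed.

Lemma wbound_eq u v M : (forall t, 0 < t <= T -> u t = v t) -> wbound mu T u M -> wbound mu T v M.
Proof. by move=> uv H t tT; rewrite -uv//; exact: H. Qed.

Lemma wC_eq u v : (forall t, 0 < t <= T -> u t = v t) -> wC mu T u -> wC mu T v.
Proof.
move=> uv [H1 [M HM] H3]; split; first exact: (lcont_eq _ H1).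
  by exists M; exact: wbound_eq HM.
move=> e e0; have [d d0 Hd] := H3 e e0; exists d => // t tT td.
by rewrite -uv//; exact: Hd.
Qed.

Lemma wCD u v : wC mu T u -> wC mu T v -> wC mu T (fun t => u t + v t).
Proof.
move=> [Hu [M HM] Vu] [Hv [N HN] Vv]; split; first exact: lcontD.
  by exists (M + N); exact: wboundD.
move=> e e0; have e2 : 0 < e / 2 by lra.
have [d1 d10 H1] := Vu _ e2; have [d2 d20 H2] := Vv _ e2.
exists (Num.min d1 d2); first by rewrite lt_min d10.
move=> t tT; rewrite lt_min => /andP[t1 t2].
apply: (@le_trans _ _ (t `^ (1 - mu) * `|u t| + t `^ (1 - mu) * `|v t|)).
  by rewrite -mulrDr ler_wpM2l ?powR_ge0// ler_normD.
by have := H1 t tT t1; have := H2 t tT t2; lra.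
Qed.

Lemma wCZ k u : wC mu T u -> wC mu T (fun t => k *: u t).
Proof.
move=> [Hu [M HM] Vu]; split; first exact: lcontZ.
  by exists (`|k| * M); exact: wboundZ.
move=> e e0; have k1 : 0 < `|k| + 1 by rewrite ltr_pwDr.
have e2 : 0 < e / (`|k| + 1) by rewrite divr_gt0.
have [d1 d10 H1] := Vu _ e2; exists d1 => // t tT td; rewrite normrZ mulrCA.
apply: (le_trans (ler_wpM2l (normr_ge0 _) (H1 t tT td))).
rewrite mulrCA -[leRHS]mulr1 ler_wpM2l ?(ltW e0)// ler_pdivrMr//; lra.
Qed.

Lemma wC_cst (x : E) : mu < 1 -> wC mu T (fun=> x).
Proof.
move=> mu1; split; first exact: lcont_cst.
  exists (T `^ (1 - mu) * `|x|) => t /andP[t0 tT]; rewrite ler_wpM2r// powR_le_base//; [lra|exact: ltW].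
move=> e e0; have k1 : 0 < `|x| + 1 by rewrite ltr_pwDr.
have e2 : 0 < e / (`|x| + 1) by rewrite divr_gt0.
have p0 : 0 < 1 - mu by lra.
have [d d0 Hd] := powR_small p0 e2; exists d => // t /andP[t0 _] td.
apply: (le_trans (ler_wpM2r (normr_ge0 _) (Hd t t0 td))).
rewrite mulrAC -mulrA -[leRHS]mulr1 ler_wpM2l ?(ltW e0)// ler_pdivrMr//; lra.
Qed.

Lemma wC_restrict T' u : T' <= T -> wC mu T u -> wC mu T' u.
Proof.
move=> TT [Hu [M HM] Vu]; split.
- by apply: lcont_mono Hu => t /= /andP[-> tT] /=; exact: le_trans TT.
- by exists M; exact: (wbound_le TT (lexx M)).
- move=> e e0; have [d d0 Hd] := Vu e e0; exists d => // t /andP[t0 tT]; apply: Hd.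
  by rewrite t0 (le_trans tT).
Qed.

(** Away from 0 the weighted norm dominates the uniform one, so continuity passes to
    the limit. *)
Lemma wC_lim u : mu < 1 -> (forall e, 0 < e -> exists2 v, wC mu T v & wbound mu T (fun t => u t - v t) e) ->
  wC mu T u.
Proof.
move=> mu1 H; split.
- move=> t tT e e0; have /andP[t0 _] := tT.
  have t20 : 0 < t / 2 by lra.
  pose k := (t / 2) `^ (1 - mu); have k0 : 0 < k by exact: powR_gt0.
  have e3 : 0 < e / 3 by lra.
  have [v [Hv _ _] Huv] := H _ (mulr_gt0 k0 e3).
  have close s : 0 < s <= T -> t / 2 <= s -> `|u s - v s| <= e / 3.
    move=> sT ts; rewrite -(ler_pM2l k0); apply: le_trans (Huv s sT).
    by rewrite ler_wpM2r// /k powR_le_base//; [lra|exact: ltW].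
  have [d d0 Hd] := Hv t tT _ e3.
  exists (Num.min d (t / 2)); first by rewrite lt_min d0.
  move=> s sT; rewrite lt_min => /andP[sd]; rewrite ltr_norml => /andP[st1 _].
  have c1 := close s sT; have c2 := close t tT; have := Hd s sT sd.
  have -> : u s - u t = (u s - v s) - (u t - v t) + (v s - v t) by lmod_eq R.
  move=> c3; apply: (le_trans (ler_normD _ _)); apply: (le_trans (lerD (ler_normB _ _) (lexx _))).
  have {}c1 : `|u s - v s| <= e / 3 by apply: c1; lra.
  have {}c2 : `|u t - v t| <= e / 3 by apply: c2; lra.
  by lra.
- have [v [_ [M HM] _] Hv] := H 1 ltr01; exists (1 + M).
  by apply: wbound_eq (wboundD Hv HM) => t _; rewrite subrK.
- move=> e e0; have e2 : 0 < e / 2 by lra.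
  have [v [_ _ Vv] Hv] := H _ e2; have [d d0 Hd] := Vv _ e2; exists d => // t tT td.
  rewrite -[u t](subrK (v t)).
  apply: (@le_trans _ _ (t `^ (1 - mu) * `|u t - v t| + t `^ (1 - mu) * `|v t|)).
    by rewrite -mulrDr ler_wpM2l ?powR_ge0// ler_normD.
  by have := Hv t tT; have := Hd t tT td; lra.
Qed.

End WC.

Lemma wC_lin (E F : completeNormedModType R) mu T (B : {linear E -> F}) (u : R -> E) :
  continuous B -> wC mu T u -> wC mu T (fun t => B (u t)).
Proof.
move=> /bounded_lin[C C1 HB] [Hu [M HM] Vu]; have C0 : 0 < C by lra.
have key t e : t `^ (1 - mu) * `|u t| <= e / C -> t `^ (1 - mu) * `|B (u t)| <= e.
  rewrite ler_pdivlMr// => H; apply: le_trans H.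
  by rewrite -mulrA ler_wpM2l ?powR_ge0// mulrC.
split; first exact: lcont_lin HB Hu.
  by exists (M * C) => t tT; apply: key; rewrite mulfK ?gt_eqF//; exact: HM.
move=> e e0; have [d d0 Hd] := Vu _ (divr_gt0 e0 C0); exists d => // t tT td.
exact/key/Hd.
Qed.

End WeightedSpaces.

Section RsdOps.
Context {R : realType} {E : normedModType R}.
Implicit Types (A : set R) (u v du dv : R -> E) (Phi : R -> R).

Lemma rsdD A Phi u v du dv : rsd A Phi u du -> rsd A Phi v dv ->
  rsd A Phi (fun t => u t + v t) (fun t => du t + dv t).
Proof.
move=> Hu Hv t At e e0; have e2 : 0 < e / 2 by lra.
have [d1 d10 H1] := Hu t At _ e2; have [d2 d20 H2] := Hv t At _ e2.
exists (Num.min d1 d2); first by rewrite lt_min d10.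
move=> s As; rewrite lt_min => /andP[s1 s2].
have -> : u s + v s - (u t + v t) - (Phi s - Phi t) *: (du t + dv t) =
  (u s - u t - (Phi s - Phi t) *: du t) + (v s - v t - (Phi s - Phi t) *: dv t) by lmod_eq R.
apply: (le_trans (ler_normD _ _)); have := H1 s As s1; have := H2 s As s2; lra.
Qed.

Lemma rsdZ A Phi k u du : rsd A Phi u du -> rsd A Phi (fun t => k *: u t) (fun t => k *: du t).
Proof.
move=> Hu t At e e0; have k1 : 0 < `|k| + 1 by rewrite ltr_pwDr.
have e2 : 0 < e / (`|k| + 1) by rewrite divr_gt0.
have [d1 d10 H1] := Hu t At _ e2; exists d1 => // s As s1.
have -> : k *: u s - k *: u t - (Phi s - Phi t) *: (k *: du t) =
  k *: (u s - u t - (Phi s - Phi t) *: du t) by lmod_eq R.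
rewrite normrZ; apply: (le_trans (ler_wpM2l (normr_ge0 _) (H1 s As s1))).
rewrite mulrA ler_wpM2r// mulrCA -[leRHS]mulr1 ler_wpM2l ?(ltW e0)// ler_pdivrMr//; lra.
Qed.

Lemma rsdB A Phi u v du dv : rsd A Phi u du -> rsd A Phi v dv ->
  rsd A Phi (fun t => u t - v t) (fun t => du t - dv t).
Proof.
move=> Hu Hv t At e e0; have [d d0 H] := rsdD Hu (rsdZ (-1) Hv) At e0.
exists d => // s As sd; have := H s As sd; by rewrite !scaleN1r.
Qed.

Lemma rsd_cst A Phi (x : E) : rsd A Phi (fun=> x) (fun=> 0).
Proof.
move=> t At e e0; exists 1 => // s As _.
by rewrite scaler0 !subrr normr0 mulr_ge0// ltW.
Qed.

Lemma rsd_eq A Phi u v du dv : (forall t, A t -> u t = v t) -> (forall t, A t -> du t = dv t) ->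
  rsd A Phi u du -> rsd A Phi v dv.
Proof.
move=> uv duv H t At e e0; have [d d0 Hd] := H t At e e0; exists d => // s As sd.
by rewrite -!uv// -duv//; exact: Hd.
Qed.

End RsdOps.

Lemma rsd_lin (R : realType) (E F : completeNormedModType R) (B : {linear E -> F}) A Phi (u du : R -> E) :
  continuous B -> rsd A Phi u du -> rsd A Phi (fun t => B (u t)) (fun t => B (du t)).
Proof.
move=> /bounded_lin[C C1 HB] Hu t At e e0; have C0 : 0 < C by lra.
have [d d0 Hd] := Hu t At _ (divr_gt0 e0 C0); exists d => // s As sd.
rewrite -linearB -linearZ -linearB; apply: (le_trans (HB _)).
by rewrite mulrC -ler_pdivlMr// mulrAC; exact: Hd.
Qed.

Section MeanValue0.
Context {R : realType} {E : normedModType R}.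
Implicit Types (s t d e T M mu : R) (u du : R -> E).

Definition cont0 (F : normedModType R) T (u : R -> F) :=
  forall e, 0 < e -> exists2 d, 0 < d & forall t, 0 < t <= T -> t < d -> `|u t - u 0| <= e.

Lemma mean_value0 T u du (Phi dPhi : R -> R^o) :
  (forall s t, 0 <= s -> s <= t -> t <= T -> Phi s <= Phi t) ->
  rsd [set t | 0 < t <= T] id u du -> rsd [set t | 0 < t <= T] id Phi dPhi ->
  (forall t, 0 < t <= T -> `|du t| <= dPhi t) -> cont0 T u ->
  forall s t, 0 <= s -> s <= t -> t <= T -> `|u t - u s| <= Phi t - Phi s.
Proof.
move=> mono Hu HP Hle c0.
have pos s t : 0 < s -> s <= t -> t <= T -> `|u t - u s| <= Phi t - Phi s.
  move=> s0 st tT; apply: (@mean_value R E u du Phi dPhi) => //.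
  - by move=> s' t' ? ? ?; apply: mono => //; lra.
  - by apply: rsd_mono Hu => r /= /andP[? ?]; apply/andP; lra.
  - by apply: rsd_mono HP => r /= /andP[? ?]; apply/andP; lra.
  - by move=> r /andP[? ?]; apply: Hle; apply/andP; lra.
move=> s t s0 st tT; have [/pos|s0'] := ltP 0 s; first exact.
have -> : s = 0 by lra.
have [t0|t0] := ltP 0 t; last first.
  by have -> : t = 0 by [lra]; rewrite !subrr normr0.
apply/ler_addgt0Pr => e e0; have [d d00 Hd] := c0 e e0.
pose r := Num.min t (d / 2).
have r0 : 0 < r by rewrite /r lt_min t0; lra.
have rt : r <= t by rewrite /r ge_min lexx.
have rd : r < d by rewrite /r gt_min; apply/orP; right; lra.
have -> : u t - u 0 = (u t - u r) + (u r - u 0) by rewrite addrA subrK.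
apply: (le_trans (ler_normD _ _)).
have rT : 0 < r <= T by rewrite r0 (le_trans rt).
have := Hd r rT rd; have := pos r t r0 rt tT; have := mono 0 r (lexx 0) (ltW r0) (le_trans rt tT); lra.
Qed.

(** The primitive of [t^(mu-1) M] is [mu^-1 t^mu M]. *)
Lemma weighted_mean_value mu T u du M : 0 < mu -> 0 <= M ->
  rsd [set t | 0 < t <= T] id u du -> wbound mu T du M -> cont0 T u ->
  forall t, 0 < t <= T -> `|u t - u 0| <= mu^-1 * (t `^ mu * M).
Proof.
move=> mu0 M0 Hu Hb c0 t /andP[t0 tT].
pose Phi s : R^o := (mu^-1 * M) *: (s `^ mu : R^o).
pose dPhi s : R^o := (mu^-1 * M) *: (mu * s `^ (mu - 1) : R^o).
have HM : 0 <= mu^-1 * M by rewrite mulr_ge0// invr_ge0 ltW.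
have := @mean_value0 T u du Phi dPhi _ Hu _ _ c0 0 t (lexx 0) (ltW t0) tT.
rewrite /Phi powR0 ?gt_eqF// scaler0 subr0 => H.
apply: (le_trans (H _ _ _)).
- by move=> s r s0 sr rT; rewrite /Phi /GRing.scale /= ler_wpM2l// powR_le_base// ltW.
- by apply: rsdZ; apply: rsd_mono (powR_rsd mu) => r /= /andP[].
- move=> r /andP[r0 rT].
  have -> : dPhi r = r `^ (mu - 1) * M.
    by rewrite /dPhi /GRing.scale /=; field; lra.
  rewrite -[mu - 1]opprB powRN mulrC ler_pdivlMr ?powR_gt0// mulrC; apply: Hb; rewrite r0//.
- by rewrite /GRing.scale /= -mulrA [M * _]mulrC.
Qed.

End MeanValue0.

Section Glue.
Context {R : realType} {E : normedModType R}.
Implicit Types (A : set R) (u v du dv : R -> E) (s t h T d e : R).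

Definition paste (F : Type) T (u v : R -> F) t := if t <= T then u t else v t.

Lemma paste_r (F : Type) T (u v : R -> F) t : u T = v T -> T <= t -> paste T u v t = v t.
Proof.
by move=> uv Tt; rewrite /paste; case: leP => // tT; have -> : t = T by [lra].
Qed.

Lemma paste_l (F : Type) T (u v : R -> F) t : t <= T -> paste T u v t = u t.
Proof. by rewrite /paste => ->. Qed.

Lemma lcont_paste A T u v : lcont (A `&` [set t | t <= T]) u -> lcont (A `&` [set t | T <= t]) v ->
  u T = v T -> lcont A (paste T u v).
Proof.
move=> Hu Hv uv t At e e0; case: (ltgtP t T) => tT.
- have [d d0 Hd] := Hu t (conj At (ltW tT)) e e0.
  exists (Num.min d (T - t)); first by rewrite lt_min d0 subr_gt0.
  move=> s As; rewrite lt_min [X in _ && X]ltr_norml => /andP[sd /andP[_ s2]].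
  by rewrite !paste_l//; [apply: Hd => //; split => //=; lra|exact: ltW|lra].
- have [d d0 Hd] := Hv t (conj At (ltW tT)) e e0.
  exists (Num.min d (t - T)); first by rewrite lt_min d0 subr_gt0.
  move=> s As; rewrite lt_min [X in _ && X]ltr_norml => /andP[sd /andP[s1 _]].
  by rewrite !paste_r//; [apply: Hd => //; split => //=; lra|exact: ltW|lra].
- have [d1 d10 H1] : exists2 d, 0 < d & forall s, (A `&` [set t | t <= T]) s -> `|s - t| < d -> `|u s - u t| <= e.
    by apply: Hu => //; split => //=; rewrite tT.
  have [d2 d20 H2] : exists2 d, 0 < d & forall s, (A `&` [set t | T <= t]) s -> `|s - t| < d -> `|v s - v t| <= e.
    by apply: Hv => //; split => //=; rewrite tT.
  exists (Num.min d1 d2); first by rewrite lt_min d10.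
  move=> s As; rewrite lt_min => /andP[s1 s2]; have [sT|/ltW Ts] := leP s T.
    by rewrite !paste_l ?tT// -tT; apply: H1.
  by rewrite !paste_r ?tT// -tT; apply: H2.
Qed.

Lemma rsd_paste A T u v du dv : rsd (A `&` [set t | t <= T]) id u du ->
  rsd (A `&` [set t | T <= t]) id v dv ->
  u T = v T -> du T = dv T -> rsd A id (paste T u v) (paste T du dv).
Proof.
move=> Hu Hv uv duv t At e e0; case: (ltgtP t T) => tT.
- have [d d0 Hd] := Hu t (conj At (ltW tT)) e e0.
  exists (Num.min d (T - t)); first by rewrite lt_min d0 subr_gt0.
  move=> s As; rewrite lt_min [X in _ && X]ltr_norml => /andP[sd /andP[_ s2]].
  by rewrite !paste_l ?(ltW tT)//; [apply: Hd => //; split => //=; lra|lra].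
- have [d d0 Hd] := Hv t (conj At (ltW tT)) e e0.
  exists (Num.min d (t - T)); first by rewrite lt_min d0 subr_gt0.
  move=> s As; rewrite lt_min [X in _ && X]ltr_norml => /andP[sd /andP[s1 _]].
  by rewrite !paste_r ?(ltW tT)//; [apply: Hd => //; split => //=; lra|lra].
- have Tt : (A `&` [set t | t <= T]) t by split => //=; rewrite tT.
  have tT' : (A `&` [set t | T <= t]) t by split => //=; rewrite tT.
  have [d1 d10 H1] := Hu t Tt e e0; have [d2 d20 H2] := Hv t tT' e e0.
  exists (Num.min d1 d2); first by rewrite lt_min d10.
  move=> s As; rewrite lt_min => /andP[s1 s2]; have [sT|/ltW Ts] := leP s T.
    by rewrite !paste_l ?tT// -tT; apply: H1.
  by rewrite !paste_r ?tT// -tT; apply: H2.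
Qed.

Lemma lcont_shift A h u : lcont A u -> lcont [set t | A (t + h)] (fun t => u (t + h)).
Proof.
move=> Hu t At e e0; have [d d0 Hd] := Hu _ At e e0; exists d => // s As sd.
apply: Hd => //; by have -> : s + h - (t + h) = s - t by lra.
Qed.

Lemma rsd_shift A h u du : rsd A id u du -> rsd [set t | A (t + h)] id (fun t => u (t + h)) (fun t => du (t + h)).
Proof.
move=> Hu t At e e0; have [d d0 Hd] := Hu _ At e e0; exists d => // s As sd.
have := Hd (s + h) As; have -> : s + h - (t + h) = s - t by lra.
by move=> /(_ sd).
Qed.

(** The weight [t^(1-mu)] itself tends to 0. *)
Lemma lcont_bounded_wC mu T v M : mu < 1 -> lcont [set t | 0 < t <= T] v ->
  (forall t, 0 < t <= T -> `|v t| <= M) -> wC mu T v.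
Proof.
move=> mu1 Hv HM; split => //.
  exists (T `^ (1 - mu) * M) => t /andP[t0 tT]; apply: ler_pM; rewrite ?powR_ge0//.
    by apply: powR_le_base => //; [lra|exact: ltW].
  by apply: HM; rewrite t0.
move=> e e0; have k1 : 0 < `|M| + 1 by rewrite ltr_pwDr.
have e2 : 0 < e / (`|M| + 1) by rewrite divr_gt0.
have p0 : 0 < 1 - mu by lra.
have [d d0 Hd] := powR_small p0 e2; exists d => // t tT td; have /andP[t0 _] := tT.
have vM : `|v t| <= `|M| + 1 by have := HM t tT; have := ler_norm M; lra.
apply: (@le_trans _ _ ((e / (`|M| + 1)) * (`|M| + 1))); last by rewrite divfK// gt_eqF.
by apply: ler_pM; rewrite ?powR_ge0//; exact: Hd.
Qed.

End Glue.

Section Regular.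
Context {R : realType} {E0 E1 : completeNormedModType R} (j : {linear E1 -> E0}) (mu : R).
Hypothesis jc : continuous j.
Implicit Types (s t h T d e : R) (u du : R -> E0) (w : R -> E1).

(** The space E_(1,mu)([[0, T]]), written without filters; see [E1mu_reg]. *)
Definition reg T u du w := [/\ forall t, 0 < t <= T -> u t = j (w t),
  rsd [set t | 0 < t <= T] id u du, wC mu T du, wC mu T w & cont0 T u].

Lemma E1mu_reg T u du w : 0 < T -> E1mu j mu T u du w <-> reg T u du w.
Proof.
move=> T0; have setE : [set` `]0, T]] = [set t : R | 0 < t <= T].
  by apply/seteqP; split=> t; rewrite /= in_itv.
split=> [[ujw [Hd /(BCwP _ _ T0) Hu /(BCwP _ _ T0) Hdu] /(BCwP _ _ T0) Hw H0]|[ujw Hd Hdu Hw H0]].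
  split=> //; first by apply/derivative_onP; rewrite -setE.
  move=> e e0; have /cvg_withinP/(_ e e0)[d d0 H] := H0; exists d => // t /andP[t0 _] td.
  by apply: H => //; rewrite subr0 gtr0_norm.
split=> //; first split.
- by rewrite /derivative_on setE; apply/derivative_onP.
- by apply/(BCwP _ _ T0); apply: wC_eq (wC_lin jc Hw) => t /ujw.
- exact/(BCwP _ _ T0).
- exact/(BCwP _ _ T0).
- apply/cvg_withinP => e e0; have [d d0 H] := H0 e e0.
  exists (Num.min d T); first by rewrite lt_min d0.
  move=> t t0; rewrite subr0 gtr0_norm// lt_min => /andP[td tT].
  by apply: H => //; rewrite t0 ltW.
Qed.

Lemma cont0D (F : normedModType R) T (u v : R -> F) : cont0 T u -> cont0 T v -> cont0 T (fun t => u t + v t).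
Proof.
move=> Hu Hv e e0; have e2 : 0 < e / 2 by lra.
have [d1 d10 H1] := Hu _ e2; have [d2 d20 H2] := Hv _ e2.
exists (Num.min d1 d2); first by rewrite lt_min d10.
move=> t tT; rewrite lt_min => /andP[t1 t2].
have -> : u t + v t - (u 0 + v 0) = (u t - u 0) + (v t - v 0) by lmod_eq R.
apply: (le_trans (ler_normD _ _)); have := H1 t tT t1; have := H2 t tT t2; lra.
Qed.

Lemma cont0Z (F : normedModType R) T k (u : R -> F) : cont0 T u -> cont0 T (fun t => k *: u t).
Proof.
move=> Hu e e0; have k1 : 0 < `|k| + 1 by rewrite ltr_pwDr.
have e2 : 0 < e / (`|k| + 1) by rewrite divr_gt0.
have [d1 d10 H1] := Hu _ e2; exists d1 => // s As s1.
rewrite -scalerBr normrZ; apply: (le_trans (ler_wpM2l (normr_ge0 _) (H1 s As s1))).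
rewrite mulrCA -[leRHS]mulr1 ler_wpM2l ?(ltW e0)// ler_pdivrMr//; lra.
Qed.

Lemma regD T u1 du1 w1 u2 du2 w2 : reg T u1 du1 w1 -> reg T u2 du2 w2 ->
  reg T (fun t => u1 t + u2 t) (fun t => du1 t + du2 t) (fun t => w1 t + w2 t).
Proof.
move=> [a1 b1 c1 d1 e1] [a2 b2 c2 d2 e2]; split.
- by move=> t tT; rewrite a1// a2// linearD.
- exact: rsdD.
- exact: wCD.
- exact: wCD.
- exact: cont0D.
Qed.

Lemma regZ T k u1 du1 w1 : reg T u1 du1 w1 ->
  reg T (fun t => k *: u1 t) (fun t => k *: du1 t) (fun t => k *: w1 t).
Proof.
move=> [a1 b1 c1 d1 e1]; split.
- by move=> t tT; rewrite a1// linearZ.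
- exact: rsdZ.
- exact: wCZ.
- exact: wCZ.
- exact: cont0Z.
Qed.

Lemma regB T u1 du1 w1 u2 du2 w2 : reg T u1 du1 w1 -> reg T u2 du2 w2 ->
  reg T (fun t => u1 t - u2 t) (fun t => du1 t - du2 t) (fun t => w1 t - w2 t).
Proof.
move=> H1 /(regZ (-1)) H2; have := regD H1 H2.
rewrite (_ : (fun t => u1 t + -1 *: u2 t) = (fun t => u1 t - u2 t)); last by apply/funext => t; rewrite scaleN1r.
rewrite (_ : (fun t => du1 t + -1 *: du2 t) = (fun t => du1 t - du2 t)); last by apply/funext => t; rewrite scaleN1r.
by rewrite (_ : (fun t => w1 t + -1 *: w2 t) = (fun t => w1 t - w2 t))//; apply/funext => t; rewrite scaleN1r.
Qed.

Lemma reg_cst T b : mu < 1 -> reg T (fun=> j b) (fun=> 0) (fun=> b).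
Proof.
move=> mu1; split=> //; [exact: rsd_cst|exact: wC_cst|exact: wC_cst|].
by move=> e e0; exists 1 => // t _ _; rewrite subrr normr0 ltW.
Qed.

Lemma reg_restrict T T' u du w : T' <= T -> reg T u du w -> reg T' u du w.
Proof.
move=> TT [a1 b1 c1 d1 e1]; have sub t : 0 < t <= T' -> 0 < t <= T.
  by move=> /andP[-> /le_trans->].
split.
- by move=> t /sub/a1.
- by apply: rsd_mono b1 => t /sub.
- exact: wC_restrict c1.
- exact: wC_restrict d1.
- by move=> e e0; have [d d0 H] := e1 e e0; exists d => // t /sub; exact: H.
Qed.

Lemma reg_eq T u du w u' du' w' :
  (forall t, 0 <= t <= T -> u t = u' t) -> (forall t, 0 < t <= T -> du t = du' t) ->
  (forall t, 0 < t <= T -> w t = w' t) -> 0 <= T ->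
  reg T u du w -> reg T u' du' w'.
Proof.
move=> hu hdu hw T0 [a1 b1 c1 d1 e1].
have hu' t : 0 < t <= T -> u t = u' t by move=> /andP[t0 tT]; apply: hu; rewrite (ltW t0).
split.
- by move=> t tT; rewrite -hu'// -hw// a1.
- exact: rsd_eq b1.
- exact: wC_eq c1.
- exact: wC_eq d1.
- move=> e e0; have [d d0 H] := e1 e e0; exists d => // t tT td.
  by rewrite -hu'// -hu ?lexx//; exact: H.
Qed.

End Regular.

(** * Uniqueness on shorter intervals *)

Section Primitives.
Context {R : realType} {E0 E1 : completeNormedModType R} (j : {linear E1 -> E0}) (mu : R).
Hypothesis jc : continuous j.
Hypothesis mu01 : 0 < mu < 1.
Implicit Types (s t h T d e : R) (u du : R -> E0) (w : R -> E1).

(** The Stieltjes primitive, with respect to [t^mu], of [mu^-1 t^(1-mu) w(t)].  This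
    function extends continuously by 0 to [t = 0], while [w] may be singular there. *)
Lemma weighted_primitive T w : 0 < T -> wC mu T w ->
  exists W : R -> E1, [/\ W 0 = 0, rsd [set t | 0 < t <= T] id W w, lcont [set t | 0 <= t <= T] W &
    exists M, forall t, 0 <= t <= T -> `|W t| <= M].
Proof.
move=> T0 [Hw [M HM] Vw]; have /andP[mu0 mu1] := mu01.
pose g t := if t <= 0 then 0 else mu^-1 *: (t `^ (1 - mu) *: w t).
have gE t : 0 < t -> g t = mu^-1 *: (t `^ (1 - mu) *: w t) by rewrite /g ltNge => /negbTE->.
have muV : 0 < mu^-1 by rewrite invr_gt0.
have Hg : lcont [set t | 0 <= t <= T] g.
  move=> t /andP[t0 tT] e e0; have [t0'|t0'] := ltP 0 t.
    have H : lcont [set t | 0 < t <= T] (fun t => mu^-1 *: (t `^ (1 - mu) *: w t)).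
      apply: lcontZ; apply: lcont_scale => //; apply: lcont_mono (powR_is_lcont _) => r /andP[]//.
    have [|d d0 Hd] := H t _ e e0; first by rewrite /= t0'.
    exists (Num.min d t); first by rewrite lt_min d0.
    move=> s /andP[s0 sT]; rewrite lt_min [X in _ && X]ltr_norml => /andP[sd /andP[st _]].
    have s0' : 0 < s by lra.
    by rewrite !gE//; apply: Hd => //=; rewrite s0'.
  have -> : t = 0 by lra.
  have [d d0 Hd] := Vw _ (mulr_gt0 mu0 e0); exists d => // s /andP[s0 sT] sd.
  rewrite {2}/g lexx subr0; have [s0'|s0'] := ltP 0 s; last by rewrite /g s0' normr0 ltW.
  rewrite gE// normrZ gtr0_norm// normrZ ger0_norm ?powR_ge0// ler_pdivrMl//.
  by apply: Hd; [rewrite s0'|move: sd; rewrite subr0 gtr0_norm].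
have mono s t : 0 <= s -> s <= t -> t <= T -> s `^ mu <= t `^ mu.
  by move=> *; rewrite powR_le_base// ltW.
have [W [W0 HW]] := rs_primitive (ltW T0) mono Hg.
have dW : rsd [set t | 0 < t <= T] id W w.
  have H1 : rsd [set t | 0 < t <= T] id (fun t => t `^ mu : R^o) (fun t => mu * t `^ (mu - 1)).
    by apply: rsd_mono (powR_rsd mu) => r /= /andP[].
  have H2 : rsd [set t | 0 < t <= T] (fun t => t `^ mu) W g.
    by apply: rsd_mono HW => r /= /andP[/ltW-> ->].
  apply: rsd_eq (rsd_chain H1 H2) => // t /andP[t0 _].
  rewrite gE// !scalerA; have -> : mu * t `^ (mu - 1) * mu^-1 * t `^ (1 - mu) = t `^ (mu - 1) * t `^ (1 - mu).
    by field; lra.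
  by rewrite (@powR_split _ t _ _ 0)// ?powRr0 ?scale1r//; lra.
have W0c : cont0 T W.
  move=> e e0; have [|d d0 Hd] := HW 0 _ 1 ltr01; first by rewrite /= lexx ltW.
  have [d2 d20 Hd2] := powR_small mu0 e0.
  exists (Num.min d d2); first by rewrite lt_min d0.
  move=> t /andP[t0 tT]; rewrite lt_min => /andP[td td2].
  have := Hd t; rewrite /= (ltW t0) tT subr0 gtr0_norm// => /(_ isT td).
  rewrite /g lexx scaler0 subr0 mul1r powR0 ?gt_eqF// subr0 ger0_norm ?powR_ge0// => /le_trans; apply.
  exact: Hd2.
have M0 : 0 <= M.
  have := HM T; rewrite T0 lexx => /(_ isT); apply: le_trans.
  by rewrite mulr_ge0// powR_ge0.
exists W; split => //.
  move=> t /andP[t0 tT] e e0; have [t0'|t0'] := ltP 0 t.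
    have [|d d0 Hd] := rsd_lcont dW (t := t) _ e0; first by rewrite /= t0'.
    exists (Num.min d t); first by rewrite lt_min d0.
    move=> s /andP[s0 sT]; rewrite lt_min [X in _ && X]ltr_norml => /andP[sd /andP[st _]].
    by apply: Hd => //=; apply/andP; lra.
  have -> : t = 0 by lra.
  have [d d0 Hd] := W0c e e0; exists d => // s /andP[s0 sT] sd.
  have [s0'|s0'] := ltP 0 s; last by have -> : s = 0 by [lra]; rewrite subrr normr0 ltW.
  by apply: Hd; [rewrite s0'|move: sd; rewrite subr0 gtr0_norm].
exists (mu^-1 * (T `^ mu * M)) => t /andP[t0 tT].
have [t0'|t0'] := ltP 0 t; last first.
  have -> : t = 0 by lra.
  by rewrite W0 normr0 !mulr_ge0 ?powR_ge0// ltW.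
have := weighted_mean_value mu0 M0 dW HM W0c (t := t); rewrite t0' tT W0 subr0 => /(_ isT) /le_trans; apply.
by rewrite ler_wpM2l ?(ltW muV)// ler_wpM2r// mono.
Qed.

Lemma reg_bounded T u du w : reg j mu T u du w -> exists M, forall t, 0 <= t <= T -> `|u t| <= M.
Proof.
move=> [_ Hd [_ [M HM] _] _ H0]; have /andP[mu0 mu1] := mu01.
exists (`|u 0| + mu^-1 * (T `^ mu * `|M|)) => t /andP[t0 tT].
have r0 : 0 <= mu^-1 * (T `^ mu * `|M|) by rewrite !mulr_ge0 ?powR_ge0// invr_ge0 ltW.
have [t0'|t0'] := ltP 0 t; last by have -> : t = 0 by [lra]; lra.
have HM' : wbound mu T du `|M| by apply: wbound_le HM; rewrite ?ler_norm.
have := weighted_mean_value mu0 (normr_ge0 M) Hd HM' H0 (t := t); rewrite t0' tT => /(_ isT) H.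
rewrite -[u t](subrK (u 0)) addrC; apply: (le_trans (ler_normD _ _)); rewrite lerD2l.
apply: (le_trans H); rewrite ler_wpM2l ?invr_ge0 ?(ltW mu0)// ler_wpM2r//.
by rewrite powR_le_base// ltW.
Qed.

Lemma reg_lcont T u du w : reg j mu T u du w -> lcont [set t | 0 <= t <= T] u.
Proof.
move=> [_ Hd _ _ H0] t /andP[t0 tT] e e0; have [t0'|t0'] := ltP 0 t.
  have [|d d0 {}Hd] := rsd_lcont Hd (t := t) _ e0; first by rewrite /= t0'.
  exists (Num.min d t); first by rewrite lt_min d0.
  move=> s /andP[s0 sT]; rewrite lt_min [X in _ && X]ltr_norml => /andP[sd /andP[st _]].
  by apply: Hd => //=; apply/andP; lra.
have -> : t = 0 by lra.
have [d d0 {}Hd] := H0 e e0; exists d => // s /andP[s0 sT] sd.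
have [s0'|s0'] := ltP 0 s; last by have -> : s = 0 by [lra]; rewrite subrr normr0 ltW.
by apply: Hd; [rewrite s0'|move: sd; rewrite subr0 gtr0_norm].
Qed.

(** Integrating [u' + B u = 0] gives [u - u(0) = - B W] for the primitive [W] of [w].
    Unlike [w], the function [W] is continuous up to [t = 0] in E_1, and the
    derivative [u] of [j W] is continuous there in E_0. *)
Lemma homogeneous_primitive (B : {linear E1 -> E0}) T u du w : continuous B -> 0 < T ->
  reg j mu T u du w -> (forall t, 0 < t <= T -> du t + B (w t) = 0) ->
  exists W : R -> E1, [/\ W 0 = 0, lcont [set t | 0 <= t <= T] W,
    exists M, forall t, 0 <= t <= T -> `|W t| <= M,
    rsd [set t | 0 <= t <= T] id (fun t => j (W t)) u &
    forall t, 0 <= t <= T -> u t - u 0 = - B (W t)].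
Proof.
move=> Bc T0 Hreg Heq; have [ujw Hd Hdu Hw H0] := Hreg.
have [W [W0 HW Wc Wb]] := weighted_primitive T0 Hw.
have W0c : cont0 T W.
  move=> e e0; have [|d d0 {}Hd] := Wc 0 _ e e0; first by rewrite /= lexx ltW.
  exists d => // t /andP[t0 tT] td; apply: Hd; first by rewrite /= ltW.
  by rewrite subr0 gtr0_norm.
have cont0L (F : completeNormedModType R) (L : {linear E1 -> F}) : continuous L -> cont0 T (fun t => L (W t)).
  move=> /bounded_lin[C C1 HC] e e0; have C0 : 0 < C by lra.
  have [d d0 Hd'] := W0c _ (divr_gt0 e0 C0); exists d => // t tT td.
  by rewrite -linearB (le_trans (HC _))// mulrC -ler_pdivlMr// Hd'.
have HjW : rsd [set t | 0 < t <= T] id (fun t => j (W t)) u.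
  by apply: rsd_eq (rsd_lin jc HW) => // t /ujw.
exists W; split => //.
- move=> t /andP[t0 tT] e e0; have [t0'|t0'] := ltP 0 t.
    have [|d d0 {}Hd] := HjW t _ e e0; first by rewrite /= t0'.
    exists (Num.min d t); first by rewrite lt_min d0.
    move=> s /andP[s0 sT]; rewrite lt_min [X in _ && X]ltr_norml => /andP[sd /andP[st _]].
    by apply: Hd => //=; apply/andP; lra.
  have -> : t = 0 by lra.
  have [d d0 {}Hd] := H0 e e0; exists d => // s /andP[s0 sT]; rewrite subr0 ger0_norm// => sd.
  have := @mean_value0 R E0 s (fun r => j (W r) - r *: u 0) (fun r => u r - u 0)
    (fun r => e *: r : R^o) (fun r => e *: 1 : R^o) _ _ _ _ _ 0 s (lexx 0) s0 (lexx s).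
  rewrite /= W0 linear0 scale0r !subr0 scaler0 subr0 => H; apply: H.
  + by move=> q r q0 qr rs; rewrite /GRing.scale /= ler_wpM2l// ltW.
  + apply: rsdB; first by apply: rsd_mono HjW => r /= /andP[-> rs]; exact: le_trans sT.
    move=> r _ e' e'0; exists 1 => // q _ _.
    by rewrite -scalerBl subrr normr0 mulr_ge0// ltW.
  + apply: rsdZ => r _ e' e'0; exists 1 => // q _ _.
    by rewrite /GRing.scale /= mulr1 subrr normr0 mulr_ge0// ltW.
  + move=> r /andP[r0 rs]; rewrite /GRing.scale /= mulr1; apply: Hd; last by lra.
    by rewrite r0 (le_trans rs).
  + have c1 : cont0 T (fun r => j (W r) - r *: u 0).
      move=> e' e'0; have e2 : 0 < e' / 2 by lra.
      have [d1 d10 H1] := cont0L _ j jc _ e2.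
      have k1 : 0 < `|u 0| + 1 by rewrite ltr_pwDr.
      exists (Num.min d1 (e' / 2 / (`|u 0| + 1))); first by rewrite lt_min d10 divr_gt0.
      move=> r /andP[r0 rT]; rewrite lt_min => /andP[rd1 rd2].
      have -> : j (W r) - r *: u 0 - (j (W 0) - 0 *: u 0) = (j (W r) - j (W 0)) - r *: u 0 by lmod_eq R.
      apply: (le_trans (ler_normB _ _)); rewrite normrZ gtr0_norm//.
      have rT' : 0 < r <= T by rewrite r0.
      have := H1 r rT' rd1; move: rd2; rewrite ltr_pdivlMr//; lra.
    move=> e' e'0; have [d' d'0 H'] := c1 e' e'0; exists d' => // r /andP[r0 rs].
    by apply: H'; rewrite r0 (le_trans rs).
- move=> t /andP[t0 tT].
  have := @mean_value0 R E0 T (fun r => u r + B (W r)) (fun r => du r + B (w r))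
    (fun r => 0 : R^o) (fun r => 0 : R^o) _ _ _ _ _ 0 t (lexx 0) t0 tT.
  rewrite /= W0 linear0 addr0 subrr => H.
  have /eqP : `|u t + B (W t) - u 0| = 0.
    apply/eqP; rewrite -normr_le0 normr_id; apply: H => //.
    + by apply: rsdD => //; exact: rsd_lin.
    + exact: rsd_cst.
    + by move=> r rT; rewrite Heq// normr0.
    + by apply: cont0D => //; exact: cont0L.
  rewrite normr_eq0 addrAC addr_eq0 => /eqP ->//.
Qed.

End Primitives.

Section Uniqueness.
Context {R : realType} {E0 E1 : completeNormedModType R} (j : {linear E1 -> E0}) (mu : R).
Hypothesis jc : continuous j.
Hypothesis ji : injective j.
Hypothesis mu01 : 0 < mu < 1.
Variable B : {linear E1 -> E0}.
Hypothesis Bc : continuous B.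
Implicit Types (s t h T d e : R) (u du : R -> E0) (w : R -> E1).
Variable T0 : R.
Hypothesis T00 : 0 < T0.
Hypothesis existence : forall x, cont_interp j mu x -> exists u du w,
  [/\ reg j mu T0 u du w, forall t, 0 < t <= T0 -> du t + B (w t) = 0 & u 0 = x].
Hypothesis uniqueness : forall u du w, reg j mu T0 u du w ->
  (forall t, 0 < t <= T0 -> du t + B (w t) = 0) -> u 0 = 0 ->
  forall t, 0 < t <= T0 -> w t = 0.

(** A homogeneous solution [u] on [[0, T]] with [u(0) = 0] cannot be continued
    directly: the solution [z] starting at [u(T)] may have a singular derivative at
    its initial time.  Primitives behave better: the primitive of [u] followed by
    that of [z] is a regular homogeneous solution on the full interval that vanishes
    at 0, hence it vanishes, and so does [u]. *)
Lemma uniqueness_restrict T u du w : 0 < T -> T <= T0 -> reg j mu T u du w ->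
  (forall t, 0 < t <= T -> du t + B (w t) = 0) -> u 0 = 0 ->
  forall t, 0 < t <= T -> w t = 0.
Proof.
have /andP[mu0 mu1] := mu01.
move=> T0' TT Hu Heq u0.
have mu01' : 0 <= mu <= 1 by rewrite !ltW.
have [z [dz [wz [Hz Hzeq z0]]]] := existence (ci_j jc mu01' (w T)).
have [W1 [W10 W1c [M1 HM1] W1d W1e]] := homogeneous_primitive jc mu01 Bc T0' Hu Heq.
have [W2 [W20 W2c [M2 HM2] W2d W2e]] := homogeneous_primitive jc mu01 Bc T00 Hz Hzeq.
have uT : u T = j (w T) by case: Hu => H _ _ _ _; apply: H; rewrite T0' lexx.
pose V2 t := W1 T + W2 (t - T).
pose W := paste T W1 V2; pose U t := j (W t); pose dU := paste T u (fun t => z (t - T)).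
have WT : W1 T = V2 T by rewrite /V2 subrr W20 addr0.
have dUT : u T = z (T - T) by rewrite subrr z0.
have [Mu Hmu] := reg_bounded mu01 Hu; have [Mz Hmz] := reg_bounded mu01 Hz.
have Wc : lcont [set t | 0 < t <= T0] W.
  apply: lcont_paste => //.
    by apply: lcont_mono W1c => t [/= /andP[t0 _] tT]; rewrite /= ltW.
  apply: lcontD; first exact: lcont_cst.
  apply: lcont_mono (lcont_shift (h := - T) W2c) => t [/= /andP[t0 tT0] Tt]; apply/andP; lra.
have dUc : lcont [set t | 0 < t <= T0] dU.
  apply: lcont_paste => //.
    by apply: lcont_mono (reg_lcont Hu) => t [/= /andP[t0 _] tT]; rewrite /= ltW.
  apply: lcont_mono (lcont_shift (h := - T) (reg_lcont Hz)) => t [/= /andP[t0 tT0] Tt]; apply/andP; lra.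
have Ud : rsd [set t | 0 < t <= T0] id U dU.
  have H : rsd [set t | 0 < t <= T0] id (paste T (fun t => j (W1 t)) (fun t => j (V2 t))) dU.
    apply: rsd_paste => //; last by rewrite WT.
      by apply: rsd_mono W1d => t [/= /andP[t0 _] tT]; rewrite /= ltW.
    have H2 := rsdD (@rsd_cst R E0 [set t | 0 <= t + - T <= T0] id (j (W1 T))) (rsd_shift (h := - T) W2d).
    apply: rsd_mono (rsd_eq _ _ H2) => t.
    - by move=> [/= /andP[t0 tT0] Tt]; apply/andP; lra.
    - by move=> _; rewrite /V2 linearD.
    - by move=> _; rewrite add0r.
  by apply: rsd_eq H => // t _; rewrite /U /W /paste; case: ifP.
have Wreg : reg j mu T0 U dU W.
  split=> //.
  - apply: (@lcont_bounded_wC _ _ _ _ _ (`|Mu| + `|Mz|)) => // t /andP[t0 tT0].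
    rewrite /dU /paste; case: (leP t T) => tT.
      by apply: (@le_trans _ _ Mu); [apply: Hmu; rewrite ltW|have := ler_norm Mu; have := normr_ge0 Mz; lra].
    apply: (@le_trans _ _ Mz); first by apply: Hmz; apply/andP; lra.
    by have := ler_norm Mz; have := normr_ge0 Mu; lra.
  - apply: (@lcont_bounded_wC _ _ _ _ _ (`|W1 T| + `|M1| + `|M2|)) => // t /andP[t0 tT0].
    rewrite /W /paste; case: (leP t T) => tT.
      apply: (@le_trans _ _ M1); first by apply: HM1; rewrite ltW.
      by have := ler_norm M1; have := normr_ge0 M2; have := normr_ge0 (W1 T); lra.
    apply: (le_trans (ler_normD _ _)); rewrite -addrA lerD2l.
    apply: (@le_trans _ _ M2); first by apply: HM2; apply/andP; lra.
    by have := ler_norm M2; have := normr_ge0 M1; lra.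
  - move=> e e0; have [|d d0 Hd] := W1d 0 _ 1 ltr01; first by rewrite /= lexx ltW.
    have k1 : 0 < 1 + `|u 0| by have := normr_ge0 (u 0); lra.
    exists (Num.min T (Num.min d (e / (1 + `|u 0|)))).
      by rewrite !lt_min T0' d0 divr_gt0.
    move=> t /andP[t0 tT0]; rewrite !lt_min => /and3P[tT td te].
    rewrite /U /W !paste_l ?(ltW T0') ?(ltW tT)//.
    have := Hd t; rewrite /= (ltW t0) (ltW tT) subr0 gtr0_norm// => /(_ isT td).
    by rewrite u0 scaler0 subr0; move: te; rewrite ltr_pdivlMr// u0 normr0; lra.
have Weq t : 0 < t <= T0 -> dU t + B (W t) = 0.
  move=> /andP[t0 tT0]; rewrite /dU /W /paste; case: (leP t T) => tT.
    have := W1e t; rewrite u0 subr0 (ltW t0) tT => /(_ isT) ->; exact: addNr.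
  have h : 0 <= t - T <= T0 by apply/andP; lra.
  have uT' : u T = - B (W1 T) by rewrite -W1e ?u0 ?subr0// lexx ltW.
  rewrite -[z _](subrK (z 0)) W2e// z0 -uT uT' /V2 linearD.
  by lmod_eq R.
have U0 : U 0 = 0 by rewrite /U /W paste_l ?(ltW T0')// W10 linear0.
move=> t /andP[t0 tT]; apply: ji; rewrite linear0.
have -> : j (w t) = u t by case: Hu => H _ _ _ _; rewrite H// t0.
have := W1e t; rewrite u0 subr0 (ltW t0) tT => /(_ isT) ->.
have tT0 : 0 < t <= T0 by rewrite t0 (le_trans tT).
have := uniqueness Wreg Weq U0 tT0; rewrite /W paste_l// => ->.
by rewrite linear0 oppr0.
Qed.

End Uniqueness.

(** * A closed graph principle *)

Section Geometric.
Context {R : realType}.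

Definition hpow n : R := 2^-1 ^+ n.

Lemma hpow_gt0 n : 0 < hpow n.
Proof. by rewrite exprn_gt0. Qed.

Lemma hpowS n : hpow n.+1 = hpow n / 2.
Proof. by rewrite /hpow exprS mulrC. Qed.

Lemma hpow0 : hpow 0 = 1. Proof. by rewrite /hpow expr0. Qed.

Lemma hpowD n k : hpow (n + k) = hpow n * hpow k.
Proof. by rewrite /hpow exprD. Qed.

Lemma hpow_le1 n : hpow n <= 1.
Proof. by elim: n => [|n IHn]; rewrite ?hpow0// hpowS; have := hpow_gt0 n; lra. Qed.

Lemma hpow_small (c e : R) : 0 < e -> exists n, c * hpow n <= e.
Proof.
move=> e0; have [n Hn] : exists n : nat, `|c| / e <= n%:R.
  by exists (Num.truncn (`|c| / e)).+1; apply: ltW; rewrite truncnS_gt.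
exists n; have H : n%:R * hpow n <= 1.
  elim: n {Hn} => [|n IHn]; first by rewrite mul0r.
  by rewrite hpowS -natr1; have := hpow_le1 n; have := hpow_gt0 n; lra.
apply: (@le_trans _ _ (`|c| * hpow n)); first by rewrite ler_wpM2r ?ler_norm// ltW// hpow_gt0.
move: Hn; rewrite ler_pdivrMr// => Hn; apply: (@le_trans _ _ ((n%:R * e) * hpow n)).
  by rewrite ler_wpM2r// ltW// hpow_gt0.
by rewrite mulrAC -[leRHS]mul1r ler_wpM2r// ltW.
Qed.

(** [Nle x r] is to be read as a bound [|x| <= r] for a seminorm on [X]. *)
Lemma geometric_steps (X : zmodType) (Nle : X -> R -> Prop) (x : nat -> X) c :
  Nle 0 0 -> (forall y z r s, Nle y r -> Nle z s -> Nle (y + z) (r + s)) ->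
  (forall n, Nle (x n.+1 - x n) (c * hpow n)) ->
  forall n k, Nle (x (n + k)%N - x n) (2 * c * hpow n * (1 - hpow k)).
Proof.
move=> N0 ND H n; elim=> [|k IHk]; first by rewrite addn0 subrr hpow0 subrr mulr0.
have -> : x (n + k.+1)%N - x n = (x (n + k).+1 - x (n + k)%N) + (x (n + k)%N - x n).
  by rewrite addnS addrA subrK.
have -> : 2 * c * hpow n * (1 - hpow k.+1) = c * hpow (n + k) + 2 * c * hpow n * (1 - hpow k).
  by rewrite hpowD hpowS; field.
exact: ND.
Qed.

Lemma geometric_limit (E : completeNormedModType R) (x : nat -> E) c : 0 <= c ->
  (forall n, `|x n.+1 - x n| <= c * hpow n) ->
  exists l, forall n, `|l - x n| <= 2 * c * hpow n.
Proof.
move=> c0 H; pose Nle (y : E) r := `|y| <= r.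
have tel n k : `|x (n + k)%N - x n| <= 2 * c * hpow n.
  have := @geometric_steps E Nle x c _ _ H n k; rewrite /Nle normr0 => /(_ (lexx 0)) tel.
  apply: (le_trans (tel _)).
    by move=> y z r s hy hz; apply: (le_trans (ler_normD _ _)); exact: lerD.
  rewrite -[leRHS]mulr1 ler_wpM2l//; first by rewrite !mulr_ge0// ltW// hpow_gt0.
  by have := hpow_gt0 k; lra.
have [l Hl] : exists l, forall e : R, 0 < e -> exists n, forall k, (n <= k)%N -> `|x k - l| <= e.
  apply: cauchy_limit => e e0; have [n Hn] := hpow_small (2 * c) e0.
  by exists n => k nk; rewrite -(subnKC nk); apply: le_trans Hn.
exists l => n; apply/ler_addgt0Pr => e e0; have [m Hm] := Hl e e0.
have -> : l - x n = (x (n + m)%N - x n) - (x (n + m)%N - l) by lmod_eq R.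
by apply: (le_trans (ler_normB _ _)); apply: lerD => //; apply: Hm; rewrite leq_addl.
Qed.

End Geometric.

Section Zabreiko.
(* Here [Nle x r] reads as [|x| <= r] for a norm on the subspace [D], and [P c x] as
   [p(x) <= c] for a functional [p]; only these relations are given, so that
   neither a norm nor [p] has to be constructed. *)
Context {R : realType} (X : lmodType R) (D : X -> Prop) (Nle : X -> R -> Prop) (P : R -> X -> Prop).
Implicit Types (x y a : X) (r s e c d : R).

Hypothesis D0 : D 0.
Hypothesis DD : forall x y, D x -> D y -> D (x + y).
Hypothesis DZ : forall k x, D x -> D (k *: x).
Hypothesis N0 : Nle 0 0.
Hypothesis ND : forall x y r s, Nle x r -> Nle y s -> Nle (x + y) (r + s).
Hypothesis NZ : forall k x r, Nle x r -> Nle (k *: x) (`|k| * r).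
Hypothesis N_le : forall x r s, Nle x r -> r <= s -> Nle x s.
Hypothesis PD : forall c d x y, P c x -> P d y -> P (c + d) (x + y).
Hypothesis PZ : forall k c x, P c x -> P (`|k| * c) (k *: x).
Hypothesis P_le : forall c d x, P c x -> c <= d -> P d x.
Hypothesis P_ex : forall x, D x -> exists c, P c x.
Hypothesis complete : forall (x : nat -> X) c, (forall n, D (x n)) ->
  (forall n, Nle (x n.+1 - x n) (c * hpow n)) ->
  exists2 y, D y & forall n, Nle (y - x n) (2 * c * hpow n).
Hypothesis P_series : forall (a S : nat -> X) x c r, D x ->
  S 0%N = 0 -> (forall n, S n.+1 = S n + a n) ->
  (forall n, P (c * hpow n) (a n)) -> (forall n, Nle (x - S n) (r * hpow n)) -> P (2 * c) x.

Let DB x y : D x -> D y -> D (x - y).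
Proof. by move=> Dx Dy; rewrite -scaleN1r; apply: DD => //; exact: DZ. Qed.

Let NB x y r s : Nle x r -> Nle y s -> Nle (x - y) (r + s).
Proof. by move=> Nx Ny; rewrite -scaleN1r; apply: ND => //; have := NZ (-1) Ny; rewrite normrN1 mul1r. Qed.

(* Otherwise nested balls, each avoiding all points approximable by [p <= n], shrink
   to a point at which [p] takes no finite value. *)
Let baire : exists n : nat, exists x0 r, [/\ D x0, 0 < r &
  forall y, D y -> Nle (y - x0) r -> forall e, 0 < e -> exists a, [/\ D a, P n%:R a & Nle (y - a) e]].
Proof.
apply: contrapT => H.
have step (q : nat * (X * R)) : exists p : X * R, D q.2.1 -> 0 < q.2.2 ->
    [/\ D p.1, 0 < p.2, Nle (p.1 - q.2.1) q.2.2 &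
       forall a, D a -> P q.1%:R a -> ~ Nle (p.1 - a) p.2].
  case: q => n [x r] /=; have [[Dx r0]|nDx] := pselect (D x /\ 0 < r); last first.
    by exists (0, 0) => Dx r0; case: nDx.
  apply: contrapT => H2; apply: H; exists n, x, r; split=> // y Dy Hy e e0.
  apply: contrapT => H3; apply: H2; exists (y, e) => _ _; split=> // a Da Pa Na.
  by apply: H3; exists a.
have /choice[F HF] := step.
pose st := fix st n : X * R := if n is n'.+1
  then let p := F (n', ((st n').1, (st n').2 / 4)) in (p.1, Num.min p.2 ((st n').2 / 2)) else (0, 1).
have stD n : D (st n).1 /\ 0 < (st n).2.
  elim: n => [|n [Dn rn]] /=; first by split.
  have [] := HF (n, ((st n).1, (st n).2 / 4)) Dn; first by rewrite divr_gt0.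
  by move=> h1 h2 _ _; split => //; rewrite lt_min h2 divr_gt0.
have stS n : [/\ Nle ((st n.+1).1 - (st n).1) ((st n).2 / 4), (st n.+1).2 <= (st n).2 / 2 &
    forall a, D a -> P n%:R a -> ~ Nle ((st n.+1).1 - a) (st n.+1).2].
  have [Dn rn] := stD n.
  have [] := HF (n, ((st n).1, (st n).2 / 4)) Dn; first by rewrite divr_gt0.
  move=> _ _ h1 h2; split => //=; first by rewrite ge_min lexx orbT.
  by move=> a Da Pa Na; apply: (h2 a Da Pa); apply: N_le Na _; rewrite ge_min lexx.
have rad n k : (st (n + k)%N).2 <= (st n).2 * hpow k.
  elim: k => [|k IHk]; first by rewrite addn0 hpow0 mulr1.
  by rewrite addnS; have [_ h _] := stS (n + k)%N; rewrite hpowS; lra.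
have radN n k : Nle ((st (n + k)%N).1 - (st n).1) ((st n).2 / 2).
  have Hn m : Nle ((st (n + m.+1)%N).1 - (st (n + m)%N).1) ((st n).2 / 4 * hpow m).
    rewrite addnS; have [h _ _] := stS (n + m)%N; apply: N_le h _.
    by have := rad n m; lra.
  have := @geometric_steps R X Nle (fun m => (st (n + m)%N).1) ((st n).2 / 4) N0 ND Hn 0%N k.
  rewrite add0n addn0 hpow0 => h; apply: N_le h _.
  have := hpow_gt0 (R := R) k; have := (stD n).2; move=> a b.
  have := mulr_gt0 a b; lra.
have [y Dy Hy] : exists2 y, D y & forall n, Nle (y - (st n).1) (2 * (1/4) * hpow n).
  apply: complete => n; first by have [] := stD n.
  have [h _ _] := stS n; apply: N_le h _.
  by have := rad 0%N n; rewrite add0n /= mul1r; lra.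
have [c Pc] := P_ex Dy.
pose n := (Num.truncn c).+1; have [_ _ Hn] := stS n.
apply: (Hn y Dy).
  by apply: P_le Pc _; apply: ltW; rewrite truncnS_gt.
have [D1 r1] := stD n.+1.
have [k Hk] : exists k, (2 * (1/4) : R) * hpow k <= (st n.+1).2 / 2 by apply: hpow_small; rewrite divr_gt0.
have -> : (st n.+1).1 - y = - ((y - (st (n.+1 + k)%N).1) + ((st (n.+1 + k)%N).1 - (st n.+1).1)).
  by lmod_eq R.
rewrite -scaleN1r; have := NZ (-1) (ND (Hy (n.+1 + k)%N) (radN n.+1 k)); rewrite normrN1 mul1r => h.
apply: N_le h _; rewrite hpowD.
have : hpow n.+1 * hpow k <= hpow k :> R by rewrite ler_piMl ?hpow_le1// ltW// hpow_gt0.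
lra.
Qed.

(** Zabreiko's lemma: a functional that is finite and countably subadditive on a
    normed space in which geometric series converge is bounded by a multiple of the
    norm.  Some sublevel set of [p] is dense in a ball; after recentring and scaling,
    every element is approximated arbitrarily well with control of [p], and iterating
    the approximation on the remainders writes it as a geometric series. *)
Lemma zabreiko : exists2 C : R, 0 < C & forall x r, D x -> Nle x r -> 0 < r -> P (C * r) x.
Proof.
have [n [x0 [r [Dx0 r0 H]]]] := baire.
pose K : R := n%:R + n%:R + 1.
have K0 : 0 < K by rewrite ltr_wpDl// addr_ge0.
have step2 y s e : D y -> 0 < s -> Nle y (r * s) -> 0 < e ->
    exists a, [/\ D a, P (K * s) a & Nle (y - a) e].
  move=> Dy s0 Ny e0; have es : 0 < e / s / 2 by rewrite !divr_gt0.
  have sN : `|s^-1| * s = 1 by rewrite ger0_norm ?invr_ge0 ?(ltW s0)// mulVf// gt_eqF.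
  have [|a1 [Da1 Pa1 Na1]] := H (s^-1 *: y + x0) (DD (DZ _ Dy) Dx0) _ _ es.
    rewrite addrK; apply: N_le (NZ s^-1 Ny) _.
    by rewrite mulrCA sN mulr1.
  have [|a2 [Da2 Pa2 Na2]] := H x0 Dx0 _ _ es.
    by rewrite subrr; apply: N_le N0 _; exact: ltW.
  exists (s *: (a1 - a2)); split; first by apply: DZ; exact: DB.
    have h : P (n%:R + n%:R) (a1 - a2).
      rewrite -scaleN1r; apply: PD => //; have := PZ (-1) Pa2; by rewrite normrN1 mul1r.
    apply: P_le (PZ s h) _; rewrite (gtr0_norm s0) mulrC ler_wpM2r ?(ltW s0)//.
    by rewrite /K; lra.
  have -> : y - s *: (a1 - a2) = s *: ((s^-1 *: y + x0 - a1) - (x0 - a2)).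
    rewrite !(scalerBr, scalerDr) scalerA divff ?scale1r ?gt_eqF//.
    by lmod_eq R.
  apply: N_le (NZ s (NB Na1 Na2)) _.
  by rewrite gtr0_norm// le_eqVlt; apply/orP; left; apply/eqP; field; lra.
have step3 y : D y -> Nle y r -> P (2 * K) y.
  move=> Dy Ny.
  have stepF (q : nat * X) : exists a, D q.2 -> Nle q.2 (r * hpow q.1) ->
     [/\ D a, P (K * hpow q.1) a & Nle (q.2 - a) (r * hpow q.1.+1)].
    case: q => k z /=; have [[Dz Nz]|nz] := pselect (D z /\ Nle z (r * hpow k)); last first.
      by exists 0 => Dz Nz; case: nz.
    have hk : 0 < r * hpow k.+1 :> R by rewrite mulr_gt0// hpow_gt0.
    by have [a Ha] := step2 z (hpow k) _ Dz (hpow_gt0 k) Nz hk; exists a.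
  have /choice[F HF] := stepF.
  pose z := fix z k : X := if k is k'.+1 then z k' - F (k', z k') else y.
  have Hz k : D (z k) /\ Nle (z k) (r * hpow k).
    elim: k => [|k [Dk Nk]] /=; first by rewrite hpow0 mulr1.
    by have [Da _ Na] := HF (k, z k) Dk Nk; split => //; exact: DB.
  apply: (@P_series (fun k => F (k, z k)) (fun k => y - z k) y K r) => //.
  - by rewrite /= subrr.
  - by move=> k /=; lmod_eq R.
  - by move=> k; have [Dk Nk] := Hz k; have [] := HF (k, z k) Dk Nk.
  - by move=> k; rewrite opprB addrC subrK; have [] := Hz k.
exists (2 * K / r); first by rewrite divr_gt0// mulr_gt0.
move=> x s Dx Nx s0; have rs : 0 < r / s by rewrite divr_gt0.
have h : Nle ((r / s) *: x) r.
  apply: N_le (NZ (r / s) Nx) _.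
  by rewrite gtr0_norm// divfK// gt_eqF.
have := PZ (s / r) (step3 _ (DZ _ Dx) h).
rewrite scalerA; have -> : s / r * (r / s) = 1 by field; lra.
rewrite scale1r => {}h; apply: P_le h _.
rewrite gtr0_norm ?divr_gt0// le_eqVlt; apply/orP; left; apply/eqP; field; lra.
Qed.

End Zabreiko.

Lemma rsd_linear (R : realType) (A : set R) (k : R) : rsd A id (fun r => k * r : R^o) (fun=> k).
Proof.
move=> r _ e e0; exists 1 => // s _ _.
by rewrite -mulrBr /GRing.scale /= mulrC subrr normr0 mulr_ge0// ltW.
Qed.

(** * Bounds in maximal regularity, uniform in the length of the interval *)

Section RegularLimits.
Context {R : realType} {E0 E1 : completeNormedModType R} (j : {linear E1 -> E0}) (mu : R).
Hypothesis jc : continuous j.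
Hypothesis mu01 : 0 < mu < 1.
Implicit Types (s t h T d e : R) (u du : R -> E0) (w : R -> E1).

Lemma wbound_norm (E : normedModType R) T (v : R -> E) M t : wbound mu T v M -> 0 < t <= T ->
  `|v t| <= t `^ (mu - 1) * M.
Proof.
move=> H /andP[t0 tT]; rewrite -[mu - 1]opprB powRN mulrC ler_pdivlMr ?powR_gt0// mulrC.
by apply: H; rewrite t0.
Qed.

Lemma norm_wbound (E : normedModType R) T (v : R -> E) M :
  (forall t, 0 < t <= T -> `|v t| <= t `^ (mu - 1) * M) -> wbound mu T v M.
Proof.
move=> H t tT; have /andP[t0 _] := tT; rewrite mulrC -ler_pdivlMr ?powR_gt0//.
by rewrite mulrC -powRN opprB; exact: H.
Qed.

(** The mean value inequality between two approximants bounds the increments of their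
    difference; passing to the limit in one of them bounds those of [u] minus the
    other, and the limit of the derivatives is the derivative of the limit. *)
Lemma reg_lim T u du w : 0 < T ->
  (forall t, 0 < t <= T -> u t = j (w t)) ->
  (forall e, 0 < e -> exists u' du' w', [/\ reg j mu T u' du' w',
     wbound mu T (fun t => du t - du' t) e, wbound mu T (fun t => w t - w' t) e &
     `|u 0 - u' 0| <= e]) ->
  reg j mu T u du w.
Proof.
move=> T0 ujw H; have /andP[mu0 mu1] := mu01; have [C C1 HC] := bounded_lin jc.
have C0 : 0 < C by lra.
have close u' du' w' e t : reg j mu T u' du' w' -> wbound mu T (fun t => w t - w' t) e ->
   0 < t <= T -> `|u t - u' t| <= C * (t `^ (mu - 1) * e).
  move=> [ujw' _ _ _ _] Hw tT; rewrite ujw// ujw'// -linearB; apply: (le_trans (HC _)).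
  by rewrite ler_wpM2l ?(ltW C0)//; exact: wbound_norm Hw tT.
have dist_du du1 du2 e1 e2 : wbound mu T (fun t => du t - du1 t) e1 -> wbound mu T (fun t => du t - du2 t) e2 ->
    wbound mu T (fun t => du2 t - du1 t) (e1 + e2).
  move=> h1 h2; have := wboundD h1 (wboundZ (-1) h2); rewrite normrN1 mul1r.
  by apply: wbound_eq => t _; lmod_eq R.
have incr u' du' w' e s t : 0 < e -> reg j mu T u' du' w' -> wbound mu T (fun t => du t - du' t) e ->
   0 < s -> s <= t -> t <= T ->
   `|(u t - u' t) - (u s - u' s)| <= e * s `^ (mu - 1) * (t - s).
  move=> e0 Hreg Hdu s0 st tT; have t0 := lt_le_trans s0 st; apply/ler_addgt0Pr => e1 e10.
  have smu : 0 < s `^ (mu - 1) by exact: powR_gt0.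
  have K0 : 0 < s `^ (mu - 1) * (t - s) + 2 * C * s `^ (mu - 1).
    by rewrite ltr_wpDl ?mulr_gt0// mulr_ge0 ?(ltW smu)//; lra.
  pose e' := e1 / (s `^ (mu - 1) * (t - s) + 2 * C * s `^ (mu - 1)).
  have e'0 : 0 < e' by rewrite divr_gt0.
  have [u2 [du2 [w2 [Hreg2 Hdu2 Hw2 _]]]] := H e' e'0.
  have tT' : 0 < t <= T by rewrite t0.
  have sT' : 0 < s <= T by rewrite s0 (le_trans st).
  have c1 := close _ _ _ _ _ Hreg2 Hw2 tT'; have c2 := close _ _ _ _ _ Hreg2 Hw2 sT'.
  have {}c1 : `|u t - u2 t| <= C * (s `^ (mu - 1) * e').
    apply: (le_trans c1); rewrite ler_wpM2l ?(ltW C0)// ler_wpM2r ?(ltW e'0)//.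
    by rewrite powR_le_basen//; lra.
  have [_ d1 _ _ _] := Hreg; have [_ d2 _ _ _] := Hreg2.
  have mv : `|(u2 t - u' t) - (u2 s - u' s)| <= (e + e') * s `^ (mu - 1) * (t - s).
    have := @mean_value R E0 (fun r => u2 r - u' r) (fun r => du2 r - du' r)
      (fun r => (e + e') * s `^ (mu - 1) * r : R^o) (fun=> (e + e') * s `^ (mu - 1) : R^o) s t st.
    rewrite -mulrBr; apply.
    - by move=> q r sq qr rt; rewrite ler_wpM2l// mulr_ge0 ?powR_ge0//; lra.
    - by apply: rsdB; [apply: rsd_mono d2|apply: rsd_mono d1] => r /= /andP[? ?]; apply/andP; lra.
    - exact: rsd_linear.
    - move=> r /andP[sr rt]; have rT : 0 < r <= T by apply/andP; lra.
      apply: (le_trans (wbound_norm (dist_du _ _ _ _ Hdu Hdu2) rT)).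
      by rewrite mulrC ler_wpM2l ?powR_le_basen//; move: mu1 e0 e'0; forget; lra.
  have -> : (u t - u' t) - (u s - u' s) = ((u2 t - u' t) - (u2 s - u' s)) + ((u t - u2 t) - (u s - u2 s)) by lmod_eq R.
  apply: (le_trans (ler_normD _ _)); apply: (le_trans (lerD mv (ler_normB _ _))).
  have e'E : e' * (s `^ (mu - 1) * (t - s) + 2 * C * s `^ (mu - 1)) = e1 by rewrite /e' divfK// gt_eqF.
  lra.
have incr0 u' du' w' e t : 0 < e -> reg j mu T u' du' w' -> wbound mu T (fun t => du t - du' t) e ->
   0 < t <= T -> `|(u t - u' t) - (u 0 - u' 0)| <= mu^-1 * (t `^ mu * e).
  move=> e0 Hreg Hdu tT; have /andP[t0 _] := tT; apply/ler_addgt0Pr => e1 e10.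
  pose K := mu^-1 * t `^ mu + C * t `^ (mu - 1) + 1.
  have h1 : 0 < mu^-1 * t `^ mu by rewrite mulr_gt0 ?powR_gt0 ?invr_gt0.
  have h2 : 0 < C * t `^ (mu - 1) by rewrite mulr_gt0 ?powR_gt0.
  have K0 : 0 < K by rewrite /K; lra.
  have e'0 : 0 < e1 / K by rewrite divr_gt0.
  have [u2 [du2 [w2 [Hreg2 Hdu2 Hw2 H0]]]] := H _ e'0.
  have c1 := close _ _ _ _ _ Hreg2 Hw2 tT.
  have [_ d1 _ _ o1] := Hreg; have [_ d2 _ _ o2] := Hreg2.
  have ee : 0 <= e + e1 / K by lra.
  have o3 : cont0 T (fun r => u2 r - u' r).
    have := cont0D o2 (cont0Z (-1) o1).
    by rewrite (_ : (fun t => u2 t + -1 *: u' t) = (fun t => u2 t - u' t))//; apply/funext => r; rewrite scaleN1r.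
  have := weighted_mean_value mu0 ee (rsdB d2 d1) (dist_du _ _ _ _ Hdu Hdu2) o3 tT => mv.
  have -> : (u t - u' t) - (u 0 - u' 0) = ((u2 t - u' t) - (u2 0 - u' 0)) + ((u t - u2 t) - (u 0 - u2 0)) by lmod_eq R.
  apply: (le_trans (ler_normD _ _)); apply: (le_trans (lerD mv (ler_normB _ _))).
  have KE : e1 / K * K = e1 by rewrite divfK// gt_eqF.
  move: KE; rewrite {2}/K; lra.
split => //.
- move=> t tT e e0; have /andP[t0 tT'] := tT.
  have t20 : 0 < t / 2 by lra.
  have k0 : 0 < (t / 2) `^ (mu - 1) by exact: powR_gt0.
  pose e' := e / 3 / (t / 2) `^ (mu - 1).
  have e'0 : 0 < e' by rewrite !divr_gt0.
  have e'E : e' * (t / 2) `^ (mu - 1) = e / 3 by rewrite divfK// gt_eqF.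
  have [u' [du' [w' [Hreg Hdu Hw _]]]] := H e' e'0.
  have [_ d1 _ _ _] := Hreg; have e3 : 0 < e / 3 by lra.
  have [d d0 Hd] := d1 t tT _ e3.
  exists (Num.min d (t / 2)); first by rewrite lt_min d0.
  move=> s /andP[s0 sT]; rewrite lt_min [X in _ && X]ltr_norml => /andP[sd /andP[s1 s2]].
  have {}Hd := Hd s (introT andP (conj s0 sT)) sd.
  have loc q r : t / 2 <= q -> q <= r -> r <= T -> `|(u r - u' r) - (u q - u' q)| <= e / 3 * (r - q).
    move=> tq qr rT; apply: le_trans (incr _ _ _ _ _ _ e'0 Hreg Hdu _ qr rT) _; first by lra.
    by rewrite -e'E ler_wpM2r ?subr_ge0// ler_wpM2l ?(ltW e'0)// powR_le_basen//; move: mu1; forget; lra.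
  have I : `|(u s - u' s) - (u t - u' t)| <= e / 3 * `|s - t|.
    have [st|/ltW ts] := leP s t.
      by rewrite distrC [X in _ * X]distrC [X in _ * X]ger0_norm ?subr_ge0//; apply: loc => //; move: s1 s2 t0 tT' sT; forget; lra.
    by rewrite [X in _ * X]ger0_norm ?subr_ge0//; apply: loc => //; move: s1 s2 t0 tT' sT; forget; lra.
  have dd : `|du t - du' t| <= e / 3.
    apply: (le_trans (wbound_norm Hdu tT)); rewrite -e'E mulrC ler_wpM2l ?(ltW e'0)// powR_le_basen//; move: mu1 t0; forget; lra.
  have -> : u s - u t - (id s - id t) *: du t = (u' s - u' t - (id s - id t) *: du' t) +
     (((u s - u' s) - (u t - u' t)) - (s - t) *: (du t - du' t)) by rewrite /=; lmod_eq R.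
  apply: (le_trans (ler_normD _ _)); apply: (le_trans (lerD Hd (ler_normB _ _))).
  by rewrite normrZ; move: (ler_wpM2l (normr_ge0 (s - t)) dd) I; rewrite /=; forget; lra.
- apply: wC_lim => // e e0; have [u' [du' [w' [[_ _ h _ _] Hdu _ _]]]] := H e e0.
  by exists du'.
- apply: wC_lim => // e e0; have [u' [du' [w' [[_ _ _ h _] _ Hw _]]]] := H e e0.
  by exists w'.
- move=> e e0; have Tmu : 0 < mu^-1 * T `^ mu by rewrite mulr_gt0 ?powR_gt0 ?invr_gt0.
  have e'0 : 0 < e / 2 / (mu^-1 * T `^ mu) by rewrite !divr_gt0.
  have [u' [du' [w' [Hreg Hdu _ _]]]] := H _ e'0.
  have [_ _ _ _ o1] := Hreg; have e2 : 0 < e / 2 by lra.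
  have [d d0 Hd] := o1 _ e2; exists d => // t tT td.
  have := incr0 _ _ _ _ _ e'0 Hreg Hdu tT => I.
  have {}I : `|u t - u' t - (u 0 - u' 0)| <= e / 2.
    apply: (le_trans I); have Tm : T `^ mu != 0 by rewrite gt_eqF// powR_gt0.
    have eE : e / 2 = mu^-1 * (T `^ mu * (e / 2 / (mu^-1 * T `^ mu))) by field; rewrite Tm gt_eqF.
    have /andP[t0 tT'] := tT.
    by rewrite [leRHS]eE ler_wpM2l ?invr_ge0 ?(ltW mu0)// ler_wpM2r ?(ltW e'0)// powR_le_base// ltW.
  have -> : u t - u 0 = (u t - u' t - (u 0 - u' 0)) + (u' t - u' 0) by lmod_eq R.
  by apply: (le_trans (ler_normD _ _)); have := Hd t tT td; lra.
Qed.

End RegularLimits.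

Section UniformMaximalRegularity.
Context {R : realType} {E0 E1 : completeNormedModType R} (j : {linear E1 -> E0}) (mu : R).
Hypothesis jc : continuous j.
Hypothesis ji : injective j.
Hypothesis mu01 : 0 < mu < 1.
Variable B : {linear E1 -> E0}.
Hypothesis Bc : continuous B.
Implicit Types (s t h T d e c r : R) (u du : R -> E0) (w : R -> E1).
Variable T0 : R.
Hypothesis T00 : 0 < T0.
Hypothesis existence : forall f x, wC mu T0 f -> cont_interp j mu x -> exists u du w,
  [/\ reg j mu T0 u du w, forall t, 0 < t <= T0 -> du t + B (w t) = f t & u 0 = x].
Hypothesis uniqueness : forall u du w, reg j mu T0 u du w ->
  (forall t, 0 < t <= T0 -> du t + B (w t) = 0) -> u 0 = 0 ->
  forall t, 0 < t <= T0 -> w t = 0.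

(* Data [(f, x)] of the problem, their norm, and the bounds of a solution in the
   weighted E_1 norm. *)
Let X : lmodType R := ((R -> E0) * E0)%type.
Let D (x : X) := wC mu T0 x.1 /\ cont_interp j mu x.2.
Let Nle (x : X) r := wbound mu T0 x.1 r /\ ile j mu x.2 r.
Let P c (x : X) := exists u du w, [/\ reg j mu T0 u du w,
  forall t, 0 < t <= T0 -> du t + B (w t) = x.1 t, u 0 = x.2 & wbound mu T0 w c].

Let mu01' : 0 <= mu <= 1. Proof. by case/andP: mu01 => h1 h2; rewrite !ltW. Qed.

Let complete (x : nat -> X) c : (forall n, D (x n)) ->
  (forall n, Nle (x n.+1 - x n) (c * hpow n)) ->
  exists2 y, D y & forall n, Nle (y - x n) (2 * c * hpow n).
Proof.
move=> Dx Nx; have /andP[mu0 mu1] := mu01.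
have c0 : 0 <= c by have [_ /ile_ge0] := Nx 0%N; rewrite hpow0 mulr1.
have Hf t : exists l : E0, 0 < t <= T0 -> forall n, `|l - (x n).1 t| <= 2 * (t `^ (mu - 1) * c) * hpow n.
  have [tT|tT] := pselect (0 < t <= T0); last by exists 0.
  have [|n|l Hl] := @geometric_limit R E0 (fun n => (x n).1 t) (t `^ (mu - 1) * c).
  - by rewrite mulr_ge0 ?powR_ge0//.
  - by have [h _] := Nx n; have := wbound_norm h tT; rewrite mulrA.
  by exists l.
have /choice[f {}Hf] := Hf.
have [cj cj1 Hcj] := ile_norm jc.
have [|n|y Hy] := @geometric_limit R E0 (fun n => (x n).2) (cj * c).
- by rewrite mulr_ge0//; lra.
- by have [_ h] := Nx n; have := Hcj _ _ _ h; rewrite mulrA.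
have fN n : wbound mu T0 (fun t => f t - (x n).1 t) (2 * c * hpow n).
  apply: norm_wbound => t tT; apply: le_trans (Hf t tT n) _.
  by rewrite le_eqVlt; apply/orP; left; apply/eqP; ring.
have yN n : ile j mu (y - (x n).2) (2 * c * hpow n).
  apply: (@ile_lim _ _ _ _ _ _ (fun k => (x (n + k)%N).2 - (x n).2)) => e e0.
  have [k Hk] := hpow_small (2 * (cj * c)) e0; exists k; split.
    have -> : y - (x n).2 - ((x (n + k)%N).2 - (x n).2) = y - (x (n + k)%N).2 by lmod_eq R.
    apply: (le_trans (Hy _)); apply: le_trans Hk; rewrite ler_wpM2l//.
      by rewrite !mulr_ge0//; lra.
    by rewrite hpowD ler_piMl ?hpow_le1// ltW// hpow_gt0.
  have := @geometric_steps R E0 (ile j mu) (fun n => (x n).2) c _ _ (fun n => proj2 (Nx n)) n k.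
  move=> h; apply: ile_le (h _ _) _.
  - exact: ile0.
  - by move=> *; exact: ileD.
  - rewrite -[leRHS]mulr1 ler_wpM2l//; first by rewrite !mulr_ge0// ltW// hpow_gt0.
    by have := hpow_gt0 (R := R) k; lra.
exists (f, y) => [|n]; last by exact: (conj (fN n) (yN n)).
split => /=.
  apply: wC_lim => // e e0; have [n Hn] := hpow_small (2 * c) e0.
  by exists (x n).1; [have [] := Dx n | apply: wbound_le (fN n)].
apply: ci_closed => // e e0; have [n Hn] := hpow_small (2 * c) e0.
by exists (x n).2; [have [] := Dx n | apply: ile_le (yN n) _].
Qed.

(* The solutions for the terms of the series add up to a solution for its sum. *)
Let P_series (a S : nat -> X) x c r : D x ->
  S 0%N = 0 -> (forall n, S n.+1 = S n + a n) ->
  (forall n, P (c * hpow n) (a n)) -> (forall n, Nle (x - S n) (r * hpow n)) -> P (2 * c) x.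
Proof.
move=> Dx S0 SS Pa Nx; have /andP[mu0 mu1] := mu01.
have [CB CB1 HCB] := bounded_lin Bc.
have stepF n : exists q : (R -> E0) * (R -> E0) * (R -> E1), [/\ reg j mu T0 q.1.1 q.1.2 q.2,
  forall t, 0 < t <= T0 -> q.1.2 t + B (q.2 t) = (a n).1 t, q.1.1 0 = (a n).2 & wbound mu T0 q.2 (c * hpow n)].
  by have [u [du [w H]]] := Pa n; exists (u, du, w).
have /choice[q Hq] := stepF.
pose U := fix U n : R -> E0 := if n is n'.+1 then (fun t => U n' t + (q n').1.1 t) else (fun=> 0).
pose dU := fix U n : R -> E0 := if n is n'.+1 then (fun t => U n' t + (q n').1.2 t) else (fun=> 0).
pose W := fix U n : R -> E1 := if n is n'.+1 then (fun t => U n' t + (q n').2 t) else (fun=> 0).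
have HU n : [/\ reg j mu T0 (U n) (dU n) (W n),
   forall t, 0 < t <= T0 -> dU n t + B (W n t) = (S n).1 t & U n 0 = (S n).2].
  elim: n => [|n [h1 h2 h3]] /=.
    split.
    - have := reg_cst j T0 0 mu1.
      by rewrite linear0.
    - by move=> t _; rewrite linear0 addr0 S0.
    - by rewrite S0.
  have [g1 g2 g3 _] := Hq n; split.
  - exact: regD.
  - move=> t tT; rewrite SS linearD addrACA h2// g2//.
  - by rewrite h3 g3 SS.
have c0 : 0 <= c.
  have [_ _ _ /(_ T0)] := Hq 0%N; rewrite T00 lexx hpow0 mulr1 => /(_ isT); apply: le_trans.
  by rewrite mulr_ge0// powR_ge0.
have Hw t : exists l : E1, 0 < t <= T0 -> forall n, `|l - W n t| <= 2 * (t `^ (mu - 1) * c) * hpow n.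
  have [tT|tT] := pselect (0 < t <= T0); last by exists 0.
  have [|n|l Hl] := @geometric_limit R E1 (fun n => W n t) (t `^ (mu - 1) * c).
  - by rewrite mulr_ge0 ?powR_ge0.
  - rewrite /= addrC addKr -mulrA.
    by have [_ _ _ h] := Hq n; exact: wbound_norm h tT.
  by exists l.
have /choice[w {}Hw] := Hw.
have wN n : wbound mu T0 (fun t => w t - W n t) (2 * c * hpow n).
  apply: norm_wbound => t tT; apply: le_trans (Hw t tT n) _.
  by rewrite le_eqVlt; apply/orP; left; apply/eqP; ring.
pose u t := if 0 < t then j (w t) else x.2.
have u0 : u 0 = x.2 by rewrite /u ltxx.
exists u, (fun t => x.1 t - B (w t)), w; split => //; last 2 first.
- by move=> t tT; rewrite subrK.
- have := wN 0%N; rewrite hpow0 mulr1; apply: wbound_eq => t _ /=; by rewrite subr0.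
apply: reg_lim => //.
  by move=> t /andP[t0 _]; rewrite /u t0.
move=> e e0; have [cj cj1 Hcj] := ile_norm jc.
have [n Hn] := hpow_small (`|r| + CB * (2 * c) + 2 * c + cj * `|r|) e0.
have hn := hpow_gt0 (R := R) n.
have [h1 h2 h3] := HU n; have [g1 g2] := Nx n.
have p1 : 0 <= `|r| * hpow n by rewrite mulr_ge0// ltW.
have p2 : 0 <= CB * (2 * c) * hpow n by rewrite !mulr_ge0//; lra.
have p3 : 0 <= (2 * c) * hpow n by rewrite !mulr_ge0//; lra.
have p4 : 0 <= cj * `|r| * hpow n by rewrite !mulr_ge0//; lra.
have rr : r * hpow n <= `|r| * hpow n by rewrite ler_wpM2r ?ler_norm// ltW.
exists (U n), (dU n), (W n); split => //.
- have BW : wbound mu T0 (fun t => B (w t - W n t)) (CB * (2 * c * hpow n)).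
    apply: norm_wbound => t tT; apply: (le_trans (HCB _)); rewrite mulrCA ler_wpM2l//; first by lra.
    exact: wbound_norm (wN n) tT.
  have arith (p p' r' s : E0) : p - (p' + r') + -1 *: (s - r') = p - s - p' by lmod_eq R.
  have := wboundD g1 (wboundZ (-1) BW); rewrite normrN1 mul1r => h.
  have {}h := wbound_eq (v := fun t => x.1 t - B (w t) - dU n t) _ h.
  apply: (@wbound_le _ _ _ _ T0 _ (r * hpow n + CB * (2 * c * hpow n))) => //; last first.
    apply: h => t tT; rewrite [B (w t - _)]linearB /=.
    have -> : (x.1 - (S n).1) t = x.1 t - (dU n t + B (W n t)) by rewrite h2//.
    exact: arith.
  by lra.
- by apply: wbound_le (wN n) => //; lra.
- rewrite u0 h3; apply: (le_trans (Hcj _ _ _ g2)).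
  have : cj * (r * hpow n) <= cj * (`|r| * hpow n) by rewrite ler_wpM2l//; lra.
  lra.
Qed.

(** [zabreiko] for the least weighted bound of a solution with given data. *)
Lemma maximal_regularity_bound : exists2 C, 0 < C & forall (f : R -> E0) x r,
  wC mu T0 f -> cont_interp j mu x -> wbound mu T0 f r -> ile j mu x r -> 0 < r ->
  exists u du w, [/\ reg j mu T0 u du w,
   forall t, 0 < t <= T0 -> du t + B (w t) = f t, u 0 = x & wbound mu T0 w (C * r)].
Proof.
have /andP[mu0 mu1] := mu01.
have [C C0 HC] : exists2 C : R, 0 < C & forall (x : X) r, D x -> Nle x r -> 0 < r -> P (C * r) x.
  apply: zabreiko => //.
  - by split; [exact: wC_cst|exact: ci0].
  - by move=> x y [? ?] [? ?]; split; [exact: wCD|exact: ciD].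
  - by move=> k x [? ?]; split; [exact: wCZ|exact: ciZ].
  - apply: conj; last exact: ile0.
    by move=> t _; rewrite normr0 mulr0.
  - by move=> x y r s [? ?] [? ?]; apply: conj; [exact: wboundD|exact: ileD].
  - by move=> k x r [? ?]; apply: conj; [exact: wboundZ|exact: ileZ].
  - by move=> x r s [h1 h2] rs; apply: conj; [exact: wbound_le h1|exact: ile_le h2 rs].
  - move=> c d x y [u [du [w [h1 h2 h3 h4]]]] [u' [du' [w' [g1 g2 g3 g4]]]].
    do 3 eexists; split; [exact: (regD h1 g1)| |by rewrite /= h3 g3|exact: (wboundD h4 g4)].
    by move=> t tT; rewrite linearD addrACA h2// g2.
  - move=> k c x [u [du [w [h1 h2 h3 h4]]]].
    do 3 eexists; split; [exact: (regZ k h1)| |by rewrite /= h3|exact: (wboundZ k h4)].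
    by move=> t tT; rewrite linearZ -scalerDr h2.
  - move=> c d x [u [du [w [h1 h2 h3 h4]]]] cd; exists u, du, w; split => //.
    exact: wbound_le cd h4.
  - move=> x [h1 h2]; have [u [du [w [g1 g2 g3]]]] := existence h1 h2.
    have [_ _ _ [_ [M HM] _] _] := g1; by exists M, u, du, w.
by exists C => // f x r h1 h2 h3 h4 r0; exact: (HC (f, x) r).
Qed.

(** For [T < T0] the right-hand side extends to [[0, T0]] with the same weighted norm,
    and by uniqueness on [[0, T]] the solution is the restriction of that on [[0, T0]]. *)
Lemma uniform_maximal_regularity : exists2 C, 1 <= C & forall T u du w f N,
  0 < T -> T <= T0 -> reg j mu T u du w ->
  (forall t, 0 < t <= T -> du t + B (w t) = f t) -> cont_interp j mu (u 0) ->
  ile j mu (u 0) N -> wbound mu T f N ->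
  wbound mu T w (C * N) /\ wbound mu T du (C * N).
Proof.
have /andP[mu0 mu1] := mu01; have [CB CB1 HCB] := bounded_lin Bc.
have [C C0 HC] := maximal_regularity_bound.
exists (1 + C + CB * C) => [|T u du w f N T0' TT Hu Heq ci HN Hf].
  by have := mulr_ge0 (le_trans ler01 CB1) (ltW C0); lra.
have N0 := ile_ge0 HN.
have fC : wC mu T f.
  have [_ _ c1 c2 _] := Hu; apply: wC_eq Heq _; apply: wCD => //; exact: wC_lin.
(* Beyond [T] the weighted function [t^(1-mu) f(t)] stays constant. *)
pose F t := paste T f (fun t => t `^ (mu - 1) *: (T `^ (1 - mu) *: f T)) t.
have FT : f T = T `^ (mu - 1) *: (T `^ (1 - mu) *: f T).
  by rewrite scalerA (@powR_split _ T _ _ 0)// ?powRr0 ?scale1r//; lra.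
have Fr t : 0 < t -> T <= t -> t `^ (1 - mu) * `|F t| = T `^ (1 - mu) * `|f T|.
  move=> t0 Tt; rewrite /F paste_r// normrZ ger0_norm ?powR_ge0// mulrA.
  rewrite (@powR_split _ t _ _ 0)// ?powRr0 ?mul1r; last by lra.
  by rewrite normrZ ger0_norm// powR_ge0.
have FN : wbound mu T0 F N.
  move=> t /andP[t0 tT0]; have [tT|/ltW Tt] := leP t T.
    by rewrite /F paste_l//; apply: Hf; rewrite t0.
  by rewrite Fr//; apply: Hf; rewrite T0' lexx.
have FC : wC mu T0 F.
  have [f1 f2 f3] := fC; split; [|by exists N|].
    apply: lcont_paste => //.
      by apply: lcont_mono f1 => t [/= /andP[-> _] ->].
    apply: lcont_scale; last exact: lcont_cst.
    by apply: lcont_mono (powR_is_lcont _) => t [/= /andP[]].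
  move=> e e0; have [d d0 Hd] := f3 e e0; exists (Num.min d T); first by rewrite lt_min d0.
  move=> t /andP[t0 _]; rewrite lt_min => /andP[td tT].
  by rewrite /F paste_l ?(ltW tT)//; apply: Hd => //; rewrite t0 (ltW tT).
suff main r : N < r -> wbound mu T w (C * r).
  have wb : wbound mu T w (C * N).
    move=> t tT; apply/ler_addgt0Pr => e e0.
    have Nr : N < N + e / C by rewrite ltrDl divr_gt0.
    apply: (le_trans (main _ Nr t tT)).
    by rewrite mulrDr lerD2l mulrC divfK// gt_eqF.
  have CN0 : 0 <= C * N by rewrite mulr_ge0// ltW.
  have CBN0 : 0 <= CB * C * N by rewrite !mulr_ge0//; lra.
  split; first by apply: wbound_le wb => //; lra.
  move=> t tT; have -> : du t = f t - B (w t) by rewrite -Heq// addrK.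
  apply: (@le_trans _ _ (t `^ (1 - mu) * (`|f t| + CB * `|w t|))).
    rewrite ler_wpM2l ?powR_ge0//; apply: (le_trans (ler_normB _ _)); rewrite lerD2l; exact: HCB.
  have := Hf t tT; have := ler_wpM2l (le_trans ler01 CB1) (wb t tT).
  rewrite mulrDr [_ * (CB * _)]mulrCA; lra.
move=> Nr; have r0 : 0 < r by exact: le_lt_trans Nr.
have [U [dU [W [HU HUeq U0 HW]]]] := HC F (u 0) r FC ci (wbound_le (lexx _) (ltW Nr) FN) (ile_le HN (ltW Nr)) r0.
have HU' := reg_restrict TT HU.
have wW t : 0 < t <= T -> W t - w t = 0.
  move=> tT; have := uniqueness_restrict jc ji mu01 Bc T00 _ uniqueness T0' TT (regB HU' Hu).
  apply => //.
  - by move=> x cx; apply: existence => //; exact: wC_cst.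
  - move=> s /andP[s0 sT]; rewrite linearB addrACA -opprD Heq ?s0// HUeq; last by rewrite s0 (le_trans sT).
    by rewrite /F paste_l// subrr.
  - by rewrite /= U0 subrr.
apply: (wbound_eq (u := W)); last by apply: wbound_le HW => //.
by move=> t tT; apply/eqP; rewrite -subr_eq0 wW.
Qed.

End UniformMaximalRegularity.

Lemma max_reg_uniform (R : realType) (E0 E1 : completeNormedModType R)
    (j : {linear E1 -> E0}) (mu : R) (B : {linear E1 -> E0}) :
  continuous j -> injective j -> 0 < mu < 1 -> max_reg j mu B ->
  exists2 T0, 0 < T0 & exists2 C, 1 <= C & forall T u du w f N,
  0 < T -> T <= T0 -> reg j mu T u du w ->
  (forall t, 0 < t <= T -> du t + B (w t) = f t) -> cont_interp j mu (u 0) ->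
  ile j mu (u 0) N -> wbound mu T f N ->
  wbound mu T w (C * N) /\ wbound mu T du (C * N).
Proof.
move=> jc ji mu01 [Bc [T0 T00 H]]; exists T0 => //; have /andP[mu0 mu1] := mu01.
have mu01' : 0 <= mu <= 1 by rewrite !ltW.
apply: uniform_maximal_regularity => //.
  move=> f x fC cx; have [|u [du [w [/(E1mu_reg mu jc _ _ _ T00) h1 h2 h3]]] _] := H f x _ cx.
    exact/(BCwP _ _ T00).
  by exists u, du, w.
move=> u du w Hreg Heq u0 t tT.
have [||v _ Hv] := H (fun=> 0) 0.
- by apply/(BCwP _ _ T00); exact: wC_cst.
- exact: ci0.
have tT' : 0 <= t <= T0 by case/andP: tT => /ltW-> ->.
apply: ji; rewrite linear0; have [<-// _ _ _ _] := Hreg.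
rewrite (Hv u _ t tT'); last by exists du, w; split=> //; exact/(E1mu_reg mu jc _ _ _ T00).
rewrite -(Hv (fun=> 0) _ t tT')//; exists (fun=> 0), (fun=> 0); split => //; last first.
  by move=> s _; rewrite linear0 addr0.
apply/(E1mu_reg mu jc _ _ _ T00); have := reg_cst j T0 0 mu1; by rewrite linear0.
Qed.

(** * The nonlinearity with the operator frozen at the equilibrium *)

Lemma opnorm_bound (R : realType) (E F : completeNormedModType R) (A B : {linear E -> F}) y :
  continuous A -> continuous B -> `|A y - B y| <= opnorm ((A : E -> F) \- (B : E -> F)) * `|y|.
Proof.
move=> /bounded_lin[C C1 HC] /bounded_lin[C' C1' HC'].
have [->|y0] := eqVneq y 0; first by rewrite (linear0 A) (linear0 B) subrr !normr0 mulr0.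
have ny : 0 < `|y| by rewrite normr_gt0.
rewrite -ler_pdivrMr//.
have ub : ubound [set `|((A : E -> F) \- (B : E -> F)) z| | z in [set z : E | `|z| <= 1]] (C + C').
  move=> r [z /= z1 <-]; apply: (le_trans (ler_normB _ _)); apply: lerD.
    by apply: (le_trans (HC z)); rewrite -[leRHS]mulr1 ler_wpM2l//; lra.
  by apply: (le_trans (HC' z)); rewrite -[leRHS]mulr1 ler_wpM2l//; lra.
apply: sup_upper_bound.
  split; [exists 0; exists 0 => //=|by exists (C + C')].
    by rewrite normr0.
  by rewrite /= (linear0 A) (linear0 B) subrr normr0.
exists (`|y|^-1 *: y) => /=.
  by rewrite normrZ ger0_norm ?invr_ge0// mulVf// gt_eqF.
rewrite [A (_ *: _)]linearZ [B (_ *: _)]linearZ -scalerBr normrZ ger0_norm ?invr_ge0// mulrC//.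
Qed.

Lemma powR_add_le (R : realType) (a b r : R) : 0 <= a -> 0 <= b -> 0 <= r ->
  (a + b) `^ r <= (2 * a) `^ r + (2 * b) `^ r.
Proof.
move=> a0 b0 r0; have [ab|/ltW ba] := leP a b.
  apply: (@le_trans _ _ ((2 * b) `^ r)); first by apply: powR_le_base => //; lra.
  by rewrite lerDr powR_ge0.
apply: (@le_trans _ _ ((2 * a) `^ r)); first by apply: powR_le_base => //; lra.
by rewrite lerDl powR_ge0.
Qed.

(** Here [z] bounds both powers of the E_beta norms and [b P] the norm of the
    difference in the estimate of the semilinear term; [a] is the weight. *)
Lemma weighted_product_le (R : realType) (a b c x y z I kap P : R) :
  0 <= a -> 0 <= x -> 0 <= y -> x <= z -> y <= z -> 0 <= I -> I <= b * P -> 0 <= P ->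
  a * b = c -> c * (1 + 2 * z) <= kap -> a * ((1 + x + y) * I) <= kap * P.
Proof.
move=> a0 x0 y0 xz yz I0 IP P0 abc ck.
apply: (@le_trans _ _ (a * ((1 + 2 * z) * (b * P)))).
  by rewrite ler_wpM2l//; apply: ler_pM => //; lra.
have -> : a * ((1 + 2 * z) * (b * P)) = c * (1 + 2 * z) * P by rewrite -abc; ring.
exact: ler_wpM2r.
Qed.

Lemma common_radius (R : realType) m (Q : 'I_m -> R -> Prop) :
  (forall k, exists2 d, 0 < d & forall x, 0 < x -> x <= d -> Q k x) ->
  exists2 d, 0 < d & forall x, 0 < x -> x <= d -> forall k, Q k x.
Proof.
move=> H; have H' k : exists d, 0 < d /\ forall x, 0 < x -> x <= d -> Q k x.
  by have [d d0 Hd] := H k; exists d.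
have /choice[d Hd] := H'; exists (\big[Num.min/1]_k d k).
  by apply: lt_bigmin => // k _; have [] := Hd k.
move=> x x0 xd k; have [_] := Hd k; apply => //; apply: (le_trans xd); exact: bigmin_le.
Qed.

Section Nonlinearity.
Context {R : realType} {E0 E1 : completeNormedModType R} (j : {linear E1 -> E0}).
Hypothesis jc : continuous j.
Variable mu : R.
Hypothesis mu01 : 0 < mu < 1.
Variables (V : set E0) (A : E0 -> {linear E1 -> E0}) (F1 F2 : E0 -> E0).
Hypothesis hV : iopen j mu V.
Hypothesis hAF1 : hyp_quasilinear j mu V A F1.
Variables (beta : R) (m : nat) (betas rhos : 'I_m -> R).
Hypothesis hF2 : hyp_semilinear j mu V F2 beta betas rhos.
Variable us : E1.
Hypothesis hVus : V (j us).
Implicit Types (s M N P : R) (w : E1).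

(** The equation reads [u' + A(us) u = frozen u]. *)
Definition frozen w := A (j us) w - A (j w) w + F1 (j w) + F2 (j w).

Let mu01' : 0 <= mu <= 1. Proof. by case/andP: mu01 => h1 h2; rewrite !ltW. Qed.

(** The quasilinear part of the difference is
    [(A(us) - A(w1)) (w1 - w2) - (A(w1) - A(w2)) w2]; only its first term contains
    the E_1 norm of [w1 - w2], and it carries the small factor [M]. *)
Lemma near_equilibrium : exists r L C, [/\ 0 < r, 0 < L, 0 < C &
  forall M w1 w2 D, 0 < M -> M < r -> ile j mu (j w1 - j us) M -> ile j mu (j w2 - j us) M ->
   ile j mu (j w1 - j w2) D ->
   [/\ V (j w1), V (j w2) &
   `|frozen w1 - frozen w2| <= L * M * `|w1 - w2| + L * D * `|w2| + L * D +
     C * \sum_(k < m) (1 + inorm j beta (j w1) `^ rhos k + inorm j beta (j w2) `^ rhos k)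
                  * inorm j (betas k) (j w1 - j w2)]].
Proof.
have /andP[m0 m1] := mu01.
have [hA /(_ _ hVus)[r1 [L [r10 HL]]]] := hAF1; have [_ /(_ _ hVus)[r2 r20 HV]] := hV.
have [/andP[mb b1] _ _ HF] := hF2.
have r0 : 0 < Num.min r1 r2 by rewrite lt_min r10.
have [C C0 HC] := HF _ hVus _ r0.
have L10 : 0 < `|L| + 1 by rewrite ltr_wpDl.
exists (Num.min r1 r2), (`|L| + 1), C; split=> //.
move=> M w1 w2 D M0; rewrite lt_min => /andP[Mr1 Mr2] h1 h2 hD.
have D0 := ile_ge0 hD.
have cij w : cont_interp j mu (j w) by exact: ci_j.
have b01 : 0 <= beta <= 1 by apply/andP; lra.
have ball w r : M < r -> ile j mu (j w - j us) M -> iball j mu (j us) r (j w).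
  by move=> Mr h; split=> //; apply: le_lt_trans (ile_inorm h) Mr.
have V1 : V (j w1) by apply: HV; exact: ball.
have V2 : V (j w2) by apply: HV; exact: ball.
have Ac w : V (j w) -> continuous (A (j w)) by move=> /hA[].
have Lip x y z (Vx : V (j x)) (Vy : V (j y)) d : iball j mu (j us) r1 (j x) -> iball j mu (j us) r1 (j y) ->
   inorm j mu (j x - j y) <= d -> `|A (j x) z - A (j y) z| <= (`|L| + 1) * d * `|z|.
  move=> bx by_ hd; apply: (le_trans (opnorm_bound z (Ac _ Vx) (Ac _ Vy))).
  rewrite ler_wpM2r//; have [h _] := HL _ _ Vx Vy bx by_; apply: (le_trans h).
  have i0 : 0 <= inorm j mu (j x - j y).
    by apply: ile_ge0 (ci_ile _); exact: ciB.
  apply: (@le_trans _ _ ((`|L| + 1) * inorm j mu (j x - j y))).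
    by rewrite ler_wpM2r// (le_trans (ler_norm L))// lerDl.
  by rewrite ler_wpM2l// ltW.
have bus : iball j mu (j us) r1 (j us).
  split=> //; rewrite subrr; apply: le_lt_trans r10; apply: ile_inorm; exact: ile0.
have E1w : `|A (j us) (w1 - w2) - A (j w1) (w1 - w2)| <= (`|L| + 1) * M * `|w1 - w2|.
  by rewrite distrC; apply: Lip => //; [exact: ball|exact: ile_inorm].
have E2w : `|A (j w1) w2 - A (j w2) w2| <= (`|L| + 1) * D * `|w2|.
  by apply: Lip => //; [exact: ball|exact: ball|exact: ile_inorm].
have E3 : `|F1 (j w1) - F1 (j w2)| <= (`|L| + 1) * D.
  have [_ h] := HL _ _ V1 V2 (ball _ _ Mr1 h1) (ball _ _ Mr1 h2); apply: (le_trans h).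
  apply: (@le_trans _ _ (`|L| * D)); last by rewrite ler_wpM2r// lerDl.
  apply: (le_trans (ler_norm _)); rewrite normrM ler_wpM2l// ger0_norm; last by apply: ile_ge0 (ci_ile _); exact: ciB.
  exact: ile_inorm.
have cb w : M < Num.min r1 r2 -> ile j mu (j w - j us) M -> iclosed_ball j mu (j us) (Num.min r1 r2) (j w).
  by move=> Mr h; have [? h'] := ball _ _ Mr h; split=> //; exact: ltW.
have Mr : M < Num.min r1 r2 by rewrite lt_min Mr1.
have E4 := HC (j w1) (j w2) (cb _ Mr h1) V1 (ci_j jc b01 w1) (cb _ Mr h2) V2 (ci_j jc b01 w2).
split=> //.
have -> : frozen w1 - frozen w2 = (A (j us) (w1 - w2) - A (j w1) (w1 - w2)) -
   (A (j w1) w2 - A (j w2) w2) + (F1 (j w1) - F1 (j w2)) + (F2 (j w1) - F2 (j w2)).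
  by rewrite /frozen [A (j us) (w1 - w2)]linearB [A (j w1) (w1 - w2)]linearB; lmod_eq R.
apply: (le_trans (ler_normD _ _)); apply: lerD => //.
apply: (le_trans (ler_normD _ _)); apply: lerD => //.
apply: (le_trans (ler_normB _ _)); exact: lerD.
Qed.

(** With [|x|_beta <= U + s^(mu-beta) M] the growth condition makes the exponent of
    [s] in the product nonnegative.  It may be 0, and then the bound is small because
    [M^rho] is; for [rho = 0] the exponent [1 - beta_k] is positive. *)
Lemma semilinear_weight kappa (k : 'I_m) U : 0 <= U -> 0 < kappa -> exists2 d, 0 < d & forall x, 0 < x -> x <= d ->
  forall s M, 0 < s -> s <= x -> 0 < M -> M <= x ->
  s `^ (1 - betas k) * (1 + 2 * (U + s `^ (mu - beta) * M) `^ rhos k) <= kappa.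
Proof.
move=> U0 kappa0; have [/andP[mb b1] /(_ k)[/andP[mbk bkb] r0] /(_ k) crit _] := hF2.
have /andP[m0 m1] := mu01.
have bk1 : 0 < 1 - betas k by lra.
have k2 : 0 < kappa / 2 by lra.
have Y0 s M : 0 < s -> 0 < M -> 0 <= s `^ (mu - beta) * M by move=> s0 M0; rewrite mulr_ge0 ?powR_ge0// ltW.
have [rE|rN] := eqVneq (rhos k) 0.
  have [d d0 Hd] := powR_small bk1 (divr_gt0 kappa0 (ltr0n _ 3)).
  exists (d / 2); first by lra.
  move=> x x0 xd s M s0 sx M0 Mx; rewrite rE powRr0.
  have := Hd s s0; lra.
have rp : 0 < rhos k by rewrite lt_neqAle eq_sym rN.
pose K := 1 + 2 * (2 * U) `^ rhos k.
have K0 : 0 < K by have := powR_ge0 (2 * U) (rhos k); rewrite /K; lra.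
have [d1 d10 H1] := powR_small bk1 (divr_gt0 k2 K0).
have [d2 d20 H2] := powR_small rp (divr_gt0 kappa0 (ltr0n _ 4)).
exists (Num.min 1 (Num.min (d1 / 2) (d2 / 4))).
  by rewrite !lt_min ltr01 !divr_gt0.
move=> x x0; rewrite !le_min => /and3P[x1 xd1 xd2] s M s0 sx M0 Mx.
have Q1 : s `^ (1 - betas k) * K <= kappa / 2.
  by rewrite -ler_pdivlMr//; apply: H1 => //; move: sx xd1 d10; forget; lra.
have Q2 : (2 * M) `^ rhos k <= kappa / 4 by apply: H2; move: M0 Mx xd2 d20; forget; lra.
have crit' : rhos k * (beta - mu) + (betas k - mu) <= 1 - mu.
  by move: crit; rewrite ler_pdivrMr ?mul1r//; lra.
have Q3 : s `^ (1 - betas k) * (2 * (s `^ (mu - beta) * M)) `^ rhos k <= (2 * M) `^ rhos k.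
  have -> : 2 * (s `^ (mu - beta) * M) = s `^ (mu - beta) * (2 * M) by ring.
  rewrite powRM ?powR_ge0//; last by lra.
  rewrite -powRrM mulrA (@powR_split _ s _ _ (1 - betas k + (mu - beta) * rhos k))//.
  by rewrite ler_piMl ?powR_ge0// powR_le1//; [move: crit'; forget; lra|rewrite s0 (le_trans sx x1)].
have Q4 := powR_add_le U0 (Y0 s M s0 M0) r0.
have s1 : 0 <= s `^ (1 - betas k) by exact: powR_ge0.
by move: (ler_wpM2l s1 Q4) Q1 Q2 Q3; rewrite /K; forget; lra.
Qed.

(** Each term of [near_equilibrium] carries a small factor once multiplied by
    [s^(1-mu)]: the quasilinear ones [M] or [s^(1-mu)] itself, through
    [|w2|_1 <= |us|_1 + s^(mu-1) M], and the semilinear ones that of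
    [semilinear_weight]. *)
Lemma frozen_contraction kappa : 0 < kappa -> exists M tau, [/\ 0 < M, 0 < tau &
  (forall w, ile j mu (j w - j us) M -> V (j w)) /\
  forall s w1 w2 P, 0 < s <= tau -> ile j mu (j w1 - j us) M -> ile j mu (j w2 - j us) M ->
   `|w1 - us| <= s `^ (mu - 1) * M -> `|w2 - us| <= s `^ (mu - 1) * M ->
   ile j mu (j w1 - j w2) P -> `|w1 - w2| <= s `^ (mu - 1) * P ->
   s `^ (1 - mu) * `|frozen w1 - frozen w2| <= kappa * P].
Proof.
move=> kappa0; have [r [L [C [r0 L0 C0 Hnear]]]] := near_equilibrium.
have /andP[m0 m1] := mu01.
have [/andP[mb b1] hbk _ _] := hF2.
have b01 : 0 <= beta <= 1 by apply/andP; lra.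
have mb1 : mu <= beta <= 1 by apply/andP; lra.
pose U := inorm j beta (j us).
have iU : ile j beta (j us) U by apply: ci_ile; exact: ci_j.
have U0 : 0 <= U := ile_ge0 iU.
have Cm : 0 < C * m%:R + 1 by rewrite ltr_wpDl// mulr_ge0// ltW.
have [kap kap0 kapE] : exists2 kap, 0 < kap & (C * m%:R + 1) * kap = kappa / 4.
  exists (kappa / (4 * (C * m%:R + 1))); first by rewrite divr_gt0// mulr_gt0.
  by field; lra.
have [d d0 Hd] : exists2 d, 0 < d & forall x, 0 < x -> x <= d -> forall k s M, 0 < s -> s <= x -> 0 < M -> M <= x ->
  s `^ (1 - betas k) * (1 + 2 * (U + s `^ (mu - beta) * M) `^ rhos k) <= kap.
  apply: common_radius => k; exact: semilinear_weight.
have p0 : 0 < 1 - mu by lra.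
have e0 : 0 < kappa / (4 * (L * (`|us| + 1))).
  by rewrite divr_gt0// !mulr_gt0// ltr_wpDl.
have [d2 d20 Hd2] := powR_small p0 e0.
have [M [M0 Md Mr M1 ML]] : exists M, [/\ 0 < M, M <= d, M < r, M <= 1 & 8 * L * M <= kappa].
  exists (Num.min d (Num.min (r / 2) (Num.min 1 (kappa / (8 * L))))); split.
  - by rewrite !lt_min d0 ltr01 !divr_gt0// mulr_gt0.
  - by rewrite ge_min lexx.
  - by rewrite !gt_min; apply/orP; right; apply/orP; left; lra.
  - by rewrite !ge_min lexx !orbT.
  - by rewrite mulrC -ler_pdivlMr ?mulr_gt0// !ge_min lexx !orbT.
have [tau [tau0 taud taud2]] : exists tau, [/\ 0 < tau, tau <= d & tau < d2].
  exists (Num.min d (d2 / 2)); split; first by rewrite lt_min d0 divr_gt0.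
    by rewrite ge_min lexx.
  by rewrite gt_min; apply/orP; right; lra.
exists M, tau; split=> //; split.
  move=> w hw; have [] := Hnear M w w 0 M0 Mr hw hw => //.
  by rewrite subrr; exact: ile0.
move=> s w1 w2 P /andP[s0 stau] h1 h2 g1 g2 hP gP.
have sd : s <= d by exact: le_trans taud.
have sd2 : s < d2 by exact: le_lt_trans taud2.
have P0 := ile_ge0 hP.
have [_ _ HG] := Hnear M w1 w2 P M0 Mr h1 h2 hP.
have sm : 0 < s `^ (1 - mu) by exact: powR_gt0.
have cancel x (y : R) : x <= s `^ (mu - 1) * y -> s `^ (1 - mu) * x <= y.
  by move=> h; rewrite mulrC -ler_pdivlMr// mulrC -powRN opprB.
have T1 := cancel _ _ gP; have T2 := cancel _ _ g2.
have smu := Hd2 s s0 sd2.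
have wb w : ile j mu (j w - j us) M -> `|w - us| <= s `^ (mu - 1) * M ->
    inorm j beta (j w) <= U + s `^ (mu - beta) * M.
  move=> h g; apply: ile_inorm; rewrite -[j w](subrK (j us)) addrC; apply: ileD => //.
  by move: h; rewrite -!linearB => h; apply: ile_weighted h g.
have bnd k : s `^ (1 - mu) * ((1 + inorm j beta (j w1) `^ rhos k + inorm j beta (j w2) `^ rhos k)
                  * inorm j (betas k) (j w1 - j w2)) <= kap * P.
  have [/andP[mbk bkb] r0k] := hbk k.
  have bk01 : 0 <= betas k <= 1 by rewrite (le_trans (ltW m0) mbk) (le_trans bkb (ltW b1)).
  have sk : 1 - mu + (mu - betas k) = 1 - betas k by ring.
  have i0 w : 0 <= inorm j beta (j w) by apply: ile_ge0 (ci_ile _); exact: ci_j.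
  have I : inorm j (betas k) (j w1 - j w2) <= s `^ (mu - betas k) * P.
    apply: ile_inorm; rewrite -linearB; apply: ile_weighted => //; first by rewrite mbk (le_trans bkb (ltW b1)).
    by rewrite linearB.
  have I0 : 0 <= inorm j (betas k) (j w1 - j w2).
    by apply: ile_ge0 (ci_ile _); apply: ciB => //; exact: ci_j.
  have J1 := powR_le_base r0k (i0 w1) (wb _ h1 g1).
  have J2 := powR_le_base r0k (i0 w2) (wb _ h2 g2).
  have := Hd d d0 (lexx d) k s M s0 sd M0 Md => Hk.
  apply: (weighted_product_le (ltW sm) _ _ J1 J2 I0 I P0 _ Hk); rewrite ?powR_ge0//.
  exact: (powR_split s0 sk).
apply: (le_trans (ler_wpM2l (ltW sm) HG)).
have S4 : s `^ (1 - mu) * (C * \sum_(k < m) (1 + inorm j beta (j w1) `^ rhos k + inorm j beta (j w2) `^ rhos k)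
                  * inorm j (betas k) (j w1 - j w2)) <= kappa / 4 * P.
  rewrite mulrCA mulr_sumr; apply: (@le_trans _ _ (C * (\sum_(k < m) kap * P))).
    by rewrite ler_wpM2l ?(ltW C0)//; apply: ler_sum => k _; exact: bnd.
  rewrite sumr_const card_ord.
  have -> : C * (kap * P *+ m) = (C * m%:R) * kap * P by rewrite -mulr_natl; ring.
  by rewrite ler_wpM2r// -kapE ler_wpM2r ?(ltW kap0)// lerDl.
have S1 : s `^ (1 - mu) * (L * M * `|w1 - w2|) <= kappa / 8 * P.
  rewrite mulrCA; apply: (@le_trans _ _ (L * M * P)); first by rewrite ler_wpM2l// mulr_ge0// ltW.
  by rewrite ler_wpM2r//; move: ML; forget; lra.
have w2n : s `^ (1 - mu) * `|w2| <= s `^ (1 - mu) * `|us| + M.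
  rewrite -[w2](subrK us); apply: (@le_trans _ _ (s `^ (1 - mu) * (`|w2 - us| + `|us|))).
    by rewrite ler_wpM2l ?(ltW sm)// ler_normD.
  by rewrite mulrDr; move: T2; forget; lra.
have e4 : s `^ (1 - mu) * (`|us| + 1) * L <= kappa / 4.
  have us1 : 0 < `|us| + 1 by rewrite ltr_wpDl.
  rewrite -mulrA -ler_pdivlMr ?mulr_gt0//; apply: (le_trans smu).
  by rewrite le_eqVlt; apply/orP; left; apply/eqP; field; move: L0 us1; forget; lra.
have S2 : s `^ (1 - mu) * (L * P * `|w2|) + s `^ (1 - mu) * (L * P) <= (kappa / 4 + kappa / 8) * P.
  have -> : s `^ (1 - mu) * (L * P * `|w2|) = (s `^ (1 - mu) * `|w2|) * L * P by ring.
  have -> : s `^ (1 - mu) * (L * P) = s `^ (1 - mu) * L * P by ring.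
  rewrite -mulrDl ler_wpM2r//.
  by move: e4 ML (ler_wpM2r (ltW L0) w2n); forget; lra.
rewrite !mulrDr; have kP : 0 <= kappa * P by rewrite mulr_ge0// ltW.
by move: S1 S2 S4 kP; forget; lra.
Qed.

(** In E_nu with [nu >= beta] all norms in the growth condition stay bounded, so no
    weight in time enters. *)
Lemma frozen_lipschitz nu : beta <= nu < 1 -> exists K M, [/\ 0 < K, 0 < M &
  forall b N, 0 < N -> ile j nu (j b) N -> N <= M -> `|frozen (us + b) - frozen us| <= K * N * (1 + `|b|)].
Proof.
move=> /andP[bnu nu1]; have [r [L [C [r0 L0 C0 Hnear]]]] := near_equilibrium.
have /andP[m0 m1] := mu01.
have [/andP[mb b1] hbk _ _] := hF2.
have b01 : 0 <= beta <= 1 by apply/andP; lra.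
have [c c1 Hc] := ile_embed jc; have c0 : 0 < c by lra.
pose U := inorm j beta (j us).
have iU : ile j beta (j us) U by apply: ci_ile; exact: ci_j.
have U0 : 0 <= U := ile_ge0 iU.
pose W := \sum_(k < m) (1 + (U + c) `^ rhos k + U `^ rhos k).
have W0 : 0 <= W by apply: sumr_ge0 => k _; rewrite !addr_ge0 ?powR_ge0.
pose K := L * c + L * c * `|us| + L * c + C * (c * W) + 1.
have Lc : 0 < L * c by rewrite mulr_gt0.
have Lcu : 0 <= L * c * `|us| by rewrite mulr_ge0// ltW.
have CW : 0 <= C * (c * W) by rewrite !mulr_ge0// ltW.
have K0 : 0 < K by rewrite /K; lra.
exists K, (Num.min 1 (r / (4 * c))); split=> //.
  by rewrite lt_min ltr01 divr_gt0// mulr_gt0.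
move=> b N N0 hN; rewrite le_min => /andP[N1 Nr].
have hmu : ile j mu (j b) (c * N) by apply: Hc hN; [exact: ltW|exact: le_trans (ltW mb) bnu].
have cN0 : 0 < c * N by rewrite mulr_gt0.
have cNr : c * N < r.
  have := ler_wpM2l (ltW c0) Nr; have -> : c * (r / (4 * c)) = r / 4 by field; lra.
  lra.
have E : j (us + b) - j us = j b by rewrite linearD addrAC subrr add0r.
have h2 : ile j mu (j us - j us) (c * N) by rewrite subrr; apply: ile0; exact: ltW.
have [|||_ _ HG] := Hnear (c * N) (us + b) us (c * N) cN0 cNr; rewrite ?E//.
apply: (le_trans HG); have -> : us + b - us = b by rewrite addrAC subrr add0r.
rewrite E.
have ib : ile j beta (j b) (c * N) by apply: Hc hN => //; exact: ltW (lt_trans m0 mb).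
have cNc : c * N <= c by rewrite ger_pMr.
have S : \sum_(k < m) (1 + inorm j beta (j (us + b)) `^ rhos k + inorm j beta (j us) `^ rhos k)
    * inorm j (betas k) (j b) <= c * W * N.
  rewrite /W mulrAC mulr_sumr; apply: ler_sum => k _.
  have [/andP[mbk bkb] r0k] := hbk k; have bk01 : 0 <= betas k <= 1 by rewrite (le_trans (ltW m0) mbk) (le_trans bkb (ltW b1)).
  have i0 w : 0 <= inorm j beta (j w) by apply: ile_ge0 (ci_ile _); exact: ci_j.
  have I0 : 0 <= inorm j (betas k) (j b) by apply: ile_ge0 (ci_ile _); exact: ci_j.
  rewrite mulrC; apply: ler_pM => //.
  - by rewrite !addr_ge0 ?powR_ge0.
  - by apply: ile_inorm; apply: Hc hN; [exact: le_trans (ltW m0) mbk|exact: le_trans bkb bnu].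
  - rewrite lerD2r lerD2l; apply: powR_le_base => //; apply: ile_inorm.
    by rewrite linearD; apply: ileD => //; exact: ile_le ib cNc.
have CS := ler_wpM2l (ltW C0) S.
have Nb : 0 <= N * `|b| by rewrite mulr_ge0// ltW.
have x1 := mulr_ge0 Lcu Nb; have x2 := mulr_ge0 CW Nb; have x3 := mulr_ge0 (ltW Lc) Nb.
have x4 := mulr_ge0 (ltW Lc) (ltW N0).
by rewrite /K; move: CS x1 x2 x3 x4 Nb N0; forget; lra.
Qed.

End Nonlinearity.

(** * Perturbed linear problems and solutions *)

Section Perturbation.
Context {R : realType} {E0 E1 : completeNormedModType R} (j : {linear E1 -> E0}).
Hypothesis jc : continuous j.
Variable mu : R.
Hypothesis mu01 : 0 < mu < 1.
Implicit Types (s t h T d e N P : R) (u du : R -> E0) (w : R -> E1).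

(** The bound on the derivative controls the displacement from [u(0)] in E_0 by
    [t^mu], as [ile_trace] demands. *)
Lemma reg_trace T u du w P theta N : 0 <= P -> reg j mu T u du w ->
  wbound mu T w P -> wbound mu T du P -> mu <= theta <= 1 -> ile j theta (u 0) N ->
  forall s, 0 < s <= T -> ile j theta (u s) (N + mu^-1 * (s `^ (mu - theta) * P)).
Proof.
move=> P0 [ujw Hd _ _ H0] hw hdu th HN s sT; have /andP[mu0 mu1] := mu01.
have /andP[s0 _] := sT; rewrite ujw//.
apply: (ile_trace mu01 th s0 _ _ (wbound_norm hw sT) HN).
  by rewrite invf_ge1 ?(ltW mu1).
by rewrite -ujw//; exact: (weighted_mean_value mu0 P0 Hd hdu H0 sT).
Qed.

(** Iterating [P -> X + P / 2] from any valid bound lowers it to [2 X]; this moves half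
    of a norm to the left-hand side. *)
Lemma absorb (Q : R -> Prop) X P0 : 0 <= X -> 0 <= P0 -> Q P0 ->
  (forall P, 0 <= P -> Q P -> Q (X + P / 2)) -> forall e, 0 < e -> exists2 P, P <= 2 * X + e & Q P.
Proof.
move=> X0 P00 QP step e e0; have [n Hn] := hpow_small P0 e0.
have H k : exists P, [/\ 0 <= P, P <= 2 * X + P0 * hpow k & Q P].
  elim: k => [|k [P [p0 Pk QP']]].
    by exists P0; split => //; rewrite hpow0; lra.
  exists (X + P / 2); split; [lra| |exact: step].
  by rewrite hpowS; lra.
by have [P [p0 Pk QP']] := H n; exists P => //; lra.
Qed.

Variable B : {linear E1 -> E0}.
Variables (T0 CL : R).
Hypothesis CL1 : 1 <= CL.
Hypothesis HL : forall T u du w f N, 0 < T -> T <= T0 -> reg j mu T u du w ->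
  (forall t, 0 < t <= T -> du t + B (w t) = f t) -> cont_interp j mu (u 0) ->
  ile j mu (u 0) N -> wbound mu T f N ->
  wbound mu T w (CL * N) /\ wbound mu T du (CL * N).

(** Of a bound [P] on the solution, the trace estimate makes [mu^-1 P], the assumption
    on the right-hand side [P / (2 CL)] and the linear bound [P / 2], which is
    absorbed. *)
Lemma perturbed_regularity T u du w N : 0 < T -> T <= T0 -> reg j mu T u du w ->
  cont_interp j mu (u 0) -> ile j mu (u 0) N ->
  (forall P, 0 <= P -> wbound mu T w P -> wbound mu T du P ->
    forall s, 0 < s <= T -> ile j mu (u s) (N + mu^-1 * P) -> `|w s| <= s `^ (mu - 1) * (N + mu^-1 * P) ->
    s `^ (1 - mu) * `|du s + B (w s)| <= mu / (2 * CL) * (N + mu^-1 * P) + N) ->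
  wbound mu T w (4 * CL * N) /\ wbound mu T du (4 * CL * N).
Proof.
move=> T00 TT Hreg ci HN Hf; have /andP[mu0 mu1] := mu01.
have N0 := ile_ge0 HN; have c1 := CL1; have CL0 : 0 < CL by lra.
have muV : 1 <= mu^-1 by rewrite invf_ge1 ?(ltW mu1).
pose Q P := wbound mu T w P /\ wbound mu T du P.
have [_ _ [_ [M1 HM1] _] [_ [M2 HM2] _] _] := Hreg.
have step P : 0 <= P -> Q P -> Q (2 * CL * N + P / 2).
  move=> P0 [hw hdu].
  have muP : P <= mu^-1 * P by rewrite ler_peMl.
  have fb : wbound mu T (fun s => du s + B (w s)) (mu / (2 * CL) * (N + mu^-1 * P) + N).
    move=> s sT; apply: (Hf P) => //.
      have := reg_trace P0 Hreg hw hdu _ HN sT; rewrite subrr powRr0 mul1r; apply.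
      by rewrite lexx ltW.
    apply: (le_trans (wbound_norm hw sT)); rewrite ler_wpM2l ?powR_ge0//; lra.
  have cN : N <= mu / (2 * CL) * (N + mu^-1 * P) + N.
    by rewrite lerDr mulr_ge0//; [rewrite divr_ge0 ?(ltW mu0)// mulr_ge0// ltW|lra].
  have [g1 g2] := HL T00 TT Hreg (fun _ _ => erefl) ci (ile_le HN cN) fb.
  have le : CL * (mu / (2 * CL) * (N + mu^-1 * P) + N) <= 2 * CL * N + P / 2.
    have -> : CL * (mu / (2 * CL) * (N + mu^-1 * P) + N) = mu * N / 2 + P / 2 + CL * N by field; lra.
    have : mu * N <= 1 * N by rewrite ler_wpM2r// ltW.
    have : 1 * N <= CL * N by rewrite ler_wpM2r.
    lra.
  by split; [apply: wbound_le g1|apply: wbound_le g2].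
have H e : 0 < e -> exists2 P, P <= 2 * (2 * CL * N) + e & Q P.
  apply: (@absorb Q (2 * CL * N) (`|M1| + `|M2|)) => //.
  - by rewrite !mulr_ge0//; lra.
  - split; [apply: wbound_le HM2|apply: wbound_le HM1] => //.
      by have := ler_norm M2; have := normr_ge0 M1; lra.
    by have := ler_norm M1; have := normr_ge0 M2; lra.
split=> t tT; apply/ler_addgt0Pr => e /H[P Pe [q1 q2]].
  by apply: (le_trans (q1 t tT)); lra.
by apply: (le_trans (q2 t tT)); lra.
Qed.

End Perturbation.

Section Solutions.
Context {R : realType} {E0 E1 : completeNormedModType R} (j : {linear E1 -> E0}).
Hypothesis jc : continuous j.
Hypothesis ji : injective j.
Variable mu : R.
Hypothesis mu01 : 0 < mu < 1.
Variables (V : set E0) (A : E0 -> {linear E1 -> E0}) (F1 F2 : E0 -> E0).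
Implicit Types (s t h T S d e N P : R) (u du v dv : R -> E0) (w : R -> E1).

Let mu1 : mu < 1. Proof. by case/andP: mu01. Qed.

(** A solution whose derivative and E_1-valued representative are part of the data. *)
Definition nsol T u du w := [/\ reg j mu T u du w, forall t, 0 <= t <= T -> V (u t) &
  forall t, 0 < t <= T -> du t + A (u t) (w t) = F1 (u t) + F2 (u t)].

Lemma solution_nsol T x u : 0 < T -> solution j mu V A F1 F2 T x u <->
  exists du w, nsol T u du w /\ u 0 = x.
Proof.
move=> T0; split=> [[du [w [/(E1mu_reg mu jc _ _ _ T0) h1 h2 h3 h4]]]|[du [w [[h1 h2 h3] h4]]]].
  by exists du, w.
by exists du, w; split=> //; apply/(E1mu_reg mu jc _ _ _ T0).
Qed.

Lemma nsol_restrict T T' u du w : T' <= T -> nsol T u du w -> nsol T' u du w.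
Proof.
move=> TT [h1 h2 h3]; split; first exact: reg_restrict h1.
  by move=> t /andP[t0 tT]; apply: h2; rewrite t0 (le_trans tT).
by move=> t /andP[t0 tT]; apply: h3; rewrite t0 (le_trans tT).
Qed.

(** At positive times the weights are bounded above and below, so a translate of a
    regular function is bounded and continuous, hence regular. *)
Lemma nsol_shift h T u du w : 0 < h -> 0 < T -> nsol (h + T) u du w ->
  nsol T (fun t => u (t + h)) (fun t => du (t + h)) (fun t => w (t + h)).
Proof.
move=> h0 T0 [Hreg HV Heq]; have [ujw Hd [dc [M1 HM1] _] [wc [M2 HM2] _] H0] := Hreg.
have in_ t : 0 < t <= T -> 0 < t + h <= h + T by move=> /andP[? ?]; apply/andP; lra.
have hM (E : normedModType R) (v : R -> E) M t : wbound mu (h + T) v M -> 0 < t <= T -> `|v (t + h)| <= h `^ (mu - 1) * `|M|.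
  move=> Hv tT; have m1 := mu1; apply: (le_trans (wbound_norm Hv (in_ _ tT))).
  apply: (@le_trans _ _ ((t + h) `^ (mu - 1) * `|M|)).
    by rewrite ler_wpM2l ?powR_ge0// ler_norm.
  by rewrite ler_wpM2r// powR_le_basen//; case/andP: tT => *; lra.
split.
- split.
  + by move=> t tT; apply: ujw; exact: in_.
  + by apply: rsd_mono (rsd_shift (h := h) Hd) => t /in_.
  + apply: (@lcont_bounded_wC _ _ _ _ _ (h `^ (mu - 1) * `|M1|)) => // [|t tT]; last exact: hM.
    by apply: lcont_mono (lcont_shift (h := h) dc) => t /in_.
  + apply: (@lcont_bounded_wC _ _ _ _ _ (h `^ (mu - 1) * `|M2|)) => // [|t tT]; last exact: hM.
    by apply: lcont_mono (lcont_shift (h := h) wc) => t /in_.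
  + move=> e e0; have [|d d0 {}Hd] := reg_lcont Hreg (t := h) _ e0.
      by apply/andP; lra.
    exists d => // t /andP[t0 tT] td; rewrite add0r; apply: Hd; first by apply/andP; lra.
    by rewrite addrK gtr0_norm.
- by move=> t /andP[t0 tT]; apply: HV; apply/andP; lra.
- by move=> t tT; apply: Heq; exact: in_.
Qed.

(** The junction time [S] is positive for both pieces.  There [j] being injective
    identifies the E_1-valued representatives, and the equation the derivatives. *)
Lemma nsol_paste h S T u du w v dv wv : 0 < h -> h < S -> S <= h + T ->
  nsol S u du w -> nsol T v dv wv -> v (S - h) = u S ->
  exists dU W, nsol (h + T) (paste S u (fun t => v (t - h))) dU W.
Proof.
move=> h0 hS ST [Hu Vu Eu] [Hv Vv Ev] vu.
have T0 : 0 < T by lra. have S0 : 0 < S by lra.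
have Sin : 0 < S <= S by rewrite S0 lexx. have Shin : 0 < S - h <= T by apply/andP; lra.
have [ujw du_ duC wC_ u0] := Hu; have [vjw dv_ dvC wvC v0] := Hv.
have wE : w S = wv (S - h) by apply: ji; rewrite -ujw// -vjw// vu.
have duE : du S = dv (S - h).
  apply: (@addIr _ (A (u S) (w S))); rewrite Eu// wE -vu Ev//.
exists (paste S du (fun t => dv (t - h))), (paste S w (fun t => wv (t - h))).
have inv t : 0 < t <= h + T -> S <= t -> 0 < t - h <= T by move=> /andP[? ?] ?; apply/andP; lra.
have wCp (E : normedModType R) (f g : R -> E) : wC mu S f -> wC mu T g -> f S = g (S - h) ->
    wC mu (h + T) (paste S f (fun t => g (t - h))).
  move=> [fc [Mf HMf] Vf] [gc [Mg HMg] _] fg; have m1 := mu1; split.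
  - apply: lcont_paste => //.
      by apply: lcont_mono fc => t [/= /andP[-> _] ->].
    by apply: lcont_mono (lcont_shift (h := - h) gc) => t [/inv H /H].
  - exists (`|Mf| + (h + T) `^ (1 - mu) * ((S - h) `^ (mu - 1) * `|Mg|)) => t tT.
    have p0 : 0 <= (h + T) `^ (1 - mu) * ((S - h) `^ (mu - 1) * `|Mg|) by rewrite !mulr_ge0 ?powR_ge0.
    have [tS|/ltW St] := leP t S.
      rewrite paste_l//; have /HMf : 0 < t <= S by case/andP: tT => ->.
      by have := ler_norm Mf; lra.
    rewrite paste_r//; apply: (@le_trans _ _ ((h + T) `^ (1 - mu) * ((S - h) `^ (mu - 1) * `|Mg|))); last by rewrite lerDr.
    have /andP[t0 tT'] := tT; apply: ler_pM; rewrite ?powR_ge0//.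
      by apply: powR_le_base => //; [lra|exact: ltW].
    apply: (le_trans (wbound_norm HMg (inv _ tT St))).
    apply: (@le_trans _ _ ((t - h) `^ (mu - 1) * `|Mg|)).
      by rewrite ler_wpM2l ?powR_ge0// ler_norm.
    by rewrite ler_wpM2r// powR_le_basen//; lra.
  - move=> e e0; have [d d0 Hd] := Vf e e0; exists (Num.min d S); first by rewrite lt_min d0.
    move=> t /andP[t0 _]; rewrite lt_min => /andP[td tS]; rewrite paste_l ?(ltW tS)//.
    by apply: Hd => //; rewrite t0 ltW.
split.
- split.
  + move=> t tT; rewrite /paste; case: (leP t S) => tS.
      by apply: ujw; case/andP: tT => ->.
    by apply: vjw; apply: inv => //; exact: ltW.
  + apply: rsd_paste => //.
      by apply: rsd_mono du_ => t [/= /andP[-> _] ->].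
    by apply: rsd_mono (rsd_shift (h := - h) dv_) => t [/inv H /H].
  + exact: wCp.
  + exact: wCp.
  + move=> e e0; have [d d0 Hd] := u0 e e0; exists (Num.min d S); first by rewrite lt_min d0.
    move=> t /andP[t0 _]; rewrite lt_min => /andP[td tS].
    by rewrite !paste_l ?(ltW tS) ?(ltW S0)//; apply: Hd => //; rewrite t0 ltW.
- move=> t /andP[t0 tT]; rewrite /paste; case: (leP t S) => tS.
    by apply: Vu; rewrite t0.
  by apply: Vv; apply/andP; lra.
- move=> t tT; rewrite /paste; case: (leP t S) => tS.
    by apply: Eu; case/andP: tT => ->.
  by apply: Ev; apply: inv => //; exact: ltW.
Qed.

End Solutions.

(** * Extension to the right end point *)

Section Endpoint.
Context {R : realType} {E : normedModType R}.
Implicit Types (r s t e d : R) (f u du : R -> E) (l : E).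

Definition close_at r f l t := if t < r then f t else l.

Lemma close_at_lt r f l t : t < r -> close_at r f l t = f t.
Proof. by rewrite /close_at => ->. Qed.

Lemma close_at_end r f l : close_at r f l r = l.
Proof. by rewrite /close_at ltxx. Qed.

Definition left_limit r f l := forall e, 0 < e -> exists2 d, 0 < d &
  forall t, 0 < t -> t < r -> r - d < t -> `|f t - l| <= e.

Lemma lcont_close r f l : (forall T, 0 < T -> T < r -> lcont [set t | 0 < t <= T] f) ->
  left_limit r f l -> lcont [set t | 0 < t <= r] (close_at r f l).
Proof.
move=> Hf Hl t /andP[t0 tr] e e0; have [tr'|rt] := ltP t r.
  have T0 : 0 < (t + r) / 2 by lra.
  have Tr : (t + r) / 2 < r by lra.
  have [|d d0 Hd] := Hf _ T0 Tr t _ e e0; first by apply/andP; lra.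
  exists (Num.min d ((r - t) / 2)); first by rewrite lt_min d0 divr_gt0 ?subr_gt0.
  move=> s /andP[s0 sr]; rewrite lt_min [X in _ && X]ltr_norml => /andP[sd /andP[_ s2]].
  by rewrite !close_at_lt//; [apply: Hd => //; apply/andP; lra|lra].
have -> : t = r by lra.
rewrite close_at_end; have [d d0 Hd] := Hl e e0; exists d => // s /andP[s0 sr] sd.
have [sr'|rs] := ltP s r.
  rewrite close_at_lt//; apply: Hd => //; move: sd; rewrite ltr_norml => /andP[? _]; lra.
have -> : s = r by lra.
by rewrite close_at_end subrr normr0 ltW.
Qed.

(** The mean value inequality on [[s, r - y]] with [y] tending to 0 shows that the
    limit of the derivative is the one-sided derivative at [r]. *)
Lemma rsd_close r u du m l : (forall T, 0 < T -> T < r -> rsd [set t | 0 < t <= T] id u du) ->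
  left_limit r u m -> left_limit r du l ->
  rsd [set t | 0 < t <= r] id (close_at r u m) (close_at r du l).
Proof.
move=> Hu Hm Hl t /andP[t0 tr] e e0; have [tr'|rt] := ltP t r.
  have T0 : 0 < (t + r) / 2 by lra.
  have Tr : (t + r) / 2 < r by lra.
  have [|d d0 Hd] := Hu _ T0 Tr t _ e e0; first by apply/andP; lra.
  exists (Num.min d ((r - t) / 2)); first by rewrite lt_min d0 divr_gt0 ?subr_gt0.
  move=> s /andP[s0 sr]; rewrite lt_min [X in _ && X]ltr_norml => /andP[sd /andP[_ s2]].
  by rewrite !close_at_lt//; [apply: Hd => //; apply/andP; lra|lra].
have -> : t = r by lra.
have r0 : 0 < r by lra.
rewrite !close_at_end; have [d d0 Hd] := Hl e e0; exists d => // s /andP[s0 sr] sd /=.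
have [sr'|rs] := ltP s r; last first.
  have -> : s = r by lra.
  by rewrite close_at_end !subrr scale0r subrr !normr0 mulr0.
rewrite close_at_lt//.
have sd' : r - d < s by move: sd; rewrite ltr_norml => /andP[? _]; lra.
have mv s' : s <= s' -> s' < r -> `|(u s' - s' *: l) - (u s - s *: l)| <= e * s' - e * s.
  move=> ss' s'r; have s'0 : 0 < s' by lra.
  apply: (@mean_value R E (fun q => u q - q *: l) (fun q => du q - l) (fun q => e * q : R^o) (fun=> e)) => //.
  - by move=> a b ? ? ?; rewrite ler_wpM2l// ltW.
  - apply: rsdB; first by apply: rsd_mono (Hu s' s'0 s'r) => q /= /andP[? ?]; apply/andP; lra.
    move=> q _ x x0; exists 1 => // p _ _.
    by rewrite /= -scalerBl subrr normr0 mulr_ge0// ltW.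
  - exact: rsd_linear.
  - by move=> q /andP[? ?]; apply: Hd; lra.
rewrite ltr0_norm ?subr_lt0// opprB; apply/ler_addgt0Pr => x x0.
have x2 : 0 < x / 2 by lra.
have [d2 d20 H2] := Hm _ x2.
have k1 : 0 < `|l| + 1 by rewrite ltr_wpDl.
pose y := Num.min (d2 / 2) (Num.min ((r - s) / 2) (x / 2 / (`|l| + 1))).
have y0 : 0 < y by rewrite !lt_min !divr_gt0// subr_gt0.
have yd2 : y <= d2 / 2 by rewrite ge_min lexx.
have yrs : y <= (r - s) / 2 by rewrite !ge_min lexx !orbT.
have yl : y * (`|l| + 1) <= x / 2 by rewrite -ler_pdivlMr// !ge_min lexx !orbT.
have s'1 : 0 < r - y by lra.
have s'2 : r - y < r by lra.
have s'3 : r - d2 < r - y by lra.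
have s'4 : s <= r - y by lra.
have h1 := mv _ s'4 s'2; have h2 := H2 _ s'1 s'2 s'3.
have -> : u s - m - (s - r) *: l = (u (r - y) - m) - ((u (r - y) - (r - y) *: l) - (u s - s *: l)) + y *: l by lmod_eq R.
apply: (le_trans (ler_normD _ _)); rewrite normrZ gtr0_norm//.
apply: (le_trans (lerD (ler_normB _ _) (lexx _))).
have : e * (r - y) <= e * r by rewrite ler_wpM2l ?(ltW e0)//; lra.
lra.
Qed.

Lemma wC_close mu r f l M : 0 < r -> mu < 1 ->
  (forall T, 0 < T -> T < r -> wC mu T f /\ wbound mu T f M) -> left_limit r f l ->
  wC mu r (close_at r f l).
Proof.
move=> r0 mu1 Hf Hl; split.
- by apply: lcont_close => // T T0 Tr; have [[]] := Hf T T0 Tr.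
- exists (`|M| + r `^ (1 - mu) * `|l|) => t /andP[t0 tr].
  have p0 : 0 <= r `^ (1 - mu) * `|l| by rewrite mulr_ge0// powR_ge0.
  have [tr'|rt] := ltP t r; last first.
    have -> : t = r by lra.
    by rewrite close_at_end lerDr.
  rewrite close_at_lt//; have [_ /(_ t)] := Hf t t0 tr'; rewrite t0 lexx => /(_ isT).
  by have := ler_norm M; lra.
- have T0 : 0 < r / 2 by lra.
  have Tr : r / 2 < r by lra.
  have [[_ _ V] _] := Hf _ T0 Tr; move=> e e0; have [d d0 Hd] := V e e0.
  exists (Num.min d (r / 2)); first by rewrite lt_min d0.
  move=> t /andP[t0 tr]; rewrite lt_min => /andP[td tr2].
  by rewrite close_at_lt; [apply: Hd => //; rewrite t0 ltW|lra].
Qed.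

End Endpoint.

(** * Dynamics near the equilibrium *)

(** The step of a continuity argument: a bound [P / 2] up to [r] and oscillations of at
    most [P / 4] about [phi(c)], on both sides of [c], give the bound [P] up to [s]. *)
Lemma small_oscillation (R : realType) (phi : R -> R) r s c e P T :
  0 < r -> r <= c -> c <= s -> s <= T -> c - e < r -> s < c + e -> 0 <= P ->
  (forall t, 0 < t <= r -> phi t <= P / 2) ->
  (forall t, 0 < t <= T -> `|t - c| < e -> `|phi t - phi c| <= P / 4) ->
  forall t, 0 < t <= s -> phi t <= P.
Proof.
move=> r0 rc cs sT ce1 ce2 P0 hr osc t /andP[t0 ts]; have [tr|rt] := leP t r.
  by have := hr t; rewrite t0 tr => /(_ isT); lra.
have h1 : `|t - c| < e by rewrite ltr_norml; apply/andP; lra.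
have h2 : `|r - c| < e by rewrite ltr_norml; apply/andP; lra.
have h3 : 0 < t <= T by apply/andP; lra.
have h4 : 0 < r <= T by apply/andP; lra.
have h5 : 0 < r <= r by rewrite r0 lexx.
have := osc t h3 h1; have := osc r h4 h2; have := hr r h5.
by rewrite !ler_norml => g1 /andP[g2 _] /andP[_ g3]; lra.
Qed.

Section Dynamics.
Context {R : realType} {E0 E1 : completeNormedModType R} (j : {linear E1 -> E0}).
Hypothesis jc : continuous j.
Hypothesis ji : injective j.
Variable mu : R.
Hypothesis mu01 : 0 < mu < 1.
Variables (V : set E0) (A : E0 -> {linear E1 -> E0}) (F1 F2 : E0 -> E0) (us : E1).
Hypothesis Vci : V `<=` cont_interp j mu.
Hypothesis hVus : V (j us).
Hypothesis hus : equilibrium j A F1 F2 us.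
Hypothesis Bc : continuous (A (j us)).
(* [CL] is the constant of the linear bound on intervals shorter than [T0]; [M] and
   [tau] bound the distance to the equilibrium and the time for which [G] has the
   small Lipschitz constant [mu / (2 CL)]. *)
Variables (T0 CL M tau : R).
Hypothesis constants : [/\ 1 <= CL, 0 < M, 0 < tau, tau <= T0 & tau <= 1].
Hypothesis HL : forall T u du w f N, 0 < T -> T <= T0 -> reg j mu T u du w ->
  (forall t, 0 < t <= T -> du t + A (j us) (w t) = f t) -> cont_interp j mu (u 0) ->
  ile j mu (u 0) N -> wbound mu T f N ->
  wbound mu T w (CL * N) /\ wbound mu T du (CL * N).
Hypothesis HV : forall w, ile j mu (j w - j us) M -> V (j w).
Hypothesis HG : forall s w1 w2 P, 0 < s <= tau ->
   ile j mu (j w1 - j us) M -> ile j mu (j w2 - j us) M ->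
   `|w1 - us| <= s `^ (mu - 1) * M -> `|w2 - us| <= s `^ (mu - 1) * M ->
   ile j mu (j w1 - j w2) P -> `|w1 - w2| <= s `^ (mu - 1) * P ->
   s `^ (1 - mu) * `|frozen j A F1 F2 us w1 - frozen j A F1 F2 us w2| <= mu / (2 * CL) * P.

Implicit Types (s t h T S d e N P : R) (u du v dv : R -> E0) (w : R -> E1).
Local Notation G := (frozen j A F1 F2 us).
Local Notation B := (A (j us)).
Local Notation sol := (nsol j mu V A F1 F2).
Local Notation K := (4 * CL).

Let mu01' : 0 <= mu <= 1. Proof. by case/andP: mu01 => h1 h2; rewrite !ltW. Qed.

Lemma frozen_eq u du w T t : sol T u du w -> 0 < t <= T -> du t + B (w t) = G (w t).
Proof.
move=> [[ujw _ _ _ _] _ Eq] tT; rewrite /frozen -ujw//.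
have -> : F1 (u t) = du t + A (u t) (w t) - F2 (u t) by rewrite Eq// addrK.
by lmod_eq R.
Qed.

Lemma frozen_us : G us = B us.
Proof. by rewrite /frozen subrr add0r -hus. Qed.

Lemma nsol_us T : sol T (fun=> j us) (fun=> 0) (fun=> us).
Proof.
have [CL1 M0 tau0 tauT tau1] := constants; have /andP[mu0 mu1] := mu01.
have muV : 1 <= mu^-1 by rewrite invf_ge1 ?(ltW mu1).
split=> //; first exact: reg_cst.
by move=> t _; rewrite add0r; exact: hus.
Qed.

(** The region in which the Lipschitz estimate of [G] holds. *)
Definition confined T u w := forall s, 0 < s <= T ->
  ile j mu (u s - j us) M /\ `|w s - us| <= s `^ (mu - 1) * M.

(** The difference solves a linear problem with right-hand side [G(w1) - G(w2)], to
    which [perturbed_regularity] applies. *)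
Lemma solution_lipschitz T u1 du1 w1 u2 du2 w2 N : 0 < T -> T <= tau ->
  sol T u1 du1 w1 -> sol T u2 du2 w2 -> confined T u1 w1 -> confined T u2 w2 ->
  ile j mu (u1 0 - u2 0) N ->
  wbound mu T (fun t => w1 t - w2 t) (K * N) /\ wbound mu T (fun t => du1 t - du2 t) (K * N).
Proof.
have [CL1 M0 tau0 tauT tau1] := constants; have /andP[mu0 mu1] := mu01.
have muV : 1 <= mu^-1 by rewrite invf_ge1 ?(ltW mu1).
move=> Tp Tt H1 H2 C1 C2 HN; have [r1 V1 _] := H1; have [r2 V2 _] := H2.
have [uj1 _ _ _ _] := r1; have [uj2 _ _ _ _] := r2.
have i0 : (0 : R) <= 0 <= T by rewrite lexx ltW.
apply: (perturbed_regularity mu01 CL1 HL Tp (le_trans Tt tauT) (regB r1 r2)) => //.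
  by apply: ciB => //; apply: Vci; [exact: V1|exact: V2].
move=> P P0 hw hdu s sT HP Hw; apply: (@le_trans _ _ (mu / (2 * CL) * (N + mu^-1 * P))); last first.
  by rewrite lerDl; exact: ile_ge0 HN.
have -> : du1 s - du2 s + B (w1 s - w2 s) = G (w1 s) - G (w2 s).
  by rewrite -(frozen_eq H1 sT) -(frozen_eq H2 sT) linearB; lmod_eq R.
have [c1 c1'] := C1 s sT; have [c2 c2'] := C2 s sT.
apply: HG; rewrite -?uj1 -?uj2//.
by case/andP: sT => -> /le_trans; apply.
Qed.

Lemma confined_us T : confined T (fun=> j us) (fun=> us).
Proof.
have [CL1 M0 tau0 tauT tau1] := constants; have /andP[mu0 mu1] := mu01.
have muV : 1 <= mu^-1 by rewrite invf_ge1 ?(ltW mu1).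
move=> s _; rewrite !subrr normr0; split; first by apply: ile0; exact: ltW.
by rewrite mulr_ge0 ?powR_ge0// ltW.
Qed.

(** Ensures that the bounds derived from an initial distance [N] use up only part of
    the radius [M]. *)
Definition small_start N := N * (1 + mu^-1 * K) <= M / 4.

(** While the weighted norms are at most [P] the solution is confined, so they are in
    fact at most [K N <= P / 2]; by continuity they never reach [P].  Real induction
    starts at a positive time, for the weighted norms tend to 0 at time 0. *)
Lemma confinement T u du w N : 0 < T -> T <= tau -> sol T u du w ->
  ile j mu (u 0 - j us) N -> small_start N -> confined T u w /\
  wbound mu T (fun t => w t - us) (K * N) /\ wbound mu T du (K * N).
Proof.
have [CL1 M0 tau0 tauT tau1] := constants; have /andP[mu0 mu1] := mu01.
have muV : 1 <= mu^-1 by rewrite invf_ge1 ?(ltW mu1).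
move=> Tp Tt H HN sN; have [Hreg HVu _] := H; have [ujw _ duC wC_ _] := Hreg.
have N0 := ile_ge0 HN.
(* The trace estimate turns [P] into [mu^-1 P = M / 2], which together with
   [N <= M / 2] stays within [M]. *)
pose P := mu * M / 2.
have P0 : 0 < P by rewrite /P divr_gt0// mulr_gt0.
have KN0 : 0 <= K * N by rewrite mulr_ge0//; lra.
have KN : K * N <= P / 2.
  have : N * (mu^-1 * K) <= M / 4 by move: sN; rewrite /small_start mulrDr mulr1; lra.
  rewrite mulrCA -ler_pdivlMl ?invr_gt0// invrK /P; lra.
have NM : N <= M / 2.
  move: sN; rewrite /small_start mulrDr mulr1; have : 0 <= N * (mu^-1 * K) by rewrite !mulr_ge0//; lra.
  lra.
have PM : P <= M.
  have : mu * M <= 1 * M by rewrite ler_wpM2r//; lra.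
  by rewrite /P; lra.
pose wd t := w t - us.
have rd : reg j mu T (fun t => u t - j us) du wd.
  have := regB Hreg (reg_cst j T us mu1).
  by rewrite (_ : (fun t => du t - 0) = du)//; apply/funext => t; rewrite subr0.
have [_ _ _ wdC _] := rd.
have conf S : S <= T -> wbound mu S wd P -> wbound mu S du P -> confined S u w.
  move=> ST b1 b2 s sS; split; last first.
    by apply: (le_trans (wbound_norm b1 sS)); rewrite ler_wpM2l ?powR_ge0.
  have mm : mu <= mu <= 1 by rewrite lexx ltW.
  have := reg_trace mu01 (ltW P0) (reg_restrict ST rd) b1 b2 mm HN sS.
  rewrite subrr powRr0 mul1r => h; apply: ile_le h _.
  have -> : mu^-1 * P = M / 2 by rewrite /P; field; lra.
  lra.
have improve S : 0 < S -> S <= T -> wbound mu S wd P -> wbound mu S du P ->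
   [/\ confined S u w, wbound mu S wd (K * N) & wbound mu S du (K * N)].
  move=> S0 ST b1 b2; have C := conf S ST b1 b2.
  have [h1 h2] := solution_lipschitz S0 (le_trans ST Tt) (nsol_restrict ST H) (nsol_us S) C (@confined_us S) HN.
  split=> //; apply: wbound_eq h2 => t _; exact: subr0.
suff [b1 b2] : wbound mu T wd P /\ wbound mu T du P by have [] := improve T Tp (lexx T) b1 b2.
have [duc _ Vd] := duC; have [wdc _ Vw] := wdC.
have [d1 d10 H1] := Vd P P0; have [d2 d20 H2] := Vw P P0.
have [a [a0 aT ad1 ad2]] : exists a, [/\ 0 < a, a <= T, a < d1 & a < d2].
  exists (Num.min T (Num.min (d1 / 2) (d2 / 2))); split.
  - by rewrite !lt_min Tp !divr_gt0.
  - by rewrite ge_min lexx.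
  - by rewrite !gt_min; apply/orP; right; apply/orP; left; lra.
  - by rewrite !gt_min; apply/orP; right; apply/orP; right; lra.
have weight (F : completeNormedModType R) (f : R -> F) c : lcont [set t | 0 < t <= T] f -> 0 < c <= T ->
  exists2 d, 0 < d & forall t, 0 < t <= T -> `|t - c| < d ->
    `|t `^ (1 - mu) * `|f t| - c `^ (1 - mu) * `|f c| | <= P / 4.
  move=> fc cT; have lc : lcont [set t | 0 < t <= T] (fun t => t `^ (1 - mu) *: f t).
    by apply: lcont_scale => //; apply: lcont_mono (powR_is_lcont _) => t /andP[].
  have [|d d0 Hd] := lc c cT (P / 4); first by rewrite divr_gt0.
  exists d => // t tT td; apply: le_trans (Hd t tT td).
  have nrm r (x : F) : r `^ (1 - mu) * `|x| = `|r `^ (1 - mu) *: x|.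
    by rewrite normrZ ger0_norm// powR_ge0.
  by rewrite !nrm; exact: ler_dist_dist.
apply: (@real_ind R (fun c => wbound mu c wd P /\ wbound mu c du P) a T) => //.
  by split=> t /andP[t0 ta]; [apply: H2|apply: H1]; rewrite ?t0 ?(le_trans ta)// (le_lt_trans ta).
move=> c /andP[ac cT]; have cT' : 0 < c <= T by apply/andP; lra.
have [e1 e10 G1] := weight _ _ c wdc cT'; have [e2 e20 G2] := weight _ _ c duc cT'.
exists (Num.min e1 e2); first by rewrite lt_min e10.
move=> r s /andP[ar rc] /andP[cs sT] cr sc [b1 b2].
have [e1m e2m] : Num.min e1 e2 <= e1 /\ Num.min e1 e2 <= e2 by rewrite !ge_min !lexx orbT.
have r0 : 0 < r by lra.
have [_ k1 k2] := improve r r0 (le_trans rc cT) b1 b2.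
have s1 : c - e1 < r by lra.
have s2 : s < c + e1 by lra.
have s3 : c - e2 < r by lra.
have s4 : s < c + e2 by lra.
split.
  by apply: (small_oscillation r0 rc cs sT s1 s2 (ltW P0) _ G1) => t tr; exact: le_trans (k1 t tr) KN.
by apply: (small_oscillation r0 rc cs sT s3 s4 (ltW P0) _ G2) => t tr; exact: le_trans (k2 t tr) KN.
Qed.

(** The E_mu bound and the weighted E_1 bound of [confinement], interpolated. *)
Lemma smoothing T u du w N theta t : 0 < T -> T <= tau -> sol T u du w ->
  ile j mu (u 0 - j us) N -> small_start N -> mu <= theta <= 1 -> 0 < t <= T ->
  ile j theta (u t - j us) (t `^ (mu - theta) * ((1 + mu^-1 * K) * N)).
Proof.
have [CL1 M0 tau0 tauT tau1] := constants; have /andP[mu0 mu1] := mu01.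
have muV : 1 <= mu^-1 by rewrite invf_ge1 ?(ltW mu1).
move=> Tp Tt H HN sN th tT; have [_ [b1 b2]] := confinement Tp Tt H HN sN.
have N0 := ile_ge0 HN.
have [Hreg _ _] := H; have [ujw _ _ _ _] := Hreg; have /andP[t0 _] := tT.
have KN0 : 0 <= K * N by rewrite mulr_ge0//; lra.
have rd : reg j mu T (fun t => u t - j us) du (fun t => w t - us).
  have := regB Hreg (reg_cst j T us mu1).
  by rewrite (_ : (fun t => du t - 0) = du)//; apply/funext => r; rewrite subr0.
have mm : mu <= mu <= 1 by rewrite lexx ltW// mu1.
have := reg_trace mu01 KN0 rd b1 b2 mm HN tT.
rewrite subrr powRr0 mul1r ujw// -linearB => h.
apply: ile_weighted => //; first by apply: (ile_le h); rewrite [leRHS](_ : _ = N + mu^-1 * (K * N))//; ring.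
apply: (le_trans (wbound_norm b1 tT)); rewrite ler_wpM2l ?powR_ge0// ler_wpM2r//.
have : K <= mu^-1 * K by rewrite ler_peMl//; lra.
lra.
Qed.

(** For a fixed [t], the solution is compared on [[0, t]] with the constant [us + b],
    where [u(0) - us = a + b] is the decomposition of [ile_decomp] at [t].  The part
    [a] is of size [t^(nu-mu) N] in E_mu, and so are, in weighted norm, the constant [b]
    and the residual of [us + b] in the equation.  The regularity bound is thus of
    order [t^(nu-mu) N], and the factor [t^(mu-nu)] of the trace estimate cancels it. *)
Lemma persistence nu Kl Ml c : mu <= nu < 1 -> 0 < Kl -> 0 < Ml -> 1 <= c ->
  (forall x N, ile j nu x N -> ile j mu x (c * N)) ->
  (forall b N, 0 < N -> ile j nu (j b) N -> N <= Ml -> `|G (us + b) - G us| <= Kl * N * (1 + `|b|)) ->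
  exists K2 d1, [/\ 0 < K2, 0 < d1 & forall T u du w N, 0 < T -> T <= tau -> sol T u du w ->
    0 < N -> N <= d1 -> ile j nu (u 0 - j us) N ->
    forall t, 0 < t <= T -> ile j nu (u t - j us) (K2 * N)].
Proof.
have [CL1 M0 tau0 tauT tau1] := constants; have /andP[mu0 mu1] := mu01.
have muV : 1 <= mu^-1 by rewrite invf_ge1 ?(ltW mu1).
move=> /andP[munu nu1] Kl0 Ml0 cge1 Hc Hlip.
have [CB CB1 HCB] := bounded_lin Bc.
have CB0 : 0 <= CB by lra.
have cl0 : 0 < CL by lra.
have [K3 [K3a K3b]] : exists K3, 3 <= K3 /\ 12 * Kl + 2 * CB <= K3.
  by exists (3 + 12 * Kl + 2 * CB); lra.
have K30 : 0 < K3 by lra.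
pose K2 := 1 + mu^-1 * (K * K3 + 2).
have K20 : 0 < K2.
  have : 0 < mu^-1 * (K * K3 + 2) by rewrite mulr_gt0 ?invr_gt0// ltr_wpDl// !mulr_ge0//; lra.
  by rewrite /K2; lra.
have k10 : 0 < 1 + mu^-1 * K.
  by have : 0 < mu^-1 * K by [rewrite mulr_gt0 ?invr_gt0//; lra]; lra.
have [d1 [d10 [da db dc dd de]]] : exists d1, 0 < d1 /\ [/\ small_start (c * d1), 4 * d1 <= Ml, (c + 3) * d1 <= M,
    2 * d1 <= M & d1 <= 1].
  have c0 : 0 < c by lra.
  pose q1 := M / 4 / (c * (1 + mu^-1 * K)); pose q2 := Ml / 4; pose q3 := M / (c + 3).
  have q10 : 0 < q1 by rewrite !divr_gt0// mulr_gt0.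
  have q20 : 0 < q2 by rewrite divr_gt0.
  have q30 : 0 < q3 by rewrite divr_gt0//; lra.
  have [d [d0 h1 h2 h3 h4]] : exists d, [/\ 0 < d, d <= q1, d <= q2, d <= q3 & d <= 1].
    exists (Num.min q1 (Num.min q2 (Num.min q3 1))).
    by rewrite !lt_min q10 q20 q30 ltr01 !ge_min !lexx !orbT.
  exists d; split=> //; split=> //.
  - rewrite /small_start; move: h1; rewrite /q1 ler_pdivlMr ?mulr_gt0//; forget; lra.
  - by move: h2; rewrite /q2; forget; lra.
  - by move: h3; rewrite /q3 ler_pdivlMr//; move: c0; forget; lra.
  - move: h3; rewrite /q3 ler_pdivlMr; last by lra.
    have : 0 <= c * d by rewrite mulr_ge0// ltW.
    move: c0 d0; forget; lra.
exists K2, d1; split=> // T u du w N Tp Tt H N0 Nd HN t tT.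
have /andP[t0 tT'] := tT; have Ht := nsol_restrict tT' H; have ttau := le_trans tT' Tt.
have t1 : t <= 1 := le_trans ttau tau1.
have cN : c * N <= c * d1 by rewrite ler_wpM2l// (le_trans _ cge1).
have HNmu : ile j mu (u 0 - j us) (c * N) by exact: Hc.
have sN : small_start (c * N).
  move: da; rewrite /small_start; apply: le_trans; rewrite ler_wpM2r//; exact: ltW.
have [conf _] := confinement t0 ttau Ht HNmu sN.
have th : mu <= nu <= 1 by rewrite munu ltW.
have [a [b [zab amu anu bN]]] := ile_decomp mu01 th t0 HN N0.
have ts0 : 0 < t `^ (nu - mu) by exact: powR_gt0.
have ts1 : t `^ (nu - mu) <= 1 by apply: powR_le1; [rewrite subr_ge0|rewrite t0].
have tb : t `^ (1 - mu) * `|b| <= 2 * (t `^ (nu - mu) * N).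
  have e1 : 1 - mu + (nu - 1) = nu - mu by ring.
  rewrite -(powR_split t0 e1).
  apply: (le_trans (ler_wpM2l (powR_ge0 _ _) bN)).
  by rewrite le_eqVlt; apply/orP; left; apply/eqP; ring.
have tsN : t `^ (nu - mu) * N <= N by rewrite ger_pMl.
have tsN0 : 0 < t `^ (nu - mu) * N by rewrite mulr_gt0.
have sb s : 0 < s <= t -> s `^ (1 - mu) * `|b| <= 2 * (t `^ (nu - mu) * N).
  move=> /andP[s0 st]; apply: le_trans tb; rewrite ler_wpM2r// powR_le_base//; [rewrite subr_ge0 ltW//|exact: ltW].
have jbE : j (us + b) - j us = j b by rewrite linearD addrAC subrr add0r.
have bmu : ile j mu (j b) M.
  have -> : j b = (u 0 - j us) - a by rewrite zab addrAC subrr add0r.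
  apply: (ile_le (ileB HNmu amu)).
  have : 3 * t `^ (nu - mu) * N <= 3 * N by rewrite -mulrA ler_wpM2l.
  move: dc cN Nd; rewrite mulrDl; forget; lra.
have bnu : ile j nu (j b) (4 * N).
  have -> : j b = (u 0 - j us) - a by rewrite zab addrAC subrr add0r.
  by apply: (ile_le (ileB HN anu)); forget; lra.
have bM s : 0 < s <= t -> `|us + b - us| <= s `^ (mu - 1) * M.
  move=> st; have /andP[s0 _] := st; have -> : us + b - us = b by rewrite addrAC subrr add0r.
  rewrite -[mu - 1]opprB powRN mulrC ler_pdivlMr ?powR_gt0// mulrC.
  by apply: (le_trans (sb s st)); move: tsN Nd dd; forget; lra.
have [Hreg HVu _] := Ht; have [ujw _ _ _ _] := Hreg.
have rd := regB Hreg (reg_cst j t (us + b) mu1).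
have N40 : 0 < 4 * N by rewrite mulr_gt0.
have N4 : 4 * N <= Ml by move: Nd db; forget; lra.
have glip := Hlip b (4 * N) N40 bnu N4.
have i0 : (0 : R) <= 0 <= t by rewrite lexx ltW.
have d0E : u 0 - j (us + b) = a.
  by rewrite linearD opprD addrA zab addrK.
(* The residual of [us + b]: the weights [s^(1-mu)] and [s^(1-mu) |b|] are both
   of order [t^(nu-mu)] since [s <= t <= 1]. *)
have resid s : 0 < s <= t -> s `^ (1 - mu) * (`|G (us + b) - G us| + `|B b|) <= t `^ (nu - mu) * N * K3.
  move=> st; have /andP[s0 st'] := st.
  have x1 : s `^ (1 - mu) <= t `^ (nu - mu).
    apply: (@le_trans _ _ (t `^ (1 - mu))); first by apply: powR_le_base => //; [rewrite subr_ge0 ltW//|exact: ltW].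
    by apply: ger_powR; [rewrite t0|move: nu1; forget; lra].
  have x2 := sb s st.
  have x3 : s `^ (1 - mu) * `|G (us + b) - G us| <= 12 * Kl * (t `^ (nu - mu) * N).
    apply: (le_trans (ler_wpM2l (powR_ge0 _ _) glip)).
    rewrite [leLHS](_ : _ = 4 * Kl * N * (s `^ (1 - mu) + s `^ (1 - mu) * `|b|)); last by ring.
    have KN0 : 0 <= 4 * Kl * N by rewrite !mulr_ge0// ltW.
    have : s `^ (1 - mu) + s `^ (1 - mu) * `|b| <= 3 * t `^ (nu - mu).
      have : t `^ (nu - mu) * N <= t `^ (nu - mu) by rewrite ger_pMr//; exact: le_trans Nd de.
      move: x1 x2; forget; lra.
    move=> /(ler_wpM2l KN0); forget; lra.
  have x4 : s `^ (1 - mu) * `|B b| <= 2 * CB * (t `^ (nu - mu) * N).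
    apply: (le_trans (ler_wpM2l (powR_ge0 _ _) (HCB b))).
    rewrite mulrCA; have := ler_wpM2l CB0 x2; forget; lra.
  rewrite mulrDr; have := ler_wpM2l (ltW tsN0) K3b; move: x3 x4; forget; lra.
pose N' := t `^ (nu - mu) * N * K3.
have N'3 : 3 * t `^ (nu - mu) * N <= N'.
  have := ler_wpM2l (ltW tsN0) K3a; rewrite /N'; forget; lra.
have [h1 h2] : wbound mu t (fun r => w r - (us + b)) (K * N') /\ wbound mu t (fun r => du r - 0) (K * N').
  apply: (perturbed_regularity mu01 CL1 HL t0 (le_trans ttau tauT) rd).
  - apply: ciB => //; [exact/Vci/HVu|exact: ci_j].
  - by rewrite d0E; exact: ile_le amu N'3.
  move=> P P0 hw hdu s sT HP Hw.
  have -> : du s - 0 + B (w s - (us + b)) = (G (w s) - G (us + b)) + ((G (us + b) - G us) - B b).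
    rewrite -(frozen_eq Ht sT) frozen_us linearB linearD; lmod_eq R.
  apply: (@le_trans _ _ (s `^ (1 - mu) * (`|G (w s) - G (us + b)| + (`|G (us + b) - G us| + `|B b|)))).
    rewrite ler_wpM2l ?powR_ge0//; apply: (le_trans (ler_normD _ _)); rewrite lerD2l; exact: ler_normB.
  rewrite mulrDr; apply: lerD; last exact: resid.
  have [q1 q2] := conf s sT.
  apply: HG => //.
  - by case/andP: sT => -> /le_trans; apply.
  - by rewrite -ujw.
  - by rewrite jbE.
  - exact: bM.
  - by rewrite -ujw.
have rz := regB Hreg (reg_cst j t us mu1).
have K0 : 0 <= K by rewrite mulr_ge0// ltW.
have N'0 : 0 <= N' by rewrite /N' mulr_ge0// ltW.
have KN'0 : 0 <= K * N' := mulr_ge0 K0 N'0.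
pose P := K * N' + 2 * (t `^ (nu - mu) * N).
have P0 : 0 <= P by rewrite /P; move: tsN0 KN'0; forget; lra.
have z1 : wbound mu t (fun r => w r - us) P.
  move=> r rt; apply: (@le_trans _ _ (r `^ (1 - mu) * (`|w r - (us + b)| + `|b|))).
    rewrite ler_wpM2l ?powR_ge0//; have -> : w r - us = (w r - (us + b)) + b by lmod_eq R.
    exact: ler_normD.
  by rewrite mulrDr; apply: lerD; [exact: h1|exact: sb].
have z2 : wbound mu t (fun r => du r - 0) P.
  by apply: wbound_le h2 => //; rewrite /P; move: tsN0; forget; lra.
have tt : 0 < t <= t by rewrite t0 lexx.
have := reg_trace mu01 P0 rz z1 z2 th HN tt => hh; apply: (ile_le hh).
have e2 : mu - nu + (nu - mu) = 0 by ring.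
have E2 : t `^ (mu - nu) * t `^ (nu - mu) = 1 by rewrite (powR_split t0 e2) powRr0.
rewrite [leLHS](_ : _ = N + mu^-1 * ((t `^ (mu - nu) * t `^ (nu - mu)) * (K * K3 + 2) * N)); last by rewrite /P /N'; ring.
by rewrite E2 le_eqVlt; apply/orP; left; apply/eqP; rewrite /K2; ring.
Qed.

(** A translate of the solution by [h] starts within a small distance of it in E_mu, as
    the solution is continuous at time 0 in E_mu; by [solution_lipschitz] it stays
    close in E_1 for times in [[r / 2, r[].  So the solution is Cauchy in E_1 at [r].
    The limit still satisfies the bounds of confinement, hence [G] is continuous there
    and the derivative converges as well. *)
Lemma solution_closes r u N : 0 < r -> r <= tau ->
  (forall T, 0 < T -> T < r -> exists du w, sol T u du w) ->
  ile j mu (u 0 - j us) N -> small_start N -> small_start ((1 + mu^-1 * K) * N) ->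
  exists U dU W, sol r U dU W /\ forall t, 0 <= t -> t < r -> U t = u t.
Proof.
have [CL1 M0 tau0 tauT tau1] := constants; have /andP[mu0 mu1] := mu01.
have muV : 1 <= mu^-1 by rewrite invf_ge1 ?(ltW mu1).
move=> r0 rtau Hex HN sN sN'.
have cl0 : 0 < CL by lra.
have N0 := ile_ge0 HN.
have [Cj Cj1 HCj] := ile_j jc; have [CB CB1 HCB] := bounded_lin Bc; have [Cn Cn1 HCn] := bounded_lin jc.
have K0 : 0 < K by rewrite mulr_gt0.
(* The solutions on the intervals [[0, T]] with [T < r] agree, [j] being injective;
   [w] and [du] are their common representatives. *)
have Hw t : exists b, 0 < t -> t < r -> u t = j b.
  have [[t0 tr]|nt] := pselect (0 < t /\ t < r); last by exists 0 => t0 tr; case: nt.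
  have [du [w [[ujw _ _ _ _] _ _]]] := Hex t t0 tr.
  by exists (w t) => _ _; apply: ujw; rewrite t0 lexx.
have /choice[w {}Hw] := Hw.
pose du t := F1 (u t) + F2 (u t) - A (u t) (w t).
have HS T : 0 < T -> T < r -> sol T u du w.
  move=> T0' Tr; have [du' [w' [Hreg HVu Heq]]] := Hex T T0' Tr.
  have wE t : 0 < t <= T -> w' t = w t.
    move=> /andP[t0 tT]; apply: ji; rewrite -Hw//; last exact: le_lt_trans Tr.
    by have [<-] := Hreg; rewrite ?t0.
  have duE t : 0 < t <= T -> du' t = du t.
    by move=> tT; rewrite /du -Heq// wE// addrK.
  split=> //; first exact: (reg_eq _ duE wE (ltW T0') Hreg).
  by move=> t tT; rewrite -duE// -wE// Heq.
have conf T : 0 < T -> T < r -> [/\ confined T u w, wbound mu T (fun t => w t - us) (K * N) & wbound mu T du (K * N)].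
  move=> T0' Tr; have := confinement T0' (ltW (lt_le_trans Tr rtau)) (HS T T0' Tr) HN sN.
  by case=> h1 [h2 h3].
have smallness t : 0 < t -> t < r -> ile j mu (u t - j us) ((1 + mu^-1 * K) * N).
  move=> t0 tr; have mm : mu <= mu <= 1 by rewrite lexx ltW.
  have tt : 0 < t <= t by rewrite t0 lexx.
  have := smoothing t0 (ltW (lt_le_trans tr rtau)) (HS t t0 tr) HN sN mm tt.
  by rewrite subrr powRr0 mul1r.
have rh0 : 0 < r / 2 by rewrite divr_gt0.
have rhr : r / 2 < r by lra.
have cont e : 0 < e -> exists2 d, 0 < d & forall h, 0 < h -> h < r -> h < d -> ile j mu (u h - u 0) e.
  move=> e0; have mV : 1 <= mu^-1 := muV.
  have P0 : 0 < e / (2 * mu^-1 + 2) by rewrite divr_gt0//; lra.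
  have [[ujw Hd [_ _ V1] [_ _ V2] c0] _ _] := HS _ rh0 rhr.
  have [d1 d10 H1] := V1 _ P0; have [d2 d20 H2] := V2 _ P0.
  exists (Num.min (r / 2) (Num.min d1 d2)); first by rewrite !lt_min rh0 d10.
  move=> h h0 hr; rewrite !lt_min => /and3P[hr2 hd1 hd2].
  have sub q : 0 < q <= h -> 0 < q <= r / 2 by move=> /andP[-> qh]; rewrite (le_trans qh)// ltW.
  have b1 : wbound mu h du (e / (2 * mu^-1 + 2)).
    by move=> q qh; apply: H1; [exact: sub|case/andP: qh => _ /le_lt_trans; apply].
  have b2 : wbound mu h w (e / (2 * mu^-1 + 2)).
    by move=> q qh; apply: H2; [exact: sub|case/andP: qh => _ /le_lt_trans; apply].
  have [_ Hdh _ _ c0h] := reg_restrict (ltW hr2) (let: And3 x _ _ := HS _ rh0 rhr in x).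
  have := @ile_trace_diff R E0 E1 j mu mu01 h mu^-1 u w (e / (2 * mu^-1 + 2)) h0 mV.
  rewrite (_ : (2 * mu^-1 + 2) * (e / (2 * mu^-1 + 2)) = e); last by rewrite mulrC divfK// gt_eqF//; move: muV; forget; lra.
  apply=> q qh; split.
  - by apply: ujw; exact: sub.
  - exact: (weighted_mean_value mu0 (ltW P0) Hdh b1 c0h qh).
  - exact: wbound_norm b2 qh.
have shift_bound e : 0 < e -> exists2 d, 0 < d & forall h t, 0 < h -> h < d -> 0 < t -> t + h < r ->
    t `^ (1 - mu) * `|w (t + h) - w t| <= K * e.
  move=> e0; have [d d0 Hd] := cont e e0; exists d => // h t h0 hd t0 thr.
  have hr : h < r by move: thr t0; forget; lra.
  have tr : t < r by move: thr h0; forget; lra.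
  have ht0 : 0 < h + t := addr_gt0 h0 t0.
  have htr : h + t < r by move: thr; forget; lra.
  have S1 := nsol_shift mu01 h0 t0 (HS _ ht0 htr).
  have ttau : t <= tau by move: tr rtau; forget; lra.
  have i1 : ile j mu (u (0 + h) - j us) ((1 + mu^-1 * K) * N) by rewrite add0r; exact: smallness.
  have [C1 _] := confinement t0 ttau S1 i1 sN'.
  have [C2 _ _] := conf t t0 tr.
  have i2 : ile j mu (u (0 + h) - u 0) e by rewrite add0r; exact: Hd.
  have [b1 _] := solution_lipschitz t0 ttau S1 (HS t t0 tr) C1 C2 i2.
  by apply: b1; rewrite t0 lexx.
have cauchy e : 0 < e -> exists2 d, 0 < d & forall s t, r / 2 <= t -> r - d < t -> t <= s -> s < r -> `|w s - w t| <= e.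
  move=> e0; have pk : 0 < (r / 2) `^ (1 - mu) by exact: powR_gt0.
  have e'0 : 0 < (r / 2) `^ (1 - mu) * e / K by rewrite divr_gt0// mulr_gt0.
  have [d d0 Hd] := shift_bound _ e'0; exists d => // s t rt dt ts sr.
  have [->|st] := eqVneq s t; first by rewrite subrr normr0 ltW.
  have h0 : 0 < s - t by rewrite subr_gt0 lt_neqAle eq_sym st.
  have := Hd (s - t) t h0; rewrite [t + (s - t)]addrC subrK [K * _]mulrC divfK ?gt_eqF// => H.
  have hd : s - t < d by move: dt sr; forget; lra.
  have t0 : 0 < t by move: rt r0; forget; lra.
  have {}H := H hd t0 sr.
  rewrite -(ler_pM2l pk); apply: le_trans H; rewrite ler_wpM2r// powR_le_base//; [rewrite subr_ge0 ltW//|exact: ltW].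
pose tn n := r - r / 2 * hpow n.
have tn1 n : r / 2 <= tn n < r.
  have h1 := hpow_gt0 (R := R) n; have h2 := hpow_le1 (R := R) n.
  have := mulr_gt0 rh0 h1; have : r / 2 * hpow n <= r / 2 by rewrite ger_pMr.
  by rewrite /tn; move: r0; forget; apply/andP; lra.
have tnmono n k : (n <= k)%N -> tn n <= tn k.
  move=> nk; rewrite /tn lerD2l lerN2 ler_wpM2l ?(ltW rh0)//.
  by rewrite -(subnKC nk) hpowD ger_pMr ?hpow_gt0// hpow_le1.
have tnlim d : 0 < d -> exists n, r - d < tn n.
  move=> d0; have d2 : 0 < d / 2 by rewrite divr_gt0.
  have [n Hn] := hpow_small (r / 2) d2; exists n; move: Hn d0; rewrite /tn; forget; lra.
have [ws Hws] : exists ws, forall e, 0 < e -> exists n, forall k, (n <= k)%N -> `|w (tn k) - ws| <= e.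
  apply: cauchy_limit => e e0; have [d d0 Hd] := cauchy e e0; have [n Hn] := tnlim d d0.
  exists n => k nk; have /andP[a1 a2] := tn1 n; have /andP[b1 b2] := tn1 k.
  by apply: Hd => //; exact: tnmono.
have wlim : left_limit r w ws.
  move=> e e0; have e2 : 0 < e / 2 by rewrite divr_gt0.
  have [d d0 Hd] := cauchy _ e2; exists (Num.min d (r / 2)); first by rewrite lt_min d0.
  move=> t t0 tr; rewrite ltrBlDr -ltrBlDl lt_min => /andP[td tr2].
  have [n1 Hn1] := Hws _ e2; have rt : 0 < r - t by move: tr; forget; lra.
  have [n2 Hn2] := tnlim _ rt.
  have hk : t <= tn (maxn n1 n2).
    by apply: (@le_trans _ _ (tn n2)); [move: Hn2; forget; lra|apply: tnmono; rewrite leq_max leqnn orbT].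
  have /andP[_ b2] := tn1 (maxn n1 n2).
  have x1 : `|w (tn (maxn n1 n2)) - w t| <= e / 2 by apply: Hd => //; move: td tr2; forget; lra.
  have x2 := Hn1 (maxn n1 n2) (leq_maxl _ _).
  have -> : w t - ws = (w (tn (maxn n1 n2)) - ws) - (w (tn (maxn n1 n2)) - w t) by lmod_eq R.
  by apply: (le_trans (ler_normB _ _)); move: x1 x2; forget; lra.
have r2tau : r / 2 <= tau by move: rtau r0; forget; lra.
have confp t : r / 2 <= t -> t < r -> ile j mu (j (w t) - j us) M /\ `|w t - us| <= (r / 2) `^ (mu - 1) * M.
  move=> rt tr; have t0 : 0 < t by move: rt r0; forget; lra.
  have [C _ _] := conf t t0 tr; have tt : 0 < t <= t by rewrite t0 lexx.
  have [c1 c2] := C t tt; rewrite -Hw//; split=> //; apply: (le_trans c2).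
  by rewrite ler_wpM2r ?(ltW M0)// powR_le_basen//; move: mu1; forget; lra.
have wsM : ile j mu (j ws - j us) M.
  apply: (@ile_lim _ _ _ _ _ _ (fun n => j (w (tn n)) - j us)) => e e0.
  have Cn0 : 0 < Cn by exact: lt_le_trans ltr01 Cn1.
  have [n Hn] := Hws _ (divr_gt0 e0 Cn0); exists n; have /andP[a1 a2] := tn1 n.
  split; last by have [] := confp _ a1 a2.
  have -> : j ws - j us - (j (w (tn n)) - j us) = j (ws - w (tn n)) by rewrite [j (ws - _)]linearB; lmod_eq R.
  by apply: (le_trans (HCn _)); rewrite mulrC -ler_pdivlMr// distrC; exact: Hn.
have wsM' : `|ws - us| <= (r / 2) `^ (mu - 1) * M.
  apply/ler_addgt0Pr => e e0; have [n Hn] := Hws e e0; have /andP[a1 a2] := tn1 n.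
  have [_ c2] := confp _ a1 a2; have := Hn n (leqnn n) => c3.
  have -> : ws - us = (w (tn n) - us) - (w (tn n) - ws) by lmod_eq R.
  by apply: (le_trans (ler_normB _ _)); move: c2 c3; forget; lra.
have Vws : V (j ws) by exact: HV.
have duG t : 0 < t -> t < r -> du t = G (w t) - B (w t).
  move=> t0 tr; have tt : 0 < t <= t by rewrite t0 lexx.
  by rewrite -(frozen_eq (HS t t0 tr) tt) addrK.
have ulim : left_limit r u (j ws).
  move=> e e0; have Cn0 : 0 < Cn by exact: lt_le_trans ltr01 Cn1.
  have [d d0 Hd] := wlim _ (divr_gt0 e0 Cn0); exists d => // t t0 tr td.
  by rewrite Hw// -linearB (le_trans (HCn _))// mulrC -ler_pdivlMr//; exact: Hd.
have dulim : left_limit r du (G ws - B ws).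
  move=> e e0.
  have pk : 0 < (r / 2) `^ (1 - mu) by exact: powR_gt0.
  pose k0 := mu / (2 * CL) * Cj / (r / 2) `^ (1 - mu) + CB.
  have k00 : 0 < k0.
    have : 0 < mu / (2 * CL) * Cj / (r / 2) `^ (1 - mu) by rewrite divr_gt0// mulr_gt0//; [rewrite divr_gt0// mulr_gt0//|exact: lt_le_trans ltr01 Cj1].
    by move: CB1; rewrite /k0; forget; lra.
  have [d d0 Hd] := wlim _ (divr_gt0 e0 k00); exists (Num.min d (r / 2)); first by rewrite lt_min d0.
  move=> t t0 tr; rewrite ltrBlDr -ltrBlDl lt_min => /andP[td tr2].
  have rt : r / 2 <= t by move: tr2; forget; lra.
  have [c1 c2] := confp t rt tr.
  have dt : r - d < t by move: td; forget; lra.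
  have x1 := Hd t t0 tr dt.
  have hh : 0 < r / 2 <= tau by rewrite rh0.
  have i1 : ile j mu (j (w t) - j ws) (Cj * `|w t - ws|) by rewrite -linearB; exact: HCj mu01'.
  have i2 : `|w t - ws| <= (r / 2) `^ (mu - 1) * (Cj * `|w t - ws|).
    rewrite mulrA ler_peMl// mulr_ege1//.
    rewrite -[mu - 1]opprB powRN invf_ge1//; apply: powR_le1; first by rewrite subr_ge0 ltW.
    by rewrite rh0 (le_trans r2tau).
  have x2 := HG hh c1 wsM c2 wsM' i1 i2.
  rewrite duG//; have -> : G (w t) - B (w t) - (G ws - B ws) = (G (w t) - G ws) - B (w t - ws) by rewrite [B (w t - _)]linearB; lmod_eq R.
  apply: (le_trans (ler_normB _ _)).
  have x3 : `|G (w t) - G ws| <= mu / (2 * CL) * Cj / (r / 2) `^ (1 - mu) * `|w t - ws|.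
    by rewrite [leRHS]mulrAC ler_pdivlMr// [leLHS]mulrC; apply: (le_trans x2); rewrite [leLHS]mulrA.
  apply: (@le_trans _ _ (k0 * `|w t - ws|)); last by rewrite mulrC -ler_pdivlMr.
  by rewrite /k0 mulrDl; apply: lerD => //; exact: HCB.
exists (close_at r u (j ws)), (close_at r du (G ws - B ws)), (close_at r w ws).
split; last by move=> t _ tr; rewrite close_at_lt.
split.
- split.
  + move=> t /andP[t0 tr]; rewrite /close_at; case: ltP => // tr'; exact: Hw.
  + by apply: rsd_close => // T T0' Tr; have [[]] := HS T T0' Tr.
  + apply: (@wC_close _ _ _ _ _ _ (K * N)) => // T T0' Tr; have [_ _ h] := conf T T0' Tr; split=> //.
    by have [[]] := HS T T0' Tr.
  + apply: (@wC_close _ _ _ _ _ _ (K * N + r `^ (1 - mu) * `|us|)) => // T T0' Tr; have [_ h _] := conf T T0' Tr.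
    split; first by have [[]] := HS T T0' Tr.
    move=> t /andP[t0 tT]; rewrite -[w t](subrK us).
    apply: (@le_trans _ _ (t `^ (1 - mu) * (`|w t - us| + `|us|))).
      by rewrite ler_wpM2l ?powR_ge0// ler_normD.
    rewrite mulrDr; apply: lerD; first by apply: h; rewrite t0.
    by rewrite ler_wpM2r// powR_le_base//; [rewrite subr_ge0 ltW//|exact: ltW|exact: ltW (le_lt_trans tT Tr)].
  + have [[_ _ _ _ c0] _ _] := HS _ rh0 rhr; move=> e e0; have [d d0 Hd] := c0 e e0.
    exists (Num.min d (r / 2)); first by rewrite lt_min d0.
    move=> t /andP[t0 tr]; rewrite lt_min => /andP[td tr2].
    have tr' : t < r by move: tr2 rhr; forget; lra.
    by rewrite !close_at_lt//; apply: Hd => //; rewrite t0 ltW.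
- move=> t /andP[t0 tr]; rewrite /close_at; case: ltP => // tr'.
  have [t0'|t0'] := ltP 0 t.
    by have [_ h _] := HS t t0' tr'; apply: h; rewrite t0 lexx.
  have -> : t = 0 by apply/eqP; rewrite eq_le t0 t0'.
  by have [_ h _] := HS _ rh0 rhr; apply: h; rewrite lexx ltW.
- move=> t /andP[t0 tr]; rewrite /close_at; case: ltP => // tr'.
    by rewrite /du subrK.
  by rewrite /frozen; lmod_eq R.
Qed.

End Dynamics.

(** * Stability *)

Section MaximalSolutions.
Context {R : realType} {E0 E1 : completeNormedModType R} (j : {linear E1 -> E0}).
Hypothesis jc : continuous j.
Hypothesis ji : injective j.
Variable mu : R.
Hypothesis mu01 : 0 < mu < 1.
Variables (V : set E0) (A : E0 -> {linear E1 -> E0}) (F1 F2 : E0 -> E0).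
Implicit Types (T h r : R) (x : E0) (u v : R -> E0) (tp : \bar R).

Lemma maximal_nsol x tp u T : maximal_solution j mu V A F1 F2 x tp u -> 0 < T -> (T%:E < tp)%E ->
  exists du w, nsol j mu V A F1 F2 T u du w /\ u 0 = x.
Proof. by move=> [_ H _] T0 Ttp; apply/(solution_nsol jc) => //; exact: H. Qed.

(** A solution extending the translate, pasted to the original one, would extend the
    maximal solution. *)
Lemma maximal_shift x tp u h : maximal_solution j mu V A F1 F2 x tp u ->
  0 < h -> (h%:E < tp)%E ->
  maximal_solution j mu V A F1 F2 (u h) (tp - h%:E)%E (fun t => u (t + h)).
Proof.
move=> Hmax h0 htp; have [tp0 Hsol Hend] := Hmax.
have sub T : (T%:E < tp - h%:E)%E -> ((h + T)%:E < tp)%E.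
  move: {Hmax tp0 Hsol Hend} htp; case: tp => [r| |] //=; rewrite ?lte_fin ?ltry//.
  by move=> _ ?; lra.
split.
- move: {Hmax tp0 Hsol Hend sub} htp; case: tp => [r| |] //=; rewrite ?lte_fin ?ltry//.
  by move=> hr; rewrite subr_gt0.
- move=> T T0 /sub hT; have hT0 : 0 < h + T by lra.
  have [du [w [H _]]] := maximal_nsol Hmax hT0 hT.
  apply/(solution_nsol jc) => //; do 2 eexists; split; first exact: (nsol_shift mu01 h0 T0 H).
  by rewrite add0r.
- move=> T v; case: tp Hmax tp0 Hsol Hend htp sub => [r| |] //= Hmax tp0 Hsol Hend; rewrite !lte_fin lee_fin => hr sub rT Hv Heq.
  have T0 : 0 < T by lra.
  have [dv [wv [Nv v0]]] := (solution_nsol jc mu V A F1 F2 (u h) v T0).1 Hv.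
  (* The pieces are joined at a time at which both are known to be solutions. *)
  pose S := h + (r - h) / 2.
  have hS : h < S by rewrite /S; lra.
  have S0 : 0 < S by lra.
  have Sr : S < r by rewrite /S; lra.
  have ShT : S <= h + T by lra.
  have Srf : (S%:E < r%:E)%E by rewrite lte_fin.
  have [du [w [Nu u0]]] := maximal_nsol Hmax S0 Srf.
  have vS : v (S - h) = u S.
    by rewrite Heq ?subrK// ?lte_fin; lra.
  have [dU [W NU]] := nsol_paste ji mu01 h0 hS ShT Nu Nv vS.
  have hT0 : 0 < h + T by lra.
  apply: (Hend (h + T) (paste S u (fun t => v (t - h)))).
  + by rewrite lee_fin; lra.
  + apply/(solution_nsol jc) => //; exists dU, W; split=> //.
    by rewrite paste_l// ltW.
  + move=> t t0; rewrite lte_fin => tr; rewrite /paste; case: (leP t S) => // St.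
    by rewrite Heq ?subrK// ?lte_fin; lra.
Qed.

End MaximalSolutions.

Section Balls.
Context {R : realType} {E0 E1 : completeNormedModType R} (j : {linear E1 -> E0}).
Hypothesis jc : continuous j.
Variables (nu : R) (us : E1).
Hypothesis nu01 : 0 <= nu <= 1.

Lemma iball_ile x d : iball j nu (j us) d x -> ile j nu (x - j us) d.
Proof.
move=> [cx xd]; apply: ile_le (ltW xd); apply: ci_ile.
by apply: ciB => //; exact: ci_j.
Qed.

Lemma ile_iball x N d : cont_interp j nu x -> ile j nu (x - j us) N -> N < d -> iball j nu (j us) d x.
Proof. by move=> cx /ile_inorm h Nd; split=> //; exact: le_lt_trans Nd. Qed.

End Balls.

Lemma positive_lower_bound (R : realType) (s : seq R) : all (fun x => 0 < x) s ->
  exists2 d, 0 < d & all (fun x => d <= x) s.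
Proof.
elim: s => [|x s IHs] /= => [_|/andP[x0 /IHs[d d0 Hd]]]; first by exists 1.
exists (Num.min x d); first by rewrite lt_min x0.
rewrite ge_min lexx /=; apply: sub_all Hd => y; apply: le_trans.
by rewrite ge_min lexx orbT.
Qed.

Lemma half_bound (R : realType) (C d e : R) : 0 < C -> 0 < e -> d <= e / (2 * C) -> C * d < e.
Proof. by move=> C0 e0; rewrite ler_pdivlMr ?mulr_gt0//; lra. Qed.

Section Transfer.
Context {R : realType} {E0 E1 : completeNormedModType R} (j : {linear E1 -> E0}).
Hypothesis jc : continuous j.
Hypothesis ji : injective j.
Variables mu mubar : R.
Hypothesis mu01 : 0 < mu < 1.
Hypothesis mubar1 : mu <= mubar <= 1.
Variables (V : set E0) (A : E0 -> {linear E1 -> E0}) (F1 F2 : E0 -> E0) (us : E1).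
Implicit Types (u du : R -> E0) (w : R -> E1) (t T N : R).
Local Notation sol := (nsol j mu V A F1 F2).
Variables tau delta C : R.
Hypothesis tau0 : 0 < tau.
Hypothesis delta0 : 0 < delta.
Hypothesis C1 : 1 <= C.
Hypothesis embed : forall x N, ile j mubar x N -> ile j mu x (C * N).
Hypothesis stay : forall T u du w N t, 0 < T -> T <= tau -> sol T u du w ->
  N <= delta -> ile j mu (u 0 - j us) N -> 0 < t <= T -> ile j mu (u t - j us) (C * N).
Hypothesis smooth : forall u du w N, sol tau u du w ->
  N <= delta -> ile j mu (u 0 - j us) N -> ile j mubar (u tau - j us) (C * N).
Hypothesis persist : forall T u du w N t, 0 < T -> T <= tau -> sol T u du w ->
  0 < N -> N <= delta -> ile j mubar (u 0 - j us) N -> 0 < t <= T -> ile j mubar (u t - j us) (C * N).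
Hypothesis extend : forall r u, 0 < r -> r <= tau ->
  (forall T, 0 < T -> T < r -> exists du w, sol T u du w) -> ile j mu (u 0 - j us) delta ->
  exists U dU W, sol r U dU W /\ forall t, 0 <= t -> t < r -> U t = u t.

Let C0 : 0 < C. Proof. exact: lt_le_trans C1. Qed.
Let mu01' : 0 <= mu <= 1. Proof. by case/andP: mu01 => h1 h2; rewrite !ltW. Qed.
Let mubar01 : 0 <= mubar <= 1.
Proof. by case/andP: mubar1 => h1 h2; rewrite h2 (le_trans _ h1)//; case/andP: mu01' . Qed.

Let ball_le nu x d e : iball j nu (j us) d x -> d <= e -> iball j nu (j us) e x.
Proof. by move=> [h1 h2] de; split=> //; exact: lt_le_trans de. Qed.

Let ci_sol T u du w : 0 < T -> sol T u du w -> forall nu, 0 <= nu <= 1 -> cont_interp j nu (u T).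
Proof. by move=> Tp [[ujw _ _ _ _] _ _] nu nu01; rewrite ujw ?Tp ?lexx//; exact: ci_j. Qed.

Let ball_embed x d e : iball j mubar (j us) d x -> C * d < e -> iball j mu (j us) e x.
Proof.
move=> Hx de; apply: (ile_iball _ (embed (iball_ile jc mubar01 Hx))) => //.
case: Hx => h _; have /andP[g1 g2] := mubar1; have /andP[g3 _] := mu01'.
exact: (ci_embed jc g3 g1 g2 h).
Qed.

(** Up to [tau] the solution is close in E_mubar by persistence; at a later time [t]
    it is smoothed from its value at [t - tau], which is close in E_mu by stability. *)
Lemma stable_mubar_of_stable_mu :
  stable_in j mu V A F1 F2 mu us -> stable_in j mu V A F1 F2 mubar us.
Proof.
move=> Hst e e0; have cpos := C0; have dpos := delta0.
have eC : 0 < e / (2 * C) by rewrite divr_gt0// mulr_gt0.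
have [|e1 e10 /= /and3P[e1a e1b _]] := @positive_lower_bound R [:: delta; e / (2 * C)].
  by rewrite /= dpos eC.
have [dm dm0 Hdm] := Hst e1 e10.
have [|d d0 /= /and4P[da db dc _]] := @positive_lower_bound R [:: delta; e / (2 * C); dm / (2 * C)].
  by rewrite /= dpos eC divr_gt0// mulr_gt0.
exists d => // x0 Hx0 tp u Hmax.
have [tpE Hu] := Hdm x0 (ball_embed Hx0 (half_bound cpos dm0 dc)) tp u Hmax; split=> // t t0.
have Hn T : 0 < T -> exists du w, sol T u du w /\ u 0 = x0.
  by move=> Tp; apply: maximal_nsol Hmax Tp _ => //; rewrite tpE ltry.
have Cd := half_bound cpos e0 db.
have de : d <= e by apply: le_trans (ltW Cd); rewrite ler_peMl// ltW.
move: t0; rewrite le_eqVlt => /predU1P[<-|t0].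
  by have [du [w [_ ->]]] := Hn 1 ltr01; exact: ball_le de.
have [du [w [Nu u0]]] := Hn t t0; have ciu := ci_sol t0 Nu mubar01.
have [ttau|taut] := leP t tau.
  apply: (ile_iball ciu (persist t0 ttau Nu d0 da _ _) Cd); last by rewrite t0 lexx.
  by rewrite u0; exact: iball_ile Hx0.
have h0 : 0 < t - tau by rewrite subr_gt0.
have Ns : sol tau (fun r => u (r + (t - tau))) (fun r => du (r + (t - tau))) (fun r => w (r + (t - tau))).
  by apply: nsol_shift => //; rewrite subrK.
have i1 : ile j mu (u (0 + (t - tau)) - j us) e1.
  by rewrite add0r; apply: iball_ile => //; apply: Hu; exact: ltW.
have := smooth Ns e1a i1; rewrite /= [tau + _]addrC subrK => h.
exact: (ile_iball ciu h (half_bound cpos e0 e1b)).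
Qed.

(** The solution lives beyond [tau] since it would otherwise extend to its end point.
    Its value at [tau] is close in E_mubar, and stability there governs the maximal
    solution that starts from that value. *)
Lemma stable_mu_of_stable_mubar :
  stable_in j mu V A F1 F2 mubar us -> stable_in j mu V A F1 F2 mu us.
Proof.
move=> Hst e e0; have cpos := C0; have dpos := delta0; have tpos := tau0.
have eC : 0 < e / (2 * C) by rewrite divr_gt0// mulr_gt0.
have [db db0 Hdb] := Hst _ eC.
have [|d d0 /= /and4P[da dc dd _]] := @positive_lower_bound R [:: delta; e / (2 * C); db / (2 * C)].
  by rewrite /= dpos eC divr_gt0// mulr_gt0.
exists d => // x0 Hx0 tp u Hmax.
have Cd := half_bound cpos e0 dc.
have de : d <= e by apply: le_trans (ltW Cd); rewrite ler_peMl// ltW.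
have u0x0 : u 0 = x0.
  have [T Tp0 Ttp] : exists2 T : R, 0 < T & (T%:E < tp)%E.
    have [tp0 _ _] := Hmax; case: tp tp0 {Hmax} => [r| |] //=; rewrite ?lte_fin => r0; last by exists 1; rewrite ?ltry.
    by exists (r / 2); rewrite ?divr_gt0// lte_fin ltr_pdivrMr// ltr_pMr// ltr1n.
  by have [du [w [_]]] := maximal_nsol jc Hmax Tp0 Ttp.
have iu0 : ile j mu (u 0 - j us) d by rewrite u0x0; exact: iball_ile Hx0.
have tautp : (tau%:E < tp)%E.
  have [tp0 _ Hend] := Hmax; rewrite ltNge; apply/negP => tptau.
  case: tp tp0 Hmax Hend tptau => [r| |] //; rewrite lte_fin lee_fin => r0 Hmax Hend rtau.
  have [T Tp Tr|U [dU [W [NU UE]]]] := extend r0 rtau _ (ile_le iu0 da).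
    have Tr' : (T%:E < r%:E)%E by rewrite lte_fin.
    by have [du [w [h _]]] := maximal_nsol jc Hmax Tp Tr'; exists du, w.
  apply: (Hend r U (lexx _)); last by move=> t t0; rewrite lte_fin; exact: UE.
  by apply/(solution_nsol jc) => //; exists dU, W; split=> //; rewrite UE.
have Hn T : 0 < T -> T <= tau -> exists du w, sol T u du w.
  move=> Tp Ttau; have Ttp : (T%:E < tp)%E by apply: le_lt_trans tautp; rewrite lee_fin.
  by have [du [w [h _]]] := maximal_nsol jc Hmax Tp Ttp; exists du, w.
have [du [w Nu]] := Hn tau tpos (lexx tau).
have butau : iball j mubar (j us) db (u tau).
  exact: (ile_iball (ci_sol tpos Nu mubar01) (smooth Nu da iu0) (half_bound cpos db0 dd)).
have [tpE Hu] := Hdb _ butau _ _ (maximal_shift jc ji mu01 Hmax tpos tautp).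
split; first by move: tpE; clear; case: tp.
move=> t; rewrite le_eqVlt => /predU1P[<-|t0].
  by rewrite u0x0; exact: ball_le de.
have [ttau|taut] := leP t tau.
  have [du' [w' Nu']] := Hn t t0 ttau; have tt : 0 < t <= t by rewrite t0 lexx.
  exact: (ile_iball (ci_sol t0 Nu' mu01') (stay t0 ttau Nu' da iu0 tt) Cd).
have := Hu (t - tau); rewrite subr_ge0 subrK => /(_ (ltW taut)) bt.
by apply: (ball_embed bt); apply: half_bound.
Qed.

End Transfer.

Theorem proposition3p1 (R : realType) (E0 E1 : completeNormedModType R)
    (j : {linear E1 -> E0}) (hj : dense_embedding j)
    (mu : R) (hmu : 0 < mu < 1)
    (V : set E0) (hV : iopen j mu V)
    (A : E0 -> {linear E1 -> E0}) (F1 F2 : E0 -> E0)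
    (hAF1 : hyp_quasilinear j mu V A F1)
    (beta : R) (m : nat) (betas rhos : 'I_m -> R)
    (hF2 : hyp_semilinear j mu V F2 beta betas rhos)
    (mubar : R) (hmubar : beta <= mubar < 1)
    (us : E1) (hVus : V (j us))
    (hus : equilibrium j A F1 F2 us) :
  stable_in j mu V A F1 F2 mu us <-> stable_in j mu V A F1 F2 mubar us.
Proof.
have [ji jc _] := hj; have /andP[mu0 mu1] := hmu.
have [/andP[mb b1] _ _ _] := hF2; have /andP[bmb mb1] := hmubar.
have [Vci _] := hV; have hreg := hAF1.1 _ hVus; have Bc := hreg.1.
have mle : mu <= mubar := le_trans (ltW mb) bmb.
have mmb : mu <= mubar < 1 by rewrite mle.
have mmb' : mu <= mubar <= 1 by rewrite mle ltW.
have mm : mu <= mu <= 1 by rewrite lexx ltW.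
have [T0 T00 [CL CL1 HL]] := max_reg_uniform jc ji hmu hreg.
have cl0 : 0 < CL := lt_le_trans ltr01 CL1.
have kap0 : 0 < mu / (2 * CL) by rewrite divr_gt0// mulr_gt0.
have [M [tau' [M0 tau'0 [HV HG']]]] := frozen_contraction jc hmu hV hAF1 hF2 hVus kap0.
have [|tau tau0 /= /and4P[tauT tau1 tautau' _]] := @positive_lower_bound R [:: T0; 1; tau'].
  by rewrite /= T00 tau'0 ltr01.
have HG s w1 w2 P : 0 < s <= tau ->
   ile j mu (j w1 - j us) M -> ile j mu (j w2 - j us) M ->
   `|w1 - us| <= s `^ (mu - 1) * M -> `|w2 - us| <= s `^ (mu - 1) * M ->
   ile j mu (j w1 - j w2) P -> `|w1 - w2| <= s `^ (mu - 1) * P ->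
   s `^ (1 - mu) * `|frozen j A F1 F2 us w1 - frozen j A F1 F2 us w2| <= mu / (2 * CL) * P.
  by move=> /andP[s0 st]; apply: HG'; rewrite s0 (le_trans st).
have consts : [/\ 1 <= CL, 0 < M, 0 < tau, tau <= T0 & tau <= 1] by [].
have [Kl [Ml [Kl0 Ml0 Hlip]]] := frozen_lipschitz jc hmu hV hAF1 hF2 hVus hmubar.
have [c c1 Hc] := ile_embed jc.
have Hcmu x N : ile j mubar x N -> ile j mu x (c * N) by apply: Hc => //; exact: ltW.
have [K2 [d1 [K20 d10 Hpers]]] :=
  persistence jc hmu Vci hVus hus Bc consts HL HG mmb Kl0 Ml0 c1 Hcmu Hlip.
have sm := smoothing jc hmu Vci hVus hus consts HL HG.
have closes := solution_closes jc ji hmu Vci hVus hus Bc consts HL HV HG.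
have k0 : 0 <= mu^-1 * (4 * CL) by rewrite mulr_ge0 ?invr_ge0 ?(ltW mu0)// mulr_ge0// ltW.
have [K' K'1 K'E] : exists2 K', 1 <= K' & K' = 1 + mu^-1 * (4 * CL).
  by exists (1 + mu^-1 * (4 * CL)); rewrite ?lerDl.
have K'0 : 0 < K' := lt_le_trans ltr01 K'1.
have [|delta delta0 /= /and3P[da db _]] := @positive_lower_bound R [:: M / 4 / (K' * K'); d1].
  by rewrite /= d10 !divr_gt0// mulr_gt0.
have smallP N : N <= delta -> 0 <= N -> small_start mu CL M N /\ small_start mu CL M (K' * N).
  move=> Nd N0; have h : N * (K' * K') <= M / 4.
    by rewrite -ler_pdivlMr ?mulr_gt0//; exact: le_trans da.
  rewrite /small_start -K'E; split; last by rewrite mulrAC mulrC.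
  by apply: le_trans h; rewrite ler_wpM2l// ler_peMl// ltW.
pose q := tau `^ (mu - mubar).
have q0 : 0 <= q by exact: powR_ge0.
have qK0 : 0 <= q * K' by rewrite mulr_ge0// ltW.
have [C [C1 Cc CK2 CK' Cq]] : exists C, [/\ 1 <= C, c <= C, K2 <= C, K' <= C & q * K' <= C].
  exists (c + K2 + K' + q * K'); move: c1 K20 K'0 qK0; clear => *; split; lra.
have stay : forall T u du w N t, 0 < T -> T <= tau -> nsol j mu V A F1 F2 T u du w ->
    N <= delta -> ile j mu (u 0 - j us) N -> 0 < t <= T -> ile j mu (u t - j us) (C * N).
  move=> T u du w N t Tp Tt Nu Nd iN tT; have N0 := ile_ge0 iN; have [s1 _] := smallP N Nd N0.
  have := sm _ _ _ _ _ _ _ Tp Tt Nu iN s1 mm tT; rewrite subrr powRr0 mul1r -K'E => h.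
  by apply: (ile_le h); rewrite ler_wpM2r.
have smooth : forall u du w N, nsol j mu V A F1 F2 tau u du w ->
    N <= delta -> ile j mu (u 0 - j us) N -> ile j mubar (u tau - j us) (C * N).
  move=> u du w N Nu Nd iN; have N0 := ile_ge0 iN; have [s1 _] := smallP N Nd N0.
  have tt : 0 < tau <= tau by rewrite tau0 lexx.
  have := sm _ _ _ _ _ _ _ tau0 (lexx tau) Nu iN s1 mmb' tt; rewrite -K'E -/q mulrA => h.
  by apply: (ile_le h); rewrite ler_wpM2r.
have persist : forall T u du w N t, 0 < T -> T <= tau -> nsol j mu V A F1 F2 T u du w ->
    0 < N -> N <= delta -> ile j mubar (u 0 - j us) N -> 0 < t <= T -> ile j mubar (u t - j us) (C * N).
  move=> T u du w N t Tp Tt Nu N0 Nd iN tT.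
  have h := Hpers T u du w N Tp Tt Nu N0 (le_trans Nd db) iN t tT.
  by apply: (ile_le h); rewrite ler_wpM2r// ltW.
have extend : forall r u, 0 < r -> r <= tau ->
    (forall T, 0 < T -> T < r -> exists du w, nsol j mu V A F1 F2 T u du w) -> ile j mu (u 0 - j us) delta ->
    exists U dU W, nsol j mu V A F1 F2 r U dU W /\ forall t, 0 <= t -> t < r -> U t = u t.
  move=> r u r0 rt Hex iN; have [s1 s2] := smallP delta (lexx _) (ltW delta0).
  by apply: (closes r u delta) => //; rewrite -K'E.
have embed x N : ile j mubar x N -> ile j mu x (C * N).
  move=> h; have N0 := ile_ge0 h; apply: (ile_le (Hcmu x N h)).
  by rewrite ler_wpM2r.
split.
  exact: (stable_mubar_of_stable_mu jc hmu mmb' tau0 delta0 C1 embed smooth persist).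
exact: (stable_mu_of_stable_mubar jc ji hmu mmb' tau0 delta0 C1 embed stay smooth extend).
Qed.
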